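(* Let $a\ge0$ and $y_0\in L^2(-1,0)$, and let $y=y(x,t)$ be the solution of $$\begin{cases}\partial_t y+\partial_x^3 y+a\,\partial_x y=0, & x\in(-1,0),\ t>0,\\ y(0,t)=\partial_x y(0,t)=0, & t>0,\\ y(-1,t)=0, & t>0,\\ y(x,0)=y_0(x), & x\in(-1,0).\end{cases}$$ Then $y\in G^{\frac12,\frac32}([-1,0]\times[\varepsilon,T])$ for all $0<\varepsilon<T<\infty$. More precisely, for every $T\in(0,\infty)$ there exist positive constants $K,R_1,R_2$ such that $$|\partial_t^n\partial_x^p y(x,t)|\le K\,t^{-\frac{3n+p+3}{2}}\,\frac{(n!)^{\frac32}}{R_1^n}\,\frac{(p!)^{\frac12}}{R_2^p}\qquad\forall p,n\in\mathbb N,\ \forall t\in(0,T],\ \forall x\in[-1,0].$$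
   Context: $\mathbb N=\{0,1,2,\dots\}$. $G^{s_1,s_2}([x_1,x_2]\times[t_1,t_2])$ (functions Gevrey of order $s_1$ in $x$ and $s_2$ in $t$) is the set of $y\in C^\infty([x_1,x_2]\times[t_1,t_2])$ for which there are constants $C,R_1,R_2>0$ with $|\partial_x^{n_1}\partial_t^{n_2}y(x,t)|\le C\,(n_1!)^{s_1}(n_2!)^{s_2}/(R_1^{n_1}R_2^{n_2})$ for all $n_1,n_2\in\mathbb N$ and all $(x,t)$ in the rectangle. The solution is the mild solution $y(\cdot,t)=e^{tA}y_0$, where $Aw=-w'''-aw'$ with domain $D(A)=\{w\in H^3(-1,0):\ w(-1)=w(0)=w'(0)=0\}$ generates a contraction semigroup $(e^{tA})_{t\ge0}$ on $L^2(-1,0)$. The constants $K,R_1,R_2$ may depend on $a$, $T$ and $y_0$. *)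

(* Defs.v *)
From HB Require Import structures.
From mathcomp Require Import all_boot all_order all_algebra.
From mathcomp Require Import all_classical all_reals all_analysis.

Set Implicit Arguments.
Unset Strict Implicit.
Unset Printing Implicit Defensive.

Import Order.TTheory GRing.Theory Num.Theory.
Import numFieldNormedType.Exports.

Local Open Scope classical_set_scope.
Local Open Scope ring_scope.

(** * The space L^2(-1,0) *)

Definition lebI (R : realType) : {measure set (measurableTypeR R) -> \bar R} :=
  mrestr lebesgue_measure (measurable_itv `](-1 : R), 0[).

Fact one_le_two (R : realType) : (1 <= 2%:E :> \bar R)%E.
Proof. by rewrite lee_fin ler1n. Qed.

(** Elements are square-integrable functions, not classes: equality in
    L^2(-1,0) is [f = g %[ae lebI R]], and [L2norm] is a seminorm.  The values
    outside ]-1,0[ are irrelevant. *)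
Definition L2 (R : realType) := LfunType (lebI R) (one_le_two R).

Definition L2norm (R : realType) (f : L2 R) : R :=
  fine ('N[lebI R]_2%:E [EFin \o f])%E.

(** * Contraction semigroups on L^2(-1,0) *)

Record contraction_semigroup (R : realType) (S : R -> L2 R -> L2 R) : Prop := {
  semigroup_linear : forall (t k : R) (f g : L2 R), 0 <= t ->
    (S t (k *: f + g) : _ -> _) = k *: S t f + S t g %[ae lebI R];
  semigroup_contraction : forall (t : R) (f : L2 R), 0 <= t ->
    L2norm (S t f) <= L2norm f;
  semigroup0 : forall f : L2 R, (S 0 f : _ -> _) = f %[ae lebI R];
  semigroupD : forall (s t : R) (f : L2 R), 0 <= s -> 0 <= t ->
    (S (s + t) f : _ -> _) = S s (S t f) %[ae lebI R];
  semigroup_continuous : forall f : L2 R,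
    L2norm (S t f - f) @[t --> 0^'+] --> (0 : R) }.

(** Graph of the infinitesimal generator: [f] is in its domain, with image
    [g]. *)
Definition generator (R : realType) (S : R -> L2 R -> L2 R) (f g : L2 R) : Prop :=
  L2norm (h^-1 *: (S h f - f) - g) @[h --> 0^'+] --> (0 : R).

(** * The operator A w = - w''' - a w' *)

Definition C1c (R : realType) (phi : R -> R) : Prop :=
  [/\ forall x, derivable phi x 1,
      continuous (derive1 phi) &
      exists c d : R, [/\ -1 < c, d < 0 &
        forall x, x \notin `[c, d] -> phi x = 0]].

(** Test functions are of class C^1 with compact support in ]-1,0[, as in the
    definition of Sobolev spaces on an interval in Brezis, Functional Analysis,
    Sobolev Spaces and PDE, section 8.2. *)
Definition weak_derivative (R : realType) (u v : L2 R) : Prop :=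
  forall phi : R -> R, C1c phi ->
    \int[lebI R]_x (u x * derive1 phi x) = - \int[lebI R]_x (v x * phi x).

(** The value at a point of [-1,0] of an element of H^1(-1,0), that is, of its
    continuous representative on [-1,0]. *)
Definition has_trace (R : realType) (w : L2 R) (x l : R) : Prop :=
  exists u : R -> R,
    [/\ {within `[-1, 0], continuous u}, u = w %[ae lebI R] & u x = l].

(** Graph of [A], with domain
    {w in H^3(-1,0) : w(-1) = w(0) = w'(0) = 0}; [w1], [w2], [w3] are the weak
    derivatives of [w] of orders 1, 2, 3. *)
Definition kdv_op (R : realType) (a : R) (w g : L2 R) : Prop :=
  exists w1 w2 w3 : L2 R,
    [/\ weak_derivative w w1, weak_derivative w1 w2 & weak_derivative w2 w3] /\
    [/\ has_trace w (-1) 0, has_trace w 0 0, has_trace w1 0 0 &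
        (g : _ -> _) = - w3 - a *: w1 %[ae lebI R]].

(** [S t] is e^{tA}. *)
Definition kdv_semigroup (R : realType) (a : R) (S : R -> L2 R -> L2 R) : Prop :=
  contraction_semigroup S /\
  (forall f g : L2 R, generator S f g <-> kdv_op a f g).

(** * Smooth and Gevrey functions on rectangles *)

(** One-sided at the endpoints of the interval [I]. *)
Definition is_derive_within (R : realType) (I : set R) (f : R -> R) (x l : R) : Prop :=
  (f z - f x) / (z - x) @[z --> within I x^'] --> l.

(** [y] is C^infinity on the rectangle [I `*` J] (boundary included when it
    belongs to the rectangle), and there [D p n] is the partial derivative of
    [y] of order [p] in the first variable and [n] in the second one.  For
    nondegenerate intervals, [D] is determined by [y] on [I `*` J]. *)
Definition smooth_partials (R : realType) (I J : set R) (y : R -> R -> R)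
    (D : nat -> nat -> R -> R -> R) : Prop :=
  [/\ forall x t, I x -> J t -> D 0%N 0%N x t = y x t,
      forall p n, {within I `*` J, continuous (fun z : R * R => D p n z.1 z.2)},
      forall p n x t, I x -> J t ->
        is_derive_within I (fun z => D p n z t) x (D p.+1 n x t) &
      forall p n x t, I x -> J t ->
        is_derive_within J (fun s => D p n x s) t (D p n.+1 x t)].

Definition gevrey (R : realType) (s1 s2 x1 x2 t1 t2 : R) (y : R -> R -> R) : Prop :=
  exists2 D : nat -> nat -> R -> R -> R,
    smooth_partials `[x1, x2] `[t1, t2] y D &
    exists C R1 R2 : R, [/\ 0 < C, 0 < R1, 0 < R2 &
      forall (n1 n2 : nat) (x t : R), x \in `[x1, x2] -> t \in `[t1, t2] ->
        `|D n1 n2 x t| <=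
          C * ((n1`!%:R `^ s1) * (n2`!%:R `^ s2)) / (R1 ^+ n1 * R2 ^+ n2)].

(* Main.v *)
Require Import Defs.
From HB Require Import structures.
From mathcomp Require Import all_boot all_order all_algebra.
From mathcomp Require Import all_classical all_reals all_analysis measurable_realfun.
From mathcomp Require Import ring lra zify.
Set Implicit Arguments.
Unset Strict Implicit.
Unset Printing Implicit Defensive.
Import Order.TTheory GRing.Theory Num.Theory.
Import numFieldNormedType.Exports.
Local Open Scope classical_set_scope.
Local Open Scope ring_scope.

(** Multiplying the equation by (1 + x) y bounds the L^2 norm of y' at some time
    before t by t^(-1/2) times the norm of the data (Kato smoothing).  A
    mollification of y at scale d t^(1/2), dilated so as to be compactly
    supported, is at distance O(d) from y, and A maps it to norm
    O(d^(-2) t^(-3/2)); for d small the first error is absorbed by applying the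
    estimate again over the other half of the time, whence
    |A e^(tA)| <= C t^(-3/2) on L^2.  Writing e^(tA) as the n-th power of
    e^((t/n)A) gives |A^n e^(tA)|^2 <= L^n (3n)! t^(-3n), which bounds the time
    derivatives, and y_xxx = - y_t - a y_x converts three space derivatives into
    one time derivative. *)

(** The obstacle is that [S] is given abstractly: for data in L^2 nothing is known beforehand about
    the regularity of e^(tA)y0 in time or space. Energy computations are therefore made on orbits
    starting in the domain of A^2. There A w lies in the domain as well, hence is continuous, and
    w''' = - A w - a w' provides a C^3 representative for which integration by parts is classical.
    Smooth compactly supported functions give a dense set of such data, and closedness of the
    generator carries the estimates over to L^2.

    In the balance of scales, A has order three but the mollification costs only h^(-2), because one
    derivative is already paid for by the bound on y'. The sup norms of w, w', w'' are bounded by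
    |w| + |A w|, so pointwise estimates need one more power of A: this is the 3 added to 3n + p in
    the exponent of t. Half-integer exponents are kept out of the inductions by squaring norms and
    by using square roots of t and of factorials. *)

Definition has_derive (R : realType) (F f : R -> R) :=
  forall x : R, is_derive x 1 F (f x).

(** * Integration over ]-1,0[ *)

Section LebI.
Variable R : realType.
Implicit Types (f g F : R -> R) (u v w : L2 R).
Notation mu := (@lebesgue_measure R).
Notation II f := (\int[lebI R]_x (f x)).

Lemma measurable_IT : measurable (`](-1)%R, 0%R[%classic : set (measurableTypeR R)).
Proof. exact: measurable_itv. Qed.

Lemma lebI_setC : lebI R (~` `](-1)%R, 0%R[%classic) = 0%E.
Proof. by rewrite /lebI/= /mrestr setICl measure0. Qed.

Lemma ge0_lebI_integral f : measurable_fun setT f -> (forall x, 0 <= f x) ->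
  (\int[lebI R]_x (f x)%:E = \int[mu]_(x in `](-1)%R, 0%R[) (f x)%:E)%E.
Proof.
move=> mf f0.
rewrite (@ge0_negligible_integral _ _ _ (lebI R) setT (~` `](-1)%R, 0%R[%classic) _)//.
- rewrite setTD setCK; apply: eq_measure_integral => A mA AI.
  by rewrite /lebI/= /mrestr setIidl.
- by apply: measurableC; exact: measurable_IT.
- exact/measurable_EFinP.
- by move=> x _; rewrite lee_fin.
- exact: lebI_setC.
Qed.

Lemma lebI_integral f :
  (lebI R).-integrable setT (EFin \o f) ->
  (\int[lebI R]_x f x = \int[mu]_(x in `](-1)%R, 0%R[) f x).
Proof.
move=> intf; rewrite /Rintegral.
rewrite (@negligible_integral _ _ _ (lebI R) setT (~` `](-1)%R, 0%R[%classic) _)//.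
- congr fine; rewrite setTD setCK; apply: eq_measure_integral => A mA AI.
  by rewrite /lebI/= /mrestr setIidl.
- by apply: measurableC; exact: measurable_IT.
- exact: lebI_setC.
Qed.

Lemma continuous_measurable_funT f : continuous f ->
  measurable_fun setT (f : measurableTypeR R -> measurableTypeR R).
Proof. exact: continuous_measurable_fun. Qed.

Lemma continuous_integrable_cc f a b : continuous f ->
  mu.-integrable `[a, b] (EFin \o f).
Proof.
move=> cf; apply: continuous_compact_integrable; first exact: segment_compact.
exact: continuous_subspaceT.
Qed.

Lemma continuous_lebI_integrable f : continuous f ->
  (lebI R).-integrable setT (EFin \o f).
Proof.
move=> cf; have mf := continuous_measurable_funT cf.
apply/integrableP; split; first exact/measurable_EFinP.
have /integrableP[_] := @continuous_integrable_cc f (-1) 0 cf.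
apply: le_lt_trans; rewrite (@ge0_lebI_integral (fun x => `|f x|))//.
  apply: ge0_subset_integral => //.
  - apply/measurable_EFinP; apply: measurable_funTS; exact: measurableT_comp.
  - exact: subset_itv_oo_cc.
exact: measurableT_comp.
Qed.

Lemma is_derive_continuous F f : has_derive F f ->
  continuous F.
Proof.
move=> dF x; apply: differentiable_continuous; apply/derivable1_diffP.
exact: ex_derive.
Qed.

Lemma lebI_FTC F f : has_derive F f -> continuous f ->
  II f = F 0 - F (-1).
Proof.
move=> dF cf; have cF := is_derive_continuous dF.
rewrite lebI_integral; last exact: continuous_lebI_integrable.
rewrite Rintegral_itv_obnd_cbnd; last first.
  apply: (integrableS _ _ _ (continuous_integrable_cc (-1) 0 cf)) => //.
  exact: subset_itv_oo_cc.
rewrite Rintegral_itv_bndo_bndc; last first.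
  apply: (integrableS _ _ _ (continuous_integrable_cc (-1) 0 cf)) => //.
  exact: subset_itv_co_cc.
rewrite /Rintegral (@continuous_FTC2 _ f F)//.
- exact: continuous_subspaceT.
- split; first by move=> x _; exact: ex_derive.
  + exact/cvg_at_right_filter/cF.
  + exact/cvg_at_left_filter/cF.
- move=> x _; have dFx : is_derive x 1 F (f x) := dF x.
  by rewrite derive1E derive_val.
Qed.

End LebI.

(** * Inner product and norm of L^2(-1,0), and the weight 1 + x *)

Section L2.
Variable R : realType.
Implicit Types (f g F : R -> R) (u v w : L2 R).
Notation II f := (\int[lebI R]_x (f x)).

Lemma lebI_aeS (P Q : R -> Prop) : (forall x, P x -> Q x) ->
  {ae lebI R, forall x, P x} -> {ae lebI R, forall x, Q x}.
Proof. exact: (@filterS _ _ (ae_filter_ringOfSetsType (lebI R)) P Q). Qed.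

Lemma lebI_aeI (P Q : R -> Prop) : {ae lebI R, forall x, P x} ->
  {ae lebI R, forall x, Q x} -> {ae lebI R, forall x, P x /\ Q x}.
Proof. exact: (@filterI _ _ (ae_filter_ringOfSetsType (lebI R)) P Q). Qed.

Lemma Lfun2P f : measurable_fun setT f ->
  (lebI R).-integrable setT (EFin \o (fun x => f x ^+ 2)) ->
  f \in Lfun (lebI R) 2%:E.
Proof.
move=> mf /integrableP[mf2 intf]; rewrite inE; apply/andP; split; rewrite inE//=.
rewrite /finite_norm unlock /Lnorm poweR_lty//; apply: le_lt_trans intf.
rewrite ge0_le_integral//=.
- apply/measurable_EFinP; apply: (measurableT_comp (measurable_powR _)) => //.
  exact: measurableT_comp.
- apply/measurable_EFinP; apply: measurableT_comp => //.
  exact: measurable_funX.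
- by move=> x _; rewrite lee_fin powR_mulrn// normrX.
Qed.

Lemma L2addE u v x : (u + v) x = u x + v x. Proof. by []. Qed.
Lemma L2oppE u x : (- u) x = - u x. Proof. by []. Qed.
Lemma L2subE u v x : (u - v) x = u x - v x. Proof. by []. Qed.
Lemma L2scaleE (k : R) u x : (k *: u) x = k * u x. Proof. by []. Qed.

Lemma L2_measurable u : measurable_fun setT u.
Proof. by []. Qed.

Lemma L2_integrableM u v :
  (lebI R).-integrable setT (EFin \o (fun x => u x * v x)).
Proof. exact/Lfun1_integrable/Lfun2_mul_Lfun1/LfunP/LfunP. Qed.

Definition ip u v : R := II (fun x => u x * v x).

Lemma ipC u v : ip u v = ip v u.
Proof. by apply: eq_Rintegral => x _; rewrite mulrC. Qed.

Lemma ipDl u v w : ip (u + v) w = ip u w + ip v w.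
Proof.
rewrite -RintegralD//; [|exact: L2_integrableM|exact: L2_integrableM].
by apply: eq_Rintegral => x _; rewrite mulrDl.
Qed.

Lemma ipZl (k : R) u v : ip (k *: u) v = k * ip u v.
Proof.
rewrite -RintegralZl//; last exact: L2_integrableM.
by apply: eq_Rintegral => x _; rewrite mulrA.
Qed.

Lemma ipNl u v : ip (- u) v = - ip u v.
Proof. by rewrite -scaleN1r ipZl mulN1r. Qed.
Lemma ipBl u v w : ip (u - v) w = ip u w - ip v w.
Proof. by rewrite ipDl ipNl. Qed.
Lemma ipDr u v w : ip w (u + v) = ip w u + ip w v.
Proof. by rewrite !(ipC w) ipDl. Qed.
Lemma ipBr u v w : ip w (u - v) = ip w u - ip w v.
Proof. by rewrite !(ipC w) ipBl. Qed.
Lemma ipZr (k : R) u v : ip u (k *: v) = k * ip u v.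
Proof. by rewrite !(ipC u) ipZl. Qed.

Lemma L2norm_ge0 u : 0 <= L2norm u.
Proof. by rewrite fine_ge0// Lnorm_ge0. Qed.

Lemma L2normE u : (L2norm u)%:E = 'N[lebI R]_2%:E [EFin \o u]%E.
Proof. exact: finite_norm_fine. Qed.

Lemma L2norm_sqr u : L2norm u ^+ 2 = ip u u.
Proof.
apply: EFin_inj; rewrite -powR_mulrn ?L2norm_ge0// -poweR_EFin L2normE.
rewrite powR_Lnorm// /ip /Rintegral fineK; last first.
  by apply: integrable_fin_num => //; exact: L2_integrableM.
apply: eq_integral => x _ /=.
by rewrite powR_mulrn// -normrX ger0_norm ?sqr_ge0// expr2.
Qed.

Lemma L2normD u v : L2norm (u + v) <= L2norm u + L2norm v.
Proof. exact: ler_LnormD. Qed.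

Lemma L2normZ (k : R) u : L2norm (k *: u) = `|k| * L2norm u.
Proof. by apply: EFin_inj; rewrite EFinM !L2normE; exact: LnormZ. Qed.

Lemma L2normN u : L2norm (- u) = L2norm u.
Proof. by rewrite -scaleN1r L2normZ normrN1 mul1r. Qed.

Lemma L2norm0 : L2norm (0 : L2 R) = 0.
Proof. by rewrite -(scale0r 0) L2normZ normr0 mul0r. Qed.

Lemma L2normB u v : L2norm (u - v) <= L2norm u + L2norm v.
Proof. by rewrite -(L2normN v) L2normD. Qed.

Lemma L2norm_distC u v : L2norm (u - v) = L2norm (v - u).
Proof. by rewrite -opprB L2normN. Qed.

Lemma L2norm_subl u v w : L2norm (u - w) <= L2norm (u - v) + L2norm (v - w).
Proof. by have := L2normD (u - v) (v - w); rewrite addrA subrK. Qed.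

Lemma ip_le u v : `|ip u v| <= L2norm u * L2norm v.
Proof.
have := @hoelder _ _ _ (lebI R) u v 2 2 (@L2_measurable u) (@L2_measurable v).
have half : 2^-1 + 2^-1 = 1 :> R by rewrite [RHS]splitr !div1r.
move=> /(_ (ltr0n _ _) (ltr0n _ _) half); rewrite -!L2normE -EFinM => h.
have i := L2_integrableM u v.
rewrite -lee_fin; apply: le_trans h; rewrite Lnorm1.
rewrite EFin_normr_Rintegral//; apply: le_abse_integral => //.
by have /integrableP[] := i.
Qed.

(** Together with [ae_L2norm], this turns almost-everywhere identities into vanishing seminorms,
    which combine by the triangle inequality. *)
Lemma L2norm_ae u v : (u : R -> R) = v %[ae lebI R] -> L2norm (u - v) = 0.
Proof.
move=> uv; apply/eqP; rewrite -sqrf_eq0 L2norm_sqr; apply/eqP.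
rewrite /ip /Rintegral (@ae_eq_integral _ _ _ _ _ (cst 0%E))//.
- by rewrite integral_cst// mul0e.
- by have /integrableP[] := L2_integrableM (u - v) (u - v).
- by apply: lebI_aeS uv => x /= /(_ I) + _; rewrite /GRing.add /GRing.opp/= => ->; rewrite subrr mul0r.
Qed.

Lemma ae_L2norm u v : L2norm (u - v) = 0 -> (u : R -> R) = v %[ae lebI R].
Proof.
move=> /fine_Lnormr_eq0; apply: lebI_aeS => x /= /(_ I) + _.
by move/eqP; rewrite subr_eq0 => /eqP.
Qed.

Lemma bounded_Lfun2M (h : R -> R) u : measurable_fun setT h ->
  (forall x, `|h x| <= 1) -> (fun x => h x * u x) \in Lfun (lebI R) 2%:E.
Proof.
move=> mh h1; have mhu : measurable_fun setT (fun x => h x * u x).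
  by apply: measurable_funM => //; exact: L2_measurable.
apply: Lfun2P => //; apply: (le_integrable _ _ _ (L2_integrableM u u)) => //.
  by apply/measurable_EFinP; exact: measurable_funX.
move=> x _; rewrite lee_fin/= exprMn normrM -expr2 [leRHS]ger0_norm ?sqr_ge0//.
rewrite (ger0_norm (sqr_ge0 (u x))) -[leRHS]mul1r ler_wpM2r ?sqr_ge0//.
by rewrite normrX exprn_ile1.
Qed.

Lemma continuous_Lfun2 f : continuous f -> f \in Lfun (lebI R) 2%:E.
Proof.
move=> cf; apply: Lfun2P; first exact: continuous_measurable_funT.
by apply: continuous_lebI_integrable => x; apply: continuousM; exact: cf.
Qed.

(** Total, so that elements of L^2 can be written from bare functions; the default 0 is excluded
    through [toL2E] wherever values matter. *)
Definition toL2 f : L2 R :=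
  if pselect (f \in Lfun (lebI R) 2%:E) is left H then Lfun_Sub (one_le_two R) H
  else 0.

Lemma toL2E f : f \in Lfun (lebI R) 2%:E -> toL2 f = f :> (R -> R).
Proof. by rewrite /toL2; case: pselect. Qed.

Lemma toL2_continuous f : continuous f -> toL2 f = f :> (R -> R).
Proof. by move=> cf; apply/toL2E/continuous_Lfun2. Qed.

(** The weight 1 + x, truncated to [0,1]: elements of L^2 are functions on the whole line, and
    multiplication must be bounded there too. *)
Definition wt (x : R) : R := Num.max 0 (Num.min 1 (1 + x)).

Lemma wt_itv (x : R) : 0 <= wt x <= 1.
Proof. by rewrite /wt le_max lexx/= ge_max ler01/= ge_min lexx. Qed.

Lemma wtE (x : R) : -1 <= x <= 0 -> wt x = 1 + x.
Proof.
move=> /andP[x1 x0]; rewrite /wt min_r; last by rewrite gerDl.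
by rewrite max_r// -lerBlDl sub0r.
Qed.

Lemma continuous_wt : continuous wt.
Proof.
have c1 : continuous (fun x : R => 1 + x).
  by move=> x; apply: cvgD; [exact: cvg_cst|exact: cvg_id].
suff c : continuous (cst 0 \max (cst 1 \min (fun x : R => 1 + x))) by exact: c.
move=> x; apply: continuous_max; first exact: cst_continuous.
by apply: continuous_min; [exact: cst_continuous|exact: c1].
Qed.

Lemma wt_Lfun u : (fun x => wt x * u x) \in Lfun (lebI R) 2%:E.
Proof.
apply: bounded_Lfun2M; first by apply: continuous_measurable_funT; exact: continuous_wt.
by move=> x; have /andP[w0 w1] := wt_itv x; rewrite ger0_norm.
Qed.

Definition wtm u : L2 R := toL2 (fun x => wt x * u x).

Lemma wtmE u x : wtm u x = wt x * u x.
Proof. by rewrite /wtm toL2E ?wt_Lfun. Qed.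

Lemma wtmB u v : wtm (u - v) = wtm u - wtm v.
Proof. by apply/LfuneqP => x; rewrite L2subE !wtmE L2subE mulrBr. Qed.

Lemma ip_wtm u v : ip (wtm u) v = ip u (wtm v).
Proof. by apply: eq_Rintegral => x _; rewrite !wtmE mulrCA mulrA. Qed.

Lemma ip_wtm_ge0 u : 0 <= ip (wtm u) u.
Proof.
apply: Rintegral_ge0 => x _; rewrite wtmE -mulrA mulr_ge0//.
  by have /andP[] := wt_itv x.
by rewrite -expr2 sqr_ge0.
Qed.

Lemma L2norm_wtm u : L2norm (wtm u) <= L2norm u.
Proof.
rewrite -(@ler_pXn2r _ 2)// ?nnegrE ?L2norm_ge0// !L2norm_sqr.
apply: le_Rintegral => //; [exact: L2_integrableM|exact: L2_integrableM|].
move=> x _; rewrite !wtmE mulrACA -expr2 -[leRHS]mul1r ler_wpM2r//.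
  by rewrite -expr2 sqr_ge0.
by have /andP[w0 w1] := wt_itv x; rewrite exprn_ile1.
Qed.

End L2.

(** * Differential calculus on the whole line *)

Section RealCalculus.
Variable R : realType.
Implicit Types (f g F w : R -> R).

Lemma has_deriveP F f : has_derive F f <-> (forall x, derivable F x 1) /\ derive1 F = f.
Proof.
split=> [dF|[dF <-] x].
  split=> [x|]; first by have dFx := dF x; exact: ex_derive.
  apply/funext => x; have dFx : is_derive x 1 F (f x) := dF x.
  by rewrite derive1E derive_val.
by rewrite derive1E; apply: DeriveDef.
Qed.

Lemma has_derive_ext F f g : (forall x, f x = g x) -> has_derive F f -> has_derive F g.
Proof. by move=> fg dF x; rewrite -fg; exact: dF. Qed.

Lemma has_derive_cst (k : R) : has_derive (fun=> k) (fun=> 0).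
Proof. by move=> x; exact: is_derive_cst. Qed.

Lemma has_derive_id : has_derive (fun x : R => x) (fun=> 1).
Proof. by move=> x; exact: is_derive_id. Qed.

Lemma has_deriveD F G f g : has_derive F f -> has_derive G g ->
  has_derive (fun x => F x + G x) (fun x => f x + g x).
Proof. by move=> dF dG x; apply: is_deriveD; [exact: dF|exact: dG]. Qed.

Lemma has_deriveN F f : has_derive F f -> has_derive (fun x => - F x) (fun x => - f x).
Proof. by move=> dF x; apply: is_deriveN; exact: dF. Qed.

Lemma has_deriveB F G f g : has_derive F f -> has_derive G g ->
  has_derive (fun x => F x - G x) (fun x => f x - g x).
Proof. by move=> dF dG; apply: has_deriveD => //; exact: has_deriveN. Qed.

Lemma has_deriveM F G f g : has_derive F f -> has_derive G g ->
  has_derive (fun x => F x * G x) (fun x => f x * G x + F x * g x).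
Proof.
move=> dF dG x; have dFx : is_derive x 1 F (f x) := dF x.
have dGx : is_derive x 1 G (g x) := dG x.
have d := is_deriveM dFx dGx.
have -> : f x * G x + F x * g x = F x *: g x + G x *: f x.
  by rewrite addrC /GRing.scale/= (mulrC (f x)).
exact: d.
Qed.

Lemma has_deriveZ (k : R) F f : has_derive F f ->
  has_derive (fun x => k * F x) (fun x => k * f x).
Proof.
move=> dF; apply: has_derive_ext (has_deriveM (has_derive_cst k) dF) => x.
by rewrite mul0r add0r.
Qed.

Lemma has_derive_comp_affine (k l : R) F f : has_derive F f ->
  has_derive (fun x => F (k * x + l)) (fun x => k * f (k * x + l)).
Proof.
move=> dF x; have dFx : is_derive (k * x + l) 1 F (f (k * x + l)) := dF _.
have da : is_derive x 1 (fun x : R => k * x + l) k.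
  have := has_deriveD (has_deriveZ k has_derive_id) (has_derive_cst l).
  by move=> /(_ x); rewrite mulr1 addr0.
rewrite mulrC.
exact: (is_derive1_comp (f := F) (g := fun x : R => k * x + l) dFx da).
Qed.

Lemma has_derive_MVT F f (a b : R) : has_derive F f -> a < b ->
  exists2 c, a < c < b & F b - F a = f c * (b - a).
Proof.
move=> dF ab; have [|c|c cab ->] := @MVT _ F f a b ab; first by move=> x _; exact: dF.
  by apply: continuous_subspaceT; exact: is_derive_continuous dF.
by exists c => //; move: cab; rewrite in_itv.
Qed.

Lemma has_derive_ndecr F f (a b : R) : has_derive F f -> a <= b ->
  (forall x, a < x < b -> 0 <= f x) -> F a <= F b.
Proof.
move=> dF; rewrite le_eqVlt => /predU1P[->//|ab] f0.
have [c cab e] := has_derive_MVT dF ab.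
by rewrite -subr_ge0 e mulr_ge0 ?f0// subr_ge0 ltW.
Qed.

Lemma has_derive_cst_on F f (a b : R) : has_derive F f -> a <= b ->
  (forall x, a < x < b -> f x = 0) -> F a = F b.
Proof.
move=> dF; rewrite le_eqVlt => /predU1P[->//|ab] f0.
have [c cab e] := has_derive_MVT dF ab.
by apply/esym/eqP; rewrite -subr_eq0 e f0// mul0r.
Qed.

(* The discriminant of the nonnegative quadratic polynomial
   k |-> \int_x^y (w' - k)^2. *)
Lemma has_derive_increment_sqr w w1 v (x y : R) : has_derive w w1 ->
  has_derive v (fun z => w1 z ^+ 2) -> x <= y ->
  (w y - w x) ^+ 2 <= (y - x) * (v y - v x).
Proof.
move=> dw dv; rewrite le_eqVlt => /predU1P[->|xy].
  by rewrite !subrr expr0n mul0r.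
set k := (w y - w x) / (y - x).
have yx0 : 0 < y - x by rewrite subr_gt0.
have d : has_derive (fun z => v z - (2 * k) * w z + k ^+ 2 * z) (fun z => (w1 z - k) ^+ 2).
  apply: has_derive_ext (has_deriveD (has_deriveB dv (has_deriveZ (2 * k) dw))
    (has_deriveZ (k ^+ 2) has_derive_id)) => z; ring.
have := has_derive_ndecr d (ltW xy) (fun z _ => sqr_ge0 (w1 z - k)).
rewrite -subr_ge0 => h.
have ke : k * (y - x) = w y - w x by rewrite /k divfK// gt_eqF.
have : 0 <= (y - x) * (v y - v x - 2 * k * (w y - w x) + k ^+ 2 * (y - x)).
  by rewrite mulr_ge0 ?(ltW yx0)//; apply: le_trans h _; rewrite le_eqVlt; apply/orP; left; apply/eqP; ring.
rewrite -ke => h'; rewrite -subr_ge0; apply: le_trans h' _.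
by rewrite le_eqVlt; apply/orP; left; apply/eqP; ring.
Qed.

Lemma has_derive_locally_cst F f (a b x : R) : has_derive F f -> a < x < b ->
  (forall y, a < y < b -> F y = F x) -> f x = 0.
Proof.
move=> dF /andP[ax xb] Fc.
have dFx : is_derive x 1 F (f x) := dF x.
have : is_derive x 1 (fun=> F x : R) (f x).
  apply: near_eq_is_derive dFx.
  near=> y; rewrite Fc//.
  by apply/andP; split; near: y; [exact: lt_nbhsr|exact: lt_nbhsl].
by move=> d; have := @derive_val _ _ _ _ _ _ _ d; rewrite derive_cst.
Unshelve. all: by end_near. Qed.

End RealCalculus.

(** * Primitives, with or without compact support *)

Section Primitives.
Variable R : realType.
Implicit Types (f g F w : R -> R).
Notation mu := (@lebesgue_measure R).
Notation II f := (\int[lebI R]_x (f x)).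

Lemma continuous_primitive f : continuous f -> exists F, has_derive F f.
Proof.
move=> cf; pose G (b x : R) : R := \int[mu]_(t in `[b, x]) f t.
have dG (b x : R) : b < x -> is_derive x 1 (G b) (f x).
  move=> bx.
  have [|dF <-] := @continuous_FTC1_closed R f b x (x + 1) _ (continuous_integrable_cc _ _ cf) bx (cf x).
    by rewrite ltrDl.
  by rewrite derive1E; apply: DeriveDef.
have GB (b c z : R) : b <= c -> c <= z -> G b z - G b c = G c z.
  move=> bc cz; rewrite /G (@Rintegral_itvB R f (BLeft b) (BRight z) c)//; last exact: continuous_integrable_cc.
  rewrite Rintegral_itv_obnd_cbnd//.
  apply: (integrableS _ _ _ (continuous_integrable_cc c z cf)) => //.
  exact: subset_itv_oc_cc.
(* The integral from a base point is known to be differentiable only to the right of it, so the base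
   point moves left with x. Subtracting the value at 0 makes the result independent of the base
   point, which is [FE]. *)
pose F x := G (- `|x| - 1) x - G (- `|x| - 1) 0.
have FE (b x : R) : b <= - `|x| - 1 -> F x = G b x - G b 0.
  move=> bx; have x0 := normr_ge0 x.
  have xx : - `|x| - 1 <= x by have := ler_norm (- x); rewrite normrN; lra.
  have h1 := GB _ _ _ bx xx.
  have h2 : G b 0 - G b (- `|x| - 1) = G (- `|x| - 1) 0 by apply: GB => //; lra.
  by rewrite /F -h1 -h2; ring.
exists F => x; apply: (@near_eq_is_derive _ _ _ (fun y => G (- `|x| - 2) y - G (- `|x| - 2) 0)).
  near=> y; rewrite (FE (- `|x| - 2))//.
  have : `|y - x| < 1.
    rewrite distrC; near: y; exact: (nbhsx_ballx x 1 ltr01).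
  have := ler_normD x (y - x); rewrite subrKC => h1 h2; lra.
have xx : - `|x| - 2 < x by have := ler_norm (- x); rewrite normrN; lra.
rewrite -[f x]subr0; have := dG _ _ xx => d1.
apply: is_deriveB; exact: is_derive_cst.
Unshelve. all: by end_near. Qed.

Lemma continuous_funB f g : continuous f -> continuous g -> continuous (fun x => f x - g x).
Proof. by move=> cf cg x; apply: continuousB; [exact: cf|exact: cg]. Qed.
Lemma continuous_funD f g : continuous f -> continuous g -> continuous (fun x => f x + g x).
Proof. by move=> cf cg x; apply: continuousD; [exact: cf|exact: cg]. Qed.
Lemma continuous_funM f g : continuous f -> continuous g -> continuous (fun x => f x * g x).
Proof. by move=> cf cg x; apply: continuousM; [exact: cf|exact: cg]. Qed.
Lemma continuous_funN f : continuous f -> continuous (fun x => - f x).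
Proof. by move=> cf x; apply: continuousN; exact: cf. Qed.
Lemma continuous_funZ (k : R) f : continuous f -> continuous (fun x => k * f x).
Proof. by move=> cf; apply: continuous_funM => // x; exact: cst_continuous. Qed.
Lemma continuous_funX n f : continuous f -> continuous (fun x => f x ^+ n).
Proof.
move=> cf; elim: n => [|n ih].
  by under eq_fun do rewrite expr0; move=> x; exact: cst_continuous.
by under eq_fun do rewrite exprS; exact: continuous_funM.
Qed.

Lemma lebI_integralD f g : continuous f -> continuous g -> II (fun x => f x + g x) = II f + II g.
Proof. by move=> cf cg; apply: RintegralD => //; exact: continuous_lebI_integrable. Qed.
Lemma lebI_integralB f g : continuous f -> continuous g -> II (fun x => f x - g x) = II f - II g.
Proof. by move=> cf cg; apply: RintegralB => //; exact: continuous_lebI_integrable. Qed.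
Lemma lebI_integralZ (k : R) f : continuous f -> II (fun x => k * f x) = k * II f.
Proof. by move=> cf; apply: RintegralZl => //; exact: continuous_lebI_integrable. Qed.

Lemma lebI_integral_ge0_eq0 g (x : R) : continuous g -> (forall x, 0 <= g x) ->
  II g = 0 -> -1 < x < 0 -> g x = 0.
Proof.
move=> cg g0 Ig x0.
have [G dG] := continuous_primitive cg.
move: Ig; rewrite (lebI_FTC dG cg) => /eqP; rewrite subr_eq0 => /eqP G01.
have Gc y : -1 < y < 0 -> G y = G (-1).
  move=> /andP[y1 y0]; apply/eqP; rewrite eq_le.
  by rewrite -{1}G01 !(has_derive_ndecr dG)// ltW.
by apply: (has_derive_locally_cst dG x0) => y y0; rewrite !Gc.
Qed.

(** Continuity is enough here: the test functions built from it are primitives of continuous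
    functions, hence C^1. *)
Definition bump (c d x : R) : R := Num.max 0 ((x - c) * (d - x)).

Lemma bump_ge0 c d x : 0 <= bump c d x.
Proof. by rewrite /bump le_max lexx. Qed.

Lemma bump_gt0 c d x : c < x < d -> 0 < bump c d x.
Proof. by move=> /andP[cx xd]; rewrite /bump lt_max mulr_gt0 ?orbT ?subr_gt0. Qed.

Lemma bump_out c d x : c <= d -> x \notin `[c, d] -> bump c d x = 0.
Proof.
move=> cd; rewrite in_itv/= negb_and -!ltNge => /orP[xc|dx]; rewrite /bump max_l//; nra.
Qed.

Lemma continuous_bump c d : continuous (bump c d).
Proof.
have c1 : continuous (fun x : R => (x - c) * (d - x)).
  by apply: continuous_funM; apply: continuous_funB => x; (exact: cvg_id || exact: cvg_cst).
suff h : continuous (cst 0 \max (fun x : R => (x - c) * (d - x))) by exact: h.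
by move=> x; apply: continuous_max; [exact: cst_continuous|exact: c1].
Qed.

Lemma lebI_integral_bump_gt0 c d : -1 < c -> c < d -> d < 0 -> 0 < II (bump c d).
Proof.
move=> c1 cd d0; rewrite lt_def; apply/andP; split; last first.
  by apply: Rintegral_ge0 => x _; exact: bump_ge0.
apply/eqP => /lebI_integral_ge0_eq0 => /(_ ((c + d) / 2) (@continuous_bump c d) (bump_ge0 c d)).
have h : 0 < bump c d ((c + d) / 2) by apply: bump_gt0; lra.
by move=> h'; move: h; rewrite h' ?ltxx//; lra.
Qed.

(** A primitive is constant on each side of [c,d]; the vanishing of the integral makes the two
    constants equal, so one subtraction kills both. *)
Lemma primitive_supp f c d : -1 < c -> c <= d -> d < 0 -> continuous f ->
  (forall x : R, x \notin `[c, d] -> f x = 0) -> II f = 0 ->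
  exists2 F, has_derive F f & forall x : R, x \notin `[c, d] -> F x = 0.
Proof.
move=> c1 cd d0 cf f0 If; have [F dF] := continuous_primitive cf.
exists (fun x => F x - F c).
  apply: has_derive_ext (has_deriveB dF (has_derive_cst (F c))) => x; exact: subr0.
have Fl x : x <= c -> F x = F c.
  move=> xc; apply: (has_derive_cst_on dF xc) => y /andP[xy yc].
  by apply: f0; rewrite in_itv/= negb_and -ltNge yc.
have Fr x : d <= x -> F d = F x.
  move=> dx; apply: (has_derive_cst_on dF dx) => y /andP[xy yc].
  by apply: f0; rewrite in_itv/= negb_and -!ltNge xy orbT.
move: If; rewrite (lebI_FTC dF cf) -(Fr 0) ?ltW// (Fl (-1)) ?ltW// => FE x.
rewrite in_itv/= negb_and -!ltNge => /orP[xc|dx].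
  by rewrite Fl ?subrr// ltW.
by rewrite -Fr// ltW.
Qed.

End Primitives.

Section ContinuousFunctions.
Variable R : realType.
Implicit Types (f g F w : R -> R).

Definition supp_in f (c d : R) := forall x : R, x \notin `[c, d] -> f x = 0.

Lemma continuous_const (k : R) : continuous (fun _ : R => k).
Proof. by move=> x; exact: cst_continuous. Qed.
Lemma continuous_idfun : continuous (fun x : R => x).
Proof. by move=> x; exact: cvg_id. Qed.

End ContinuousFunctions.

(** Goals are eta-expanded, so each case names the component functions explicitly instead of leaving
    them to higher-order unification. *)
Ltac continuity :=
  lazymatch goal with
  | |- continuous (fun x => x) => exact (@continuous_idfun _)
  | |- continuous (fun x => @?f x * @?g x) => apply: (@continuous_funM _ f g); continuity
  | |- continuous (fun x => @?f x - @?g x) => apply: (@continuous_funB _ f g); continuity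
  | |- continuous (fun x => @?f x + @?g x) => apply: (@continuous_funD _ f g); continuity
  | |- continuous (fun x => - @?f x) => apply: (@continuous_funN _ f); continuity
  | |- continuous (fun x => @?f x ^+ ?n) => apply: (@continuous_funX _ n f); continuity
  | |- continuous (fun x => ?f x) => change (continuous f); continuity
  | |- _ => first [eassumption | exact (@continuous_const _ _) | exact: continuous_bump | idtac]
  end.

(** * Du Bois-Reymond lemmas of orders one and two; continuous representatives *)

Section DuBoisReymond.
Variable R : realType.
Implicit Types (f g F w : R -> R).
Notation II f := (\int[lebI R]_x (f x)).

Lemma eq_lebI_integral f g : (forall x, f x = g x) -> II f = II g.
Proof. by move=> fg; apply: eq_Rintegral => x _. Qed.

(** With m the mean of k for the weight b, the function p = (k - m) b has integral zero, hence is
    the derivative of a test function. Then k and 1 both annihilate p, so the integral of (k - m)^2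
    b vanishes and k = m where b > 0. *)
Lemma du_bois_reymond1 (k : R -> R) : continuous k ->
  (forall f f1 (c d : R), has_derive f f1 -> continuous f1 -> -1 < c -> d < 0 -> supp_in f c d ->
    II (fun x => k x * f1 x) = 0) ->
  forall x y, -1 < x < 0 -> -1 < y < 0 -> k x = k y.
Proof.
move=> ck hk.
suff H (c d : R) : -1 < c -> c < d -> d < 0 -> exists m, forall x, c < x < d -> k x = m.
  move=> x y /andP[x1 x0] /andP[y1 y0].
  pose c : R := (Num.min x y - 1) / 2; pose d : R := Num.max x y / 2.
  have [c1 c2 c3] : [/\ -1 < c, c < x & c < y].
    by rewrite /c /Num.min; case: ifP => h; split; lra.
  have [d1 d2 d3] : [/\ d < 0, x < d & y < d].
    by rewrite /d /Num.max; case: ifP => h; split; lra.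
  have [m mP] := H _ _ c1 (lt_trans c2 d2) d1.
  by rewrite !mP//; apply/andP; split.
move=> c1 cd d0; set b := bump c d; have b0 := lebI_integral_bump_gt0 c1 cd d0.
have cb : continuous b by exact: continuous_bump.
pose m := II (fun x => k x * b x) / II b.
pose p x := k x * b x - m * b x.
have cp : continuous p by rewrite /p; continuity.
have p0 : supp_in p c d.
  by move=> x xcd; rewrite /p /b bump_out ?mulr0 ?subrr// ltW.
have Ip : II p = 0.
  rewrite /p lebI_integralB; [|by continuity|by continuity].
  by rewrite lebI_integralZ// /m divfK ?gt_eqF// subrr.
have [f df f0] := primitive_supp c1 (ltW cd) d0 cp p0 Ip.
have kp := hk f p c d df cp c1 d0 f0.
exists m => x /andP[cx xd].
have : (k x - m) ^+ 2 * b x = 0.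
  apply: (@lebI_integral_ge0_eq0 _ (fun x => (k x - m) ^+ 2 * b x)).
  - by continuity.
  - by move=> y; rewrite mulr_ge0 ?sqr_ge0// bump_ge0.
  - rewrite (@eq_lebI_integral _ (fun x => k x * p x - m * p x)); last by move=> y; rewrite /p; ring.
    by rewrite lebI_integralB ?lebI_integralZ ?Ip ?kp ?mulr0 ?subrr//; continuity.
  - by rewrite (lt_trans c1 cx) (lt_trans xd d0).
move/eqP; rewrite mulf_eq0 sqrf_eq0 subr_eq0 => /orP[/eqP//|].
by rewrite gt_eqF// bump_gt0// cx.
Qed.

(** As in order one, but p is k b minus its projection on the affine functions. The two vanishing
    moments of p are what is needed to integrate it twice with compact support. *)
Lemma du_bois_reymond2 (k : R -> R) : continuous k ->
  (forall f f1 f2 (c d : R), has_derive f f1 -> has_derive f1 f2 -> continuous f2 ->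
    -1 < c -> d < 0 -> supp_in f c d -> supp_in f1 c d ->
    II (fun x => k x * f2 x) = 0) ->
  exists m n, forall x, -1 < x < 0 -> k x = m + n * x.
Proof.
move=> ck hk.
suff H (c d : R) : -1 < c -> c < d -> d < 0 -> exists m n, forall x, c < x < d -> k x = m + n * x.
  (* The affine function found on [c,d] could depend on c and d. Every interval used contains -2/3
     and -1/3, and the values of k there determine it. *)
  pose n0 := 3 * (k (- (1 / 3)) - k (- (2 / 3))).
  exists (k (- (1 / 3)) + n0 / 3), n0 => x /andP[x1 x0].
  pose c : R := (Num.min x (- (2 / 3)) - 1) / 2.
  pose d : R := (Num.max x (- (1 / 3))) / 2.
  have [c1 c2 c3] : [/\ -1 < c, c < x & c < - (2 / 3)].
    by rewrite /c /Num.min; case: ifP => h; split; lra.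
  have [d1 d2 d3] : [/\ d < 0, x < d & - (1 / 3) < d].
    by rewrite /d /Num.max; case: ifP => h; split; lra.
  have [|m [n mP]] := H _ _ c1 _ d1; first lra.
  rewrite /n0 !mP; [lra| | |]; lra.
move=> c1 cd d0; set b := bump c d; have b0 := lebI_integral_bump_gt0 c1 cd d0.
have cb : continuous b by exact: continuous_bump.
(* The barycentre of b: centring at it makes 1 and e orthogonal for the weight b, so the two
   coefficients of the projection are computed separately. *)
pose xb := II (fun x => x * b x) / II b.
pose e x := x - xb.
have ce : continuous e by rewrite /e; continuity.
pose m2 := II (fun x => e x ^+ 2 * b x).
have m20 : 0 < m2.
  have ge0 (x : R) : 0 <= e x ^+ 2 * b x by rewrite mulr_ge0 ?sqr_ge0// bump_ge0.
  rewrite lt_def; apply/andP; split; last by apply: Rintegral_ge0 => x _.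
  apply/eqP => m2e.
  have z (x : R) : c < x < d -> e x = 0.
    move=> /andP[cx xd]; have x01 : -1 < x < 0 by rewrite (lt_trans c1 cx) (lt_trans xd d0).
    have := lebI_integral_ge0_eq0 _ ge0 m2e x01 => /(_ ltac:(continuity))/eqP.
    rewrite mulf_eq0 sqrf_eq0 => /orP[/eqP//|].
    by rewrite gt_eqF// bump_gt0// cx.
  have := z ((2 * c + d) / 3); have := z ((c + 2 * d) / 3); rewrite /e => h1 h2.
  have : (c + 2 * d) / 3 - xb = 0 by apply: h1; lra.
  have : (2 * c + d) / 3 - xb = 0 by apply: h2; lra.
  by lra.
have Ieb : II (fun x => e x * b x) = 0.
  rewrite (@eq_lebI_integral _ (fun x => x * b x - xb * b x)); last by move=> x; rewrite /e; ring.
  by rewrite lebI_integralB ?lebI_integralZ//; [rewrite /xb divfK ?subrr// gt_eqF|continuity|continuity].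
pose m := II (fun x => k x * b x) / II b.
pose n := II (fun x => k x * (e x * b x)) / m2.
pose p x := k x * b x - (m * b x + n * (e x * b x)).
have cp : continuous p by rewrite /p; continuity.
have p0 : supp_in p c d.
  by move=> x xcd; rewrite /p /b bump_out ?mulr0 ?addr0 ?subrr// ltW.
have Ip : II p = 0.
  rewrite /p lebI_integralB; [|by continuity|by continuity].
  rewrite lebI_integralD; [|by continuity|by continuity].
  rewrite lebI_integralZ// lebI_integralZ; last by continuity.
  by rewrite Ieb /m divfK ?gt_eqF// mulr0 addr0 subrr.
have Iep : II (fun x => e x * p x) = 0.
  rewrite (@eq_lebI_integral _ (fun x => k x * (e x * b x) - (m * (e x * b x) + n * (e x ^+ 2 * b x)))); last first.
    by move=> x; rewrite /p; ring.
  rewrite lebI_integralB; [|by continuity|by continuity].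
  rewrite lebI_integralD; [|by continuity|by continuity].
  rewrite lebI_integralZ; last by continuity.
  rewrite lebI_integralZ; last by continuity.
  by rewrite Ieb -/m2 /n divfK ?gt_eqF// mulr0 add0r subrr.
have [f1 df1 f10] := primitive_supp c1 (ltW cd) d0 cp p0 Ip.
have cf1 := is_derive_continuous df1.
have f1m : f1 (-1) = 0 by apply: f10; rewrite in_itv/= negb_and -ltNge c1.
have f1z : f1 0 = 0 by apply: f10; rewrite in_itv/= negb_and -!ltNge d0 orbT.
(* Integration by parts against e turns the vanishing first moment of p into the vanishing integral
   of its primitive f1. *)
have If1 : II f1 = 0.
  have de : has_derive e (fun=> 1).
    by move=> x; have := has_deriveB (@has_derive_id R) (has_derive_cst xb) x; rewrite subr0.
  have := lebI_FTC (has_deriveM de df1) ltac:(continuity).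
  rewrite f1m f1z !mulr0 subrr lebI_integralD; [|by continuity|by continuity].
  by rewrite Iep addr0 => <-; apply: eq_lebI_integral => x; rewrite mul1r.
have [f df f0] := primitive_supp c1 (ltW cd) d0 cf1 f10 If1.
have kp := hk f f1 p c d df df1 cp c1 d0 f0 f10.
exists (m - n * xb), n => x /andP[cx xd].
have : (k x - m - n * e x) ^+ 2 * b x = 0.
  apply: (@lebI_integral_ge0_eq0 _ (fun x => (k x - m - n * e x) ^+ 2 * b x)).
  - by continuity.
  - by move=> y; rewrite mulr_ge0 ?sqr_ge0// bump_ge0.
  - rewrite (@eq_lebI_integral _ (fun x => k x * p x - (m * p x + n * (e x * p x)))); last by move=> y; rewrite /p; ring.
    rewrite lebI_integralB; [|by continuity|by continuity].
    rewrite lebI_integralD; [|by continuity|by continuity].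
    rewrite lebI_integralZ; last by continuity.
    rewrite lebI_integralZ; last by continuity.
    by rewrite kp Ip Iep !mulr0 addr0 subrr.
  - by rewrite (lt_trans c1 cx) (lt_trans xd d0).
move/eqP; rewrite mulf_eq0 sqrf_eq0 => /orP[/eqP|]; last first.
  by rewrite gt_eqF// bump_gt0// cx.
by rewrite /e; lra.
Qed.

Lemma continuous_eq0_cc f : continuous f -> (forall x, -1 < x < 0 -> f x = 0) ->
  forall x, -1 <= x <= 0 -> f x = 0.
Proof.
move=> cf f0 x /andP[x1 x0].
have [x1e|x1'] := eqVneq x (-1).
  have h1 : f y @[y --> x^'+] --> f x by exact/cvg_at_right_filter/cf.
  apply: (cvg_unique (@norm_hausdorff _ R) h1); apply: cvg_near_cst.
  near=> y; apply: f0; rewrite -x1e; apply/andP; split => //.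
  by near: y; apply: nbhs_right_lt; rewrite x1e ltrN10.
have [x0e|x0'] := eqVneq x 0.
  have h1 : f y @[y --> x^'-] --> f x by exact/cvg_at_left_filter/cf.
  apply: (cvg_unique (@norm_hausdorff _ R) h1); apply: cvg_near_cst.
  near=> y; apply: f0; rewrite -x0e; apply/andP; split => //.
  by near: y; apply: nbhs_left_gt; rewrite x0e ltrN10.
by apply: f0; rewrite !lt_neqAle x1 x0 x0' eq_sym x1'.
Unshelve. all: by end_near. Qed.

Lemma continuous_ae_eq f g : continuous f -> continuous g ->
  f = g %[ae lebI R] -> forall x, -1 <= x <= 0 -> f x = g x.
Proof.
move=> cf cg fg x x01; apply/eqP; rewrite -subr_eq0; apply/eqP.
move: x x01; apply: continuous_eq0_cc; first by continuity.
move=> x x01; apply/eqP; rewrite -sqrf_eq0; apply/eqP.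
apply: (@lebI_integral_ge0_eq0 _ (fun x => (f x - g x) ^+ 2)) => //.
- by continuity.
- by move=> y; exact: sqr_ge0.
have := L2norm_ae (u := toL2 f) (v := toL2 g).
rewrite !toL2_continuous// => /(_ fg) /eqP; rewrite -sqrf_eq0 L2norm_sqr => /eqP <-.
by apply: eq_lebI_integral => y; rewrite !L2subE !toL2_continuous// expr2.
Qed.

Definition clamp (x : R) : R := Num.max (-1) (Num.min 0 x).

Lemma clamp_itv x : clamp x \in `[-1, 0].
Proof. by rewrite in_itv/= /clamp le_max lexx/= ge_max lerN10 ge_min lexx. Qed.

Lemma clampE x : -1 <= x <= 0 -> clamp x = x.
Proof. by move=> /andP[x1 x0]; rewrite /clamp min_r// max_r. Qed.

Lemma continuous_clamp : continuous clamp.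
Proof.
suff h : continuous (cst (-1) \max (cst 0 \min (fun x : R => x))) by exact: h.
move=> x; apply: continuous_max; first exact: cst_continuous.
by apply: continuous_min; [exact: cst_continuous|exact: cvg_id].
Qed.

(** Composing with the retraction onto [-1,0] replaces one-sided continuity at the ends by plain
    continuity, so that all later calculus takes place on the whole line. *)
Lemma clamp_extension (u : R -> R) : {within `[-1, 0], continuous u} ->
  continuous (u \o clamp).
Proof.
move=> /subspace_continuousP cu x.
apply: (@cvg_comp _ _ _ clamp u (nbhs x) (within `[-1, 0]%classic (nbhs (clamp x)))); last first.
  by apply: cu; exact: clamp_itv.
move=> P wP; have h : \forall y \near x, `[-1, 0]%classic (clamp y) -> P (clamp y) := @continuous_clamp x _ wP.
by apply: filterS h => y; apply; exact: clamp_itv.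
Qed.

Lemma lebI_ae (P : R -> Prop) : (forall x, -1 < x < 0 -> P x) ->
  {ae lebI R, forall x, P x}.
Proof.
move=> PI; apply: (@negligibleS _ _ _ (lebI R) (~` `](-1)%R, 0%R[%classic)).
  by move=> x /= nP; rewrite in_itv/= => x01; exact/nP/PI.
exists (~` `](-1)%R, 0%R[%classic); split => //.
- by apply: measurableC; exact: measurable_IT.
- exact: lebI_setC.
Qed.

Lemma ip_ae (u v z : L2 R) : (u : R -> R) = v %[ae lebI R] -> ip u z = ip v z.
Proof.
move=> uv; apply/eqP; rewrite -subr_eq0 -ipBl -normr_le0.
by rewrite (le_trans (ip_le _ _))// (L2norm_ae uv) mul0r.
Qed.

Lemma ip_toL2 (u : L2 R) f : continuous f -> II (fun x => u x * f x) = ip u (toL2 f) :> R.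
Proof. by move=> cf; rewrite /ip toL2_continuous. Qed.

End DuBoisReymond.

(** * Classical representatives for the domain of A^2 *)

Section Regularity.
Variable R : realType.
Implicit Types (f g F : R -> R) (w z : L2 R).
Notation II f := (\int[lebI R]_x (f x)).

Lemma supp_in_out f (c d : R) : -1 < c -> d < 0 -> supp_in f c d ->
  f (-1) = 0 /\ f 0 = 0.
Proof.
move=> c1 d0 f0; split; apply: f0; rewrite in_itv/= negb_and -!ltNge.
  by rewrite c1.
by rewrite d0 orbT.
Qed.

Lemma weak_derivative_ip w z f f1 (c d : R) : weak_derivative w z ->
  has_derive f f1 -> continuous f1 -> -1 < c -> d < 0 -> supp_in f c d ->
  ip w (toL2 f1) = - ip z (toL2 f).
Proof.
move=> wz df cf1 c1 d0 f0; have /has_deriveP[df' f1E] := df.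
have cf := is_derive_continuous df.
have hf : C1c f.
  by apply: And3; [exact: df'|rewrite f1E; exact: cf1|exists c, d; apply: And3].
have := wz f hf; rewrite f1E => h.
by rewrite -(ip_toL2 w cf1) -(ip_toL2 z cf).
Qed.

(* The derivatives are taken on the whole line; only the values on [-1,0] are
   related to [w] and [z]. *)
Definition classical_kdv (a : R) w z u u1 u2 u3 :=
  [/\ has_derive u u1, has_derive u1 u2, has_derive u2 u3 & continuous u3] /\
  [/\ u (-1) = 0, u 0 = 0, u1 0 = 0, u = w %[ae lebI R] &
      (fun x => - u3 x - a * u1 x) = z %[ae lebI R]].

Lemma has_trace_extension w (x l : R) : has_trace w x l -> -1 <= x <= 0 ->
  exists2 u : R -> R, continuous u & u = w %[ae lebI R] /\ u x = l.
Proof.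
move=> [u [cu uw ux]] x01; exists (u \o @clamp R); first exact: clamp_extension.
split; last by rewrite /= clampE.
apply: lebI_aeS (lebI_aeI uw (@lebI_ae R (fun y => -1 < y < 0) (fun=> id))) => y.
move=> [+ /andP[y1 y0] _] => /(_ I) <-.
by rewrite /= clampE// !ltW.
Qed.

Lemma lebI_ae_sym (f g : R -> R) : f = g %[ae lebI R] -> g = f %[ae lebI R].
Proof. by apply: lebI_aeS => x h I'; rewrite h. Qed.

Lemma lebI_ae_trans (f g h : R -> R) : f = g %[ae lebI R] -> g = h %[ae lebI R] ->
  f = h %[ae lebI R].
Proof.
by move=> fg gh; apply: lebI_aeS (lebI_aeI fg gh) => x [h1 h2] I'; rewrite h1// h2.
Qed.

Lemma continuous_cc_eq f g : continuous f -> continuous g ->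
  (forall x, -1 < x < 0 -> f x = g x) -> forall x, -1 <= x <= 0 -> f x = g x.
Proof.
move=> cf cg fg x x01; apply/eqP; rewrite -subr_eq0; apply/eqP; move: x x01.
apply: continuous_eq0_cc; first by continuity.
by move=> x x01; rewrite fg ?subrr.
Qed.

Lemma lebI_integral_by_parts0 F f G g (c d : R) : has_derive F f -> has_derive G g ->
  continuous f -> continuous g -> -1 < c -> d < 0 -> supp_in G c d ->
  II (fun x => F x * g x) = - II (fun x => f x * G x).
Proof.
move=> dF dG cf cg c1 d0 G0; have [g1 g0] := supp_in_out c1 d0 G0.
have cF := is_derive_continuous dF; have cG := is_derive_continuous dG.
have := lebI_FTC (has_deriveM dF dG) ltac:(continuity).
rewrite lebI_integralD; [|by continuity|by continuity].
by rewrite g1 g0 !mulr0 subrr => /eqP; rewrite addrC addr_eq0 => /eqP.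
Qed.

Lemma itvN10 : (-1 <= -1 :> R) && (-1 <= 0 :> R) /\ (-1 <= 0 :> R) && (0 <= 0 :> R).
Proof. by rewrite !lexx lerN10. Qed.

Lemma ip_ae_continuous w f g : continuous f -> f = w %[ae lebI R] -> continuous g ->
  ip w (toL2 g) = II (fun x => f x * g x) :> R.
Proof.
move=> cf fw cg; rewrite -(@ip_ae _ (toL2 f)) ?toL2_continuous//.
by rewrite /ip !toL2_continuous.
Qed.

(** Since z = A w is itself in the domain, it is continuous, and so is w''' = - z - a w'.
    Integrating w''' back yields candidates for w'' and w', then w, whose constants of integration
    are fixed by the Du Bois-Reymond lemmas. *)
Lemma kdv_regular (a : R) w z z' : kdv_op a w z -> kdv_op a z z' ->
  exists u u1 u2 u3, classical_kdv a w z u u1 u2 u3.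
Proof.
move=> [w1 [w2 [w3 [[ww1 w12 w23] [tw1 tw0 tw10 zE]]]]] [_ [_ [_ [_ [tz _ _ _]]]]].
have [i1 i0] := itvN10.
have [v cv [vw v1]] := has_trace_extension tw1 i1.
have [v' cv' [vw' v0']] := has_trace_extension tw0 i0.
(* Each trace comes with its own continuous representative; those of w at -1 and at 0 agree on
   [-1,0]. *)
have v0 : v 0 = 0.
  have e := lebI_ae_trans vw (lebI_ae_sym vw').
  by rewrite (continuous_ae_eq cv cv' e i0).
have [p cp [pw1 p0]] := has_trace_extension tw10 i0.
have [q cq [qz _]] := has_trace_extension tz i1.
pose u3 x := - q x - a * p x.
have cu3 : continuous u3 by rewrite /u3; continuity.
have u3w3 : u3 = w3 %[ae lebI R].
  apply: lebI_aeS (lebI_aeI zE (lebI_aeI qz pw1)) => x [h1 [h2 h3]] I'.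
  have h1' : z x = - w3 x - a * w1 x := h1 I'.
  by rewrite /u3 h2// h3// h1'; ring.
have [Q1 dQ1] := continuous_primitive cu3.
have cQ1 := is_derive_continuous dQ1.
have [Q dQ] := continuous_primitive cQ1.
have cQ := is_derive_continuous dQ.
(* Both p and Q have second weak derivative w''', so they differ by an affine function. *)
have [|m [n mn]] := @du_bois_reymond2 R (fun x => p x - Q x) ltac:(continuity).
  move=> f f1 f2 c d df df1 cf2 c1 d0 f0 f10.
  have cf1 := is_derive_continuous df1; have cf := is_derive_continuous df.
  rewrite (@eq_lebI_integral _ _ (fun x => p x * f2 x - Q x * f2 x)); last by move=> x; ring.
  rewrite lebI_integralB; [|by continuity|by continuity].
  rewrite (lebI_integral_by_parts0 dQ df1 cQ1 cf2 c1 d0 f10).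
  rewrite (lebI_integral_by_parts0 dQ1 df cu3 cf1 c1 d0 f0) opprK.
  rewrite -(ip_ae_continuous cp pw1 cf2) -(ip_ae_continuous cu3 u3w3 cf).
  rewrite (weak_derivative_ip w12 df1 cf2 c1 d0 f10).
  by rewrite (weak_derivative_ip w23 df cf1 c1 d0 f0) opprK subrr.
pose u1 x := Q x + m + n * x; pose u2 x := Q1 x + n.
have du1 : has_derive u1 u2.
  have := has_deriveD (has_deriveD dQ (has_derive_cst m)) (has_deriveZ n (@has_derive_id R)).
  by apply: has_derive_ext => x; rewrite /u2 addr0 mulr1.
have du2 : has_derive u2 u3.
  have := has_deriveD dQ1 (has_derive_cst n).
  by apply: has_derive_ext => x; rewrite addr0.
have cu1 := is_derive_continuous du1.
have pu1 : forall x, -1 <= x <= 0 -> p x = u1 x.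
  by apply: continuous_cc_eq => // x /mn e; rewrite /u1 -addrA -e subrKC.
have u1w1 : u1 = w1 %[ae lebI R].
  apply: lebI_ae_trans pw1; apply: lebI_ae => x /andP[x1 x0] _.
  by rewrite pu1// !ltW.
have [U dU] := continuous_primitive cu1.
have cU := is_derive_continuous dU.
(* The same comparison at order one: v and U both have weak derivative w'. *)
have hv : forall x y, -1 < x < 0 -> -1 < y < 0 -> v x - U x = v y - U y.
  apply: (@du_bois_reymond1 R (fun x => v x - U x) ltac:(continuity)).
  move=> f f1 c d df cf1 c1 d0 f0; have cf := is_derive_continuous df.
  rewrite (@eq_lebI_integral _ _ (fun x => v x * f1 x - U x * f1 x)); last by move=> x; ring.
  rewrite lebI_integralB; [|by continuity|by continuity].
  rewrite (lebI_integral_by_parts0 dU df cu1 cf1 c1 d0 f0).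
  rewrite -(ip_ae_continuous cv vw cf1) -(ip_ae_continuous cu1 u1w1 cf).
  by rewrite (weak_derivative_ip ww1 df cf1 c1 d0 f0) opprK addNr.
pose k := v (- (1 / 2)) - U (- (1 / 2)); pose u x := U x + k.
have du : has_derive u u1.
  have := has_deriveD dU (has_derive_cst k).
  by apply: has_derive_ext => x; rewrite addr0.
have uv : forall x, -1 <= x <= 0 -> v x = u x.
  apply: continuous_cc_eq => //; first exact: is_derive_continuous du.
  move=> x x01; rewrite /u /k -(hv x)//; last lra.
  by rewrite subrKC.
exists u, u1, u2, u3; split; split => //.
- by rewrite -uv.
- by rewrite -uv.
- by rewrite -pu1.
- apply: lebI_ae_trans vw; apply: lebI_ae => x /andP[x1 x0] _.
  by rewrite uv// !ltW.
- apply: lebI_ae_trans qz; apply: lebI_ae => x /andP[x1 x0] _.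
  by rewrite /u3 pu1 ?ltW//; ring.
Qed.

End Regularity.

(** * The weighted energy identity and sup bounds by the graph norm *)

Section EnergyEstimates.
Variable R : realType.
Implicit Types (f g F u v : R -> R) (w z : L2 R).
Notation II f := (\int[lebI R]_x (f x)).

Lemma L2norm_toL2_sqr f : continuous f -> L2norm (toL2 f) ^+ 2 = II (fun x => f x ^+ 2) :> R.
Proof.
move=> cf; rewrite L2norm_sqr /ip; apply: eq_lebI_integral => x.
by rewrite toL2_continuous// expr2.
Qed.

Lemma L2norm_ae_eq w z : (w : R -> R) = z %[ae lebI R] -> L2norm w = L2norm z.
Proof.
move=> wz; have h := L2norm_ae wz; apply/eqP; rewrite eq_le.
have := L2normD (w - z) z; rewrite subrK h add0r => ->/=.
by have := L2normD (z - w) w; rewrite subrK L2norm_distC h add0r.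
Qed.

Lemma L2norm_sub_toL2 w f g : f = w %[ae lebI R] -> continuous f -> continuous g ->
  L2norm (w - toL2 g) = L2norm (toL2 (fun x => f x - g x)).
Proof.
move=> fw cf cg; apply: L2norm_ae_eq; apply: lebI_aeS fw => x h I'.
rewrite toL2_continuous; last by continuity.
by rewrite (h I') [LHS](_ : _ = w x - toL2 g x)// toL2_continuous.
Qed.

Lemma L2norm_le_sqr w (m : R) : 0 <= m -> L2norm w ^+ 2 <= m ^+ 2 -> L2norm w <= m.
Proof. by move=> m0; rewrite ler_sqr ?nnegrE ?L2norm_ge0. Qed.

Lemma ip_wtm_continuous f g : continuous f -> continuous g ->
  ip (toL2 f) (wtm (toL2 g)) = II (fun x => f x * ((1 + x) * g x)) :> R.
Proof.
move=> cf cg; have -> : ip (toL2 f) (wtm (toL2 g)) = ip (wtm (toL2 g)) (toL2 f) by rewrite ipC.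
rewrite (@ip_ae _ _ (toL2 (fun x => (1 + x) * g x))); last first.
  apply: lebI_ae => x /andP[x1 x0] _; rewrite wtmE wtE ?ltW//.
  by rewrite !toL2_continuous//; continuity.
rewrite /ip; apply: eq_lebI_integral => x; rewrite !toL2_continuous//; [ring|by continuity].
Qed.

Section Energy.
Variables (a : R) (w z : L2 R) (u u1 u2 u3 : R -> R).
Hypothesis a0 : 0 <= a.
Hypothesis wu : classical_kdv a w z u u1 u2 u3.

(* The multiplier is (1 + x) u, whose weight 1 + x vanishes at the end -1,
   where u' is unknown. *)
Lemma kdv_energy :
  2 * ip z (wtm w) = a * L2norm w ^+ 2 - 3 * L2norm (toL2 u1) ^+ 2.
Proof.
have [[du du1 du2 cu3] [um u0 u10 uw uz]] := wu.
have cu := is_derive_continuous du; have cu1 := is_derive_continuous du1.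
have cu2 := is_derive_continuous du2.
pose q x := - u3 x - a * u1 x; have cq : continuous q by rewrite /q; continuity.
have qz : (toL2 q : R -> R) = z %[ae lebI R] by rewrite toL2_continuous.
have uw' : (toL2 u : R -> R) = w %[ae lebI R] by rewrite toL2_continuous.
have -> : ip z (wtm w) = ip (toL2 q) (wtm (toL2 u)).
  rewrite -(ip_ae _ qz) [LHS]ipC ip_wtm -(ip_ae _ uw').
  by rewrite -ip_wtm ipC.
have -> : L2norm w = L2norm (toL2 u) by rewrite (L2norm_ae_eq uw').
rewrite ip_wtm_continuous// !L2norm_toL2_sqr//.
(* A primitive of the whole identity. It vanishes at 0 because u = u' = 0 there, and at -1 because
   every term carries 1 + x or u. *)
pose G x := - (2 * ((1 + x) * (u x * u2 x))) + 2 * (u x * u1 x) + (1 + x) * (u1 x * u1 x) - a * ((1 + x) * (u x * u x)).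
have d1 : has_derive (fun x : R => 1 + x) (fun=> 1).
  by move=> x; have := has_deriveD (has_derive_cst 1) (@has_derive_id R) x; rewrite add0r.
have dG : has_derive G (fun x => 2 * (q x * ((1 + x) * u x)) + 3 * u1 x ^+ 2 - a * u x ^+ 2).
  have := has_deriveB (has_deriveD (has_deriveD
     (has_deriveN (has_deriveZ 2 (has_deriveM d1 (has_deriveM du du2))))
     (has_deriveZ 2 (has_deriveM du du1))) (has_deriveM d1 (has_deriveM du1 du1)))
     (has_deriveZ a (has_deriveM d1 (has_deriveM du du))).
  by apply: has_derive_ext => x; rewrite /q; ring.
have := lebI_FTC dG ltac:(continuity).
rewrite /G um u0 u10 lebI_integralB; [|by continuity|by continuity].
rewrite lebI_integralD; [|by continuity|by continuity].
rewrite lebI_integralZ; last by continuity.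
rewrite lebI_integralZ; last by continuity.
rewrite lebI_integralZ; last by continuity.
by move=> h; lra.
Qed.

(** The energy identity read as a stationary estimate: 3 |u'|^2 <= a |w|^2 + 2 |A w| |w|. *)
Lemma kdv_deriv_norm : L2norm (toL2 u1) <= (a + 1) * (L2norm w + L2norm z).
Proof.
have w0 := L2norm_ge0 w; have z0 := L2norm_ge0 z.
apply: L2norm_le_sqr; first by rewrite mulr_ge0 ?addr_ge0.
have e := kdv_energy.
have h : `|ip z (wtm w)| <= L2norm z * L2norm w.
  apply: le_trans (ip_le _ _) _; rewrite ler_wpM2l//; exact: L2norm_wtm.
move: h; rewrite ler_norml => /andP[h _].
set n := L2norm (toL2 u1) in e *; set nw := L2norm w in e h w0 *; set nz := L2norm z in e h z0 *.
have : 3 * n ^+ 2 <= a * nw ^+ 2 + 2 * (nz * nw) by lra.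
move=> en; rewrite exprMn; set A := (a + 1) ^+ 2.
have A1 : 1 <= A by rewrite /A exprn_ege1// lerDr.
have Aa : a <= A by rewrite /A; nra.
have h1 : a * nw ^+ 2 <= A * nw ^+ 2 by rewrite ler_wpM2r ?sqr_ge0.
have h2 : nw * nz <= A * (nw * nz) by rewrite ler_peMl ?mulr_ge0.
have h3 : 0 <= A * nz ^+ 2 by rewrite mulr_ge0 ?sqr_ge0//; lra.
have h4 : 0 <= nw * nz by rewrite mulr_ge0.
have h5 : 0 <= A * nw ^+ 2 by rewrite mulr_ge0 ?sqr_ge0//; lra.
lra.
Qed.

Lemma kdv_third_norm :
  L2norm (toL2 u3) <= (1 + a * (a + 1)) * (L2norm w + L2norm z).
Proof.
have [[du du1 du2 cu3] [um u0 u10 uw uz]] := wu.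
have cu1 := is_derive_continuous du1.
have -> : L2norm (toL2 u3) = L2norm (- z - a *: toL2 u1).
  apply: L2norm_ae_eq; apply: lebI_aeS uz => x h I'.
  rewrite [RHS](_ : _ = - z x - a * toL2 u1 x)// -(h I') !toL2_continuous//; ring.
apply: le_trans (L2normB _ _) _; rewrite L2normN L2normZ ger0_norm//.
have := kdv_deriv_norm; have := L2norm_ge0 w; have := L2norm_ge0 (toL2 u1).
move=> h1 h2 h3.
have : a * L2norm (toL2 u1) <= a * ((a + 1) * (L2norm w + L2norm z)) by rewrite ler_wpM2l.
lra.
Qed.

(** The three boundary conditions give a zero of u'' by applying Rolle twice: u(-1) = u(0) yields a
    zero of u', which pairs with u'(0) = 0. From that zero, Cauchy-Schwarz on an interval of length
    at most 1 bounds u''. *)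
Lemma kdv_sup2 (x : R) : -1 <= x <= 0 -> `|u2 x| <= L2norm (toL2 u3).
Proof.
move=> /andP[x1 x0].
have [[du du1 du2 cu3] [um u0 u10 uw uz]] := wu.
have [c /andP[c1 c0]] := has_derive_MVT du (ltrN10 _).
rewrite um u0 subrr opprK add0r mulr1 => u1c.
have [d /andP[cd d0]] := has_derive_MVT du1 c0.
rewrite -u1c u10 subrr => /esym/eqP; rewrite mulf_eq0 sub0r oppr_eq0 => /orP[/eqP u2d|/eqP c00]; last by move: c0; rewrite c00 ltxx.
rewrite -ler_sqr ?nnegrE ?L2norm_ge0// real_normK ?num_real//.
have cu3' : continuous (fun x => u3 x ^+ 2) by continuity.
rewrite L2norm_toL2_sqr//; have [V dV] := continuous_primitive cu3'.
rewrite (lebI_FTC dV cu3').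
have nd := has_derive_ndecr dV; have V0 := (fun y => sqr_ge0 (u3 y)).
have d1 : -1 <= d by lra.
have [xd|dx] := leP x d.
  have := has_derive_increment_sqr du2 dV xd; rewrite u2d sub0r sqrrN.
  have := nd _ _ x1 (fun y _ => V0 y); have := nd _ _ (ltW d0) (fun y _ => V0 y).
  have := nd _ _ xd (fun y _ => V0 y); move: (V x) (V d) (V 0) (V (-1)) (u2 x ^+ 2) => *; nra.
have := has_derive_increment_sqr du2 dV (ltW dx); rewrite u2d subr0.
have := nd _ _ x0 (fun y _ => V0 y); have := nd _ _ d1 (fun y _ => V0 y).
have := nd _ _ (ltW dx) (fun y _ => V0 y); move: (V x) (V d) (V 0) (V (-1)) (u2 x ^+ 2) => *; nra.
Qed.

Lemma sup_of_deriv f f1 (m : R) : has_derive f f1 -> f 0 = 0 ->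
  (forall x, -1 <= x <= 0 -> `|f1 x| <= m) -> forall x, -1 <= x <= 0 -> `|f x| <= m.
Proof.
move=> df f0 fm x /andP[x1]; rewrite le_eqVlt => /predU1P[->|x0].
  by rewrite f0 normr0; apply: le_trans (fm 0 _); rewrite ?lexx ?lerN10.
have [c /andP[c1 c0]] := has_derive_MVT df x0.
rewrite f0 !sub0r => e; have -> : f x = f1 c * x by lra.
have m1 : `|f1 c| <= m by apply: fm; rewrite (le_trans x1 (ltW c1)) ltW.
rewrite normrM -[leRHS]mulr1; apply: ler_pM => //; rewrite ler_norml; lra.
Qed.

Lemma kdv_sup (x : R) : -1 <= x <= 0 ->
  [/\ `|u x| <= L2norm (toL2 u3), `|u1 x| <= L2norm (toL2 u3) & `|u2 x| <= L2norm (toL2 u3)].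
Proof.
have [[du du1 du2 cu3] [um u0 u10 uw uz]] := wu.
have h1 := sup_of_deriv du1 u10 kdv_sup2; have h0 := sup_of_deriv du u0 h1.
by move=> x01; split; [exact: h0|exact: h1|exact: kdv_sup2].
Qed.

End Energy.
End EnergyEstimates.

(** * Compactly supported functions in the domain of A *)

Section SmoothDomain.
Variable R : realType.
Implicit Types (f g F u v : R -> R) (w z : L2 R).

Fixpoint Ck (k : nat) f : Prop :=
  if k is k'.+1 then exists2 f1, has_derive f f1 & Ck k' f1 else continuous f.

Lemma Ck_continuous k f : Ck k f -> continuous f.
Proof. by case: k => //= k [f1 df _]; exact: is_derive_continuous df. Qed.

Lemma CkS k f : Ck k.+1 f -> Ck k f.
Proof.
elim: k f => [|k ih] f; first by case=> f1 df _; exact: is_derive_continuous df.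
by case=> f1 df c1; exists f1 => //; exact: ih.
Qed.

Lemma Ck_le k l f : (k <= l)%N -> Ck l f -> Ck k f.
Proof.
move=> /subnK <-; elim: (l - k)%N => // n ih; rewrite addSn => /CkS; exact: ih.
Qed.

Lemma Ck_lin k (m n : R) f g : Ck k f -> Ck k g -> Ck k (fun x => m * f x + n * g x).
Proof.
elim: k f g => [|k ih] f g /=; first by move=> cf cg; continuity.
move=> [f1 df cf] [g1 dg cg]; exists (fun x => m * f1 x + n * g1 x); last exact: ih.
exact: has_deriveD (has_deriveZ m df) (has_deriveZ n dg).
Qed.

Lemma Ck_affine k (m n : R) f : Ck k f -> Ck k (fun x => f (m * x + n)).
Proof.
elim: k f => [|k ih] f /=.
  move=> cf x; apply: (@continuous_comp _ _ _ (fun x : R => m * x + n) f); last exact: cf.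
  have h : continuous (fun x : R => m * x + n) by continuity.
  exact: h.
move=> [f1 df cf]; exists (fun x => m * f1 (m * x + n)).
  exact: has_derive_comp_affine.
have := Ck_lin m 0 (ih f1 cf) (ih f1 cf).
by under eq_fun do rewrite mul0r addr0.
Qed.

Lemma supp_in_derive f f1 (c d : R) : has_derive f f1 -> supp_in f c d -> supp_in f1 c d.
Proof.
move=> df f0 x; rewrite in_itv/= negb_and -!ltNge => /orP[xc|dx].
  have o (y : R) : y < c -> f y = 0 by move=> yc; apply: f0; rewrite in_itv/= negb_and -!ltNge yc.
  apply: (@has_derive_locally_cst _ _ _ (x - 1) c _ df); first lra.
  by move=> y /andP[_ yc]; rewrite !o.
have o (y : R) : d < y -> f y = 0 by move=> yc; apply: f0; rewrite in_itv/= negb_and -!ltNge yc orbT.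
apply: (@has_derive_locally_cst _ _ _ d (x + 1) _ df); first lra.
by move=> y /andP[dy _]; rewrite !o.
Qed.

Lemma weak_derivative_toL2 f f1 : has_derive f f1 -> continuous f1 ->
  weak_derivative (toL2 f) (toL2 f1).
Proof.
move=> df cf1 p [dp cp [c [d [c1 d0 p0]]]].
have hp : has_derive p (derive1 p) by apply/has_deriveP.
have p0' : supp_in p c d by exact: p0.
have := lebI_integral_by_parts0 df hp cf1 cp c1 d0 p0'.
by rewrite !toL2_continuous//; exact: is_derive_continuous df.
Qed.

Lemma has_trace_toL2 f (x : R) : continuous f -> has_trace (toL2 f) x (f x).
Proof.
move=> cf; exists f; split => //; first exact: continuous_subspaceT.
by rewrite toL2_continuous//; apply: lebI_ae.
Qed.

(** Written as a linear combination so that [Ck_lin] applies to it directly. *)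
Definition kdv_fun (a : R) f1 f3 : R -> R := fun x => (-1) * f3 x + (- a) * f1 x.

Lemma smooth_kdv (a : R) f f1 f2 f3 (c d : R) : has_derive f f1 -> has_derive f1 f2 ->
  has_derive f2 f3 -> continuous f3 -> -1 < c -> d < 0 -> supp_in f c d ->
  kdv_op a (toL2 f) (toL2 (kdv_fun a f1 f3)).
Proof.
move=> df df1 df2 cf3 c1 d0 f0.
have cf2 := is_derive_continuous df2; have cf1 := is_derive_continuous df1.
have cf := is_derive_continuous df.
have [fm fz] := supp_in_out c1 d0 f0.
have [f1m f1z] := supp_in_out c1 d0 (supp_in_derive df f0).
exists (toL2 f1), (toL2 f2), (toL2 f3); split; split.
- exact: weak_derivative_toL2.
- exact: weak_derivative_toL2.
- exact: weak_derivative_toL2.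
- by have := has_trace_toL2 (-1) cf; rewrite fm.
- by have := has_trace_toL2 0 cf; rewrite fz.
- by have := has_trace_toL2 0 cf1; rewrite f1z.
- apply: lebI_ae => x _ _.
  rewrite [RHS](_ : _ = - toL2 f3 x - a * toL2 f1 x)// !toL2_continuous//; last by rewrite /kdv_fun; continuity.
  by rewrite /kdv_fun; ring.
Qed.

(* Iterating needs [f] to stay compactly supported, so the whole chain is
   carried along with a common support. *)
Lemma Ck_kdv (a : R) k f (c d : R) : -1 < c -> d < 0 -> supp_in f c d -> Ck k.+3 f ->
  exists g, [/\ kdv_op a (toL2 f) (toL2 g), Ck k g, supp_in g c d &
   exists f1 f2 f3, [/\ has_derive f f1, has_derive f1 f2, has_derive f2 f3, continuous f3
     & g = kdv_fun a f1 f3]].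
Proof.
move=> c1 d0 f0 [f1 df [f2 df1 [f3 df2 cf3]]].
have s1 := supp_in_derive df f0; have s2 := supp_in_derive df1 s1.
have s3 := supp_in_derive df2 s2.
exists (kdv_fun a f1 f3); split.
- by apply: (@smooth_kdv a f f1 f2 f3 c d) => //; exact: Ck_continuous cf3.
- apply: Ck_lin => //; apply: (@Ck_le _ k.+2); first by rewrite -addn2 leq_addr.
  by exists f2 => //; exists f3.
- by move=> x h; rewrite /kdv_fun s1// s3// !mulr0 addr0.
- by exists f1, f2, f3; split => //; exact: Ck_continuous cf3.
Qed.

End SmoothDomain.

(** * Iterated Steklov averages *)

Section Steklov.
Variable R : realType.
Implicit Types (f g F u v : R -> R) (w z : L2 R).

Definition primitive f : R -> R :=
  if pselect (exists F, has_derive F f) is left H then projT1 (cid H) else f.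

Lemma primitiveP f : continuous f -> has_derive (primitive f) f.
Proof.
by move=> /continuous_primitive h; rewrite /primitive; case: pselect => // H; case: cid.
Qed.

(* The average of [f] over [x, x + h]; the affine form [1 * x + h] is the one
   of [has_derive_comp_affine] and [Ck_affine]. *)
Definition steklov (h : R) f : R -> R :=
  fun x => h^-1 * primitive f (1 * x + h) + (- h^-1) * primitive f x.

Lemma has_derive_steklov h f : continuous f ->
  has_derive (steklov h f) (fun x => h^-1 * (f (x + h) - f x)).
Proof.
move=> /primitiveP dP.
have := has_deriveD (has_deriveZ h^-1 (has_derive_comp_affine 1 h dP)) (has_deriveZ (- h^-1) dP).
by apply: has_derive_ext => x; rewrite !mul1r mulNr mulrBr.
Qed.

Lemma Ck_steklov k h f : Ck k f -> Ck k.+1 (steklov h f).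
Proof.
move=> cf; exists (fun x => h^-1 * f (1 * x + h) + (- h^-1) * f x).
  apply: has_derive_ext (has_derive_steklov h (Ck_continuous cf)) => x.
  by rewrite mul1r mulNr mulrBr.
by apply: Ck_lin => //; exact: Ck_affine.
Qed.

Lemma continuous_steklov h f : continuous f -> continuous (steklov h f).
Proof. by move=> /(@Ck_steklov 0 h)/Ck_continuous. Qed.

(** The mean value theorem is applied to the difference of two shifted primitives, which yields one
    shift s common to x and y. A common shift is what lets oscillation bounds pass through iterated
    averages. *)
Lemma steklov_sub h f (x y : R) : 0 < h -> continuous f ->
  exists2 s, 0 < s < h & steklov h f x - steklov h f y = f (x + s) - f (y + s).
Proof.
move=> h0 /primitiveP dP.
have d : has_derive (fun s => primitive f (1 * s + x) - primitive f (1 * s + y))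
                    (fun s => f (x + s) - f (y + s)).
  have := has_deriveB (has_derive_comp_affine 1 x dP) (has_derive_comp_affine 1 y dP).
  by apply: has_derive_ext => s; rewrite !mul1r !(addrC s).
have [s sh e] := has_derive_MVT d h0; exists s => //.
move: e; rewrite subr0 !mul1r !add0r => e.
apply: (mulIf (lt0r_neq0 h0)); rewrite -e /steklov !mul1r !(addrC h).
by field; exact: lt0r_neq0.
Qed.

Lemma steklov_val h f (x : R) : 0 < h -> continuous f ->
  exists2 s, 0 < s < h & steklov h f x = f (x + s).
Proof.
move=> h0 /primitiveP dP.
have xh : x < x + h by rewrite ltrDl.
have [y /andP[xy yh] e] := has_derive_MVT dP xh; exists (y - x).
  by rewrite subr_gt0 xy ltrBlDl.
rewrite subrKC /steklov mul1r mulNr -mulrBr e addrAC subrr add0r mulrCA mulVf ?mulr1//.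
by rewrite gt_eqF.
Qed.

Lemma iter_steklov_continuous n h f : continuous f -> continuous (iter n (steklov h) f).
Proof. by move=> cf; elim: n => //= n ih; exact: continuous_steklov. Qed.

Lemma Ck_iter_steklov n h f : continuous f -> Ck n (iter n (steklov h) f).
Proof. by move=> cf; elim: n => //= n ih; exact: Ck_steklov. Qed.

(** Each average looks ahead by at most h, so n of them see f on [l, r + n h] only. *)
Lemma iter_steklov_osc n h f (l r B : R) : 0 < h -> continuous f ->
  (forall x y, l <= x <= r + n%:R * h -> l <= y <= r + n%:R * h -> `|f x - f y| <= B) ->
  forall x y, l <= x <= r -> l <= y <= r ->
    `|iter n (steklov h) f x - iter n (steklov h) f y| <= B.
Proof.
move=> h0 cf; elim: n r => [|n ih] r fB x y /andP[lx xr] /andP[ly yr] /=.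
  by apply: fB; rewrite mul0r addr0; apply/andP.
have [s /andP[s0 sh] ->] := steklov_sub x y h0 (@iter_steklov_continuous n h _ cf).
apply: (ih (r + h)); [|lra|lra].
move=> x' y' /andP[l1 r1] /andP[l2 r2]; apply: fB; apply/andP; split => //.
- by rewrite -natr1 mulrDl mul1r; lra.
- by rewrite -natr1 mulrDl mul1r; lra.
Qed.

Lemma iter_steklov_near n h f (x m B : R) : 0 < h -> continuous f ->
  (forall y, x <= y <= x + n%:R * h -> `|m - f y| <= B) ->
  `|m - iter n (steklov h) f x| <= B.
Proof.
move=> h0 cf; elim: n x => [|n ih] x fB /=.
  by apply: fB; rewrite mul0r addr0 lexx.
have [s /andP[s0 sh] ->] := steklov_val x h0 (@iter_steklov_continuous n h _ cf).
apply: ih => y /andP[y1 y2]; apply: fB.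
by rewrite -natr1 mulrDl mul1r; apply/andP; split; lra.
Qed.

(** Forward averages spread the support to the left only. Off the new support, f vanishes on the
    whole averaging window, so [iter_steklov_near] applies with target 0 and error 0. *)
Lemma iter_steklov_supp n h f (c d : R) : 0 < h -> continuous f -> supp_in f c d ->
  supp_in (iter n (steklov h) f) (c - n%:R * h) d.
Proof.
move=> h0 cf f0 x xcd; apply/eqP; rewrite -normr_le0 -normrN -sub0r.
apply: iter_steklov_near => // y /andP[y1 y2]; rewrite f0 ?subrr ?normr0//.
move: xcd; rewrite !in_itv/= !negb_and -!ltNge => /orP[|] h1; apply/orP; [left|right]; lra.
Qed.

End Steklov.

(** * Mollification of H^1 functions vanishing at both ends *)

Section Approximation.
Variable R : realType.
Implicit Types (f g F u v : R -> R) (w z : L2 R).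
Notation II f := (\int[lebI R]_x (f x)).

Lemma clamp_sub (x y : R) : x <= y -> 0 <= clamp y - clamp x <= y - x.
Proof.
move=> xy; rewrite /clamp /Num.max /Num.min.
by case: (ltP 0 x) => ?; case: (ltP 0 y) => ?; rewrite ?ltrN10;
  case: (ltP (-1) x) => ?; case: (ltP (-1) y) => ?; lra.
Qed.

Lemma clamp_out (x : R) : x \notin `[-1, 0] -> clamp x = -1 \/ clamp x = 0.
Proof.
rewrite in_itv/= negb_and -!ltNge => /orP[h|h]; [left|right];
  by rewrite /clamp /Num.max /Num.min; case: (ltP 0 x) => ?; rewrite ?ltrN10; case: (ltP (-1) x) => ?; lra.
Qed.

(** The comparison is assumed on [-1,0] only, so both functions are first composed with [clamp].
    This keeps the integral: by the mean value theorem the two primitives have equal increments. *)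
Lemma le_lebI_integral f g : continuous f -> continuous g -> (forall x, -1 <= x <= 0 -> f x <= g x) ->
  II f <= II g.
Proof.
move=> cf cg fg.
have cfc : continuous (fun x => f (clamp x)).
  apply: (@clamp_extension _ f); exact: continuous_subspaceT.
have cgc : continuous (fun x => g (clamp x)).
  apply: (@clamp_extension _ g); exact: continuous_subspaceT.
have E h : continuous h -> continuous (fun x => h (clamp x)) -> II h = II (fun x => h (clamp x)).
  move=> ch chc; have [H dH] := continuous_primitive ch; have [G dG] := continuous_primitive chc.
  rewrite (lebI_FTC dH ch) (lebI_FTC dG chc).
  have [c /andP[c1 c0]] := has_derive_MVT (has_deriveB dH dG) (ltrN10 _).
  rewrite clampE ?subrr ?mul0r; last by rewrite !ltW.
  by move=> e; lra.
rewrite (E f)// (E g)//; apply: le_Rintegral => //.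
- exact: continuous_lebI_integrable.
- exact: continuous_lebI_integrable.
by move=> x _; apply: fg; have := clamp_itv x; rewrite in_itv.
Qed.

Section Approx.
Variables u u1 : R -> R.
Hypotheses (du : has_derive u u1) (cu1 : continuous u1) (um : u (-1) = 0) (uz : u 0 = 0).

(** [W] is u extended by 0, as u vanishes at both ends. With [V] a primitive of u'^2, the increment
    Vc (x + r) - Vc (x - r) is the energy of [W] within distance r of x. *)
Let W x := u (clamp x).
Let V := primitive (fun x => u1 x ^+ 2).
Let Vc x := V (clamp x).
Let n1 : R := L2norm (toL2 u1).

Let cV2 : continuous (fun x => u1 x ^+ 2). Proof. by continuity. Qed.
Let dV : has_derive V (fun x => u1 x ^+ 2). Proof. exact: primitiveP. Qed.
Let cu : continuous u. Proof. exact: is_derive_continuous du. Qed.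
Let cV : continuous V. Proof. exact: is_derive_continuous dV. Qed.

Let cW : continuous W.
Proof. by apply: (@clamp_extension _ u); exact: continuous_subspaceT. Qed.
Let cVc : continuous Vc.
Proof. by apply: (@clamp_extension _ V); exact: continuous_subspaceT. Qed.

Let W0 : supp_in W (-1) 0.
Proof. by move=> x /clamp_out[]; rewrite /W => ->. Qed.

Let V_le (x y : R) : x <= y -> V x <= V y.
Proof. by move=> xy; apply: (has_derive_ndecr dV xy) => z _; exact: sqr_ge0. Qed.

Let Vc_le (x y : R) : x <= y -> Vc x <= Vc y.
Proof. by move=> /clamp_sub /andP[h _]; apply: V_le; lra. Qed.

Let n1E : n1 ^+ 2 = V 0 - V (-1).
Proof. by rewrite /n1 L2norm_toL2_sqr// (lebI_FTC dV). Qed.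

Let Vc_bd (x : R) : V (-1) <= Vc x <= V 0.
Proof.
have := clamp_itv x; rewrite in_itv/= => /andP[h1 h2].
by rewrite /Vc !V_le.
Qed.

Let W_incr (x r z y : R) : x - r <= z <= x + r -> x - r <= y <= x + r ->
  `|W z - W y| <= Num.sqrt (2 * r * (Vc (x + r) - Vc (x - r))).
Proof.
move=> zx yx; rewrite -sqrtr_sqr ler_wsqrtr//.
wlog zy : z y zx yx / z <= y.
  move=> H; have [zy|yz] := leP z y; first exact: H.
  by rewrite -sqrrN opprB; apply: H => //; exact: ltW.
have /andP[c1 c2] := clamp_sub zy.
have c1' : clamp z <= clamp y by lra.
rewrite -sqrrN opprB; apply: le_trans (has_derive_increment_sqr du dV c1') _.
move: zx yx => /andP[z1 z2] /andP[y1 y2].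
apply: ler_pM; [lra|by rewrite subr_ge0 V_le|lra|].
by rewrite lerB// Vc_le.
Qed.

(** A primitive U of Vc replaces the exchange of integrals: the integral is a difference of two
    increments of U over length 2 r, hence 2 r times a difference of two values of Vc, which lie
    between V (-1) and V 0. *)
Lemma lebI_integral_osc (r : R) : 0 < r -> II (fun x => Vc (x + r) - Vc (x - r)) <= 2 * r * n1 ^+ 2.
Proof.
move=> r0; have dU := primitiveP cVc; set U := primitive Vc in dU.
have aff (s x : R) : 1 * x + s = x + s by rewrite mul1r.
have d1 := has_derive_comp_affine 1 r dU.
have d2 := has_derive_comp_affine 1 (- r) dU.
have d : has_derive (fun x => U (1 * x + r) - U (1 * x - r)) (fun x => Vc (x + r) - Vc (x - r)).
  by apply: has_derive_ext (has_deriveB d1 d2) => x; rewrite !mul1r.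
have c : continuous (fun x => Vc (x + r) - Vc (x - r)).
  have a1 := @Ck_affine _ 0 1 r _ cVc; have a2 := @Ck_affine _ 0 1 (- r) _ cVc.
  apply: continuous_funB.
    by under eq_fun do rewrite -[X in X + r]mul1r.
  by under eq_fun do rewrite -[X in X - r]mul1r.
rewrite (lebI_FTC d c) !mul1r add0r sub0r n1E.
have [|x _ e1] := has_derive_MVT dU (_ : - r < r); first lra.
have [|y _ e2] := has_derive_MVT dU (_ : -1 - r < -1 + r); first lra.
have /andP[_ b1] := Vc_bd x; have /andP[b2 _] := Vc_bd y.
have -> : U r - U (- r) - (U (-1 + r) - U (-1 - r)) = 2 * r * (Vc x - Vc y) by lra.
by rewrite ler_wpM2l ?lerB// mulr_ge0 ?ltW.
Qed.

(** The local oscillation of u at scale r carries one factor sqrt (2 r) pointwise; integrating the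
    local energies supplies the second. *)
Lemma L2norm_osc f (r K : R) : continuous f -> 0 < r -> 0 <= K ->
  (forall x, -1 <= x <= 0 -> `|f x| <= K * Num.sqrt (2 * r * (Vc (x + r) - Vc (x - r)))) ->
  L2norm (toL2 f) <= K * (2 * r) * n1.
Proof.
move=> cf r0 K0 fK; have n10 : 0 <= n1 := L2norm_ge0 _.
have r0' := ltW r0.
apply: L2norm_le_sqr; first by rewrite !mulr_ge0.
rewrite L2norm_toL2_sqr//.
have c : continuous (fun x => Vc (x + r) - Vc (x - r)).
  have a1 := @Ck_affine _ 0 1 r _ cVc; have a2 := @Ck_affine _ 0 1 (- r) _ cVc.
  apply: continuous_funB.
    by under eq_fun do rewrite -[X in X + r]mul1r.
  by under eq_fun do rewrite -[X in X - r]mul1r.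
apply: (@le_trans _ _ (II (fun x => (K ^+ 2 * (2 * r)) * (Vc (x + r) - Vc (x - r))))).
  apply: le_lebI_integral; [by continuity|exact (@continuous_funZ _ _ _ c)|].
  move=> x /fK fx; rewrite -[_ ^+ 2]real_normK ?num_real//.
  rewrite -mulrA.
  have q0 : 0 <= 2 * r * (Vc (x + r) - Vc (x - r)).
    by rewrite mulr_ge0 ?mulr_ge0// subr_ge0 Vc_le//; lra.
  rewrite -[X in _ <= _ * X](sqr_sqrtr q0) -exprMn ler_sqr ?nnegrE ?mulr_ge0 ?sqrtr_ge0//.
rewrite (lebI_integralZ _ c).
have -> : (K * (2 * r) * n1) ^+ 2 = K ^+ 2 * (2 * r) * (2 * r * n1 ^+ 2) by ring.
rewrite ler_wpM2l//; last exact: lebI_integral_osc.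
by rewrite !mulr_ge0// sqr_ge0.
Qed.

Let delta (h : R) f x : R := h^-1 * (f (x + h) - f x).

Let has_derive_delta h f f1 : has_derive f f1 -> has_derive (delta h f) (delta h f1).
Proof.
move=> df x; have := has_deriveZ h^-1 (has_deriveB (has_derive_comp_affine 1 h df) df) x.
by rewrite !mul1r /delta; under eq_fun do rewrite mul1r.
Qed.

(* [u], extended by 0, is averaged [m + 3] times over steps [h]; the dilation
   by [1 + (m + 5) h] keeps the support inside ]-1,0[. *)
Lemma kdv_approx (a : R) (m : nat) (h : R) : 0 <= a -> 0 < h <= 1 ->
  let C := 2 * m.+4%:R * (4 * m.+4.+2%:R ^+ 3 + a * m.+4.+2%:R + 1) in
  exists f f1 f2 f3 (c d : R),
  [/\ [/\ Ck m.+3 f, -1 < c, d < 0 & supp_in f c d],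
      [/\ has_derive f f1, has_derive f1 f2, has_derive f2 f3 & continuous f3],
      L2norm (toL2 (fun x => u x - f x)) <= C * h * n1 &
      L2norm (toL2 (kdv_fun a f1 f3)) <= C * h^-1 ^+ 2 * n1].
Proof.
move=> a0 /andP[h0 h1] C.
have n10 : 0 <= n1 := L2norm_ge0 _.
pose n : R := m.+3%:R.
have n0 : 3 <= n by rewrite /n ler_nat.
pose S : R := m.+4.+2%:R; pose N1 : R := m.+4%:R.
have N1E : N1 = n + 1 by rewrite /N1 /n -natr1.
have SE : S = n + 3 by rewrite /S /n -natrD addn3.
have hV0 : 0 < h^-1 by rewrite invr_gt0.
have hh : h * h^-1 = 1 by rewrite divff// gt_eqF.
(* After n averages the support is [-1 - n h, 0]. The shift by h moves its right end off 0, and n +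
   2, one more than the resulting n + 1, leaves room at -1. *)
pose s := 1 + (n + 2) * h.
have s1 : 1 < s by rewrite /s ltrDl mulr_gt0//; lra.
have sS : s <= S.
  rewrite SE /s; have : (n + 2) * h <= (n + 2) * 1 by rewrite ler_wpM2l//; lra.
  lra.
pose g := iter m (steklov h) W; pose g1 := steklov h g; pose g2 := steklov h g1.
pose G := steklov h g2.
have cg : continuous g by exact: iter_steklov_continuous.
have cg1 : continuous g1 by exact: continuous_steklov.
have cg2 : continuous g2 by exact: continuous_steklov.
have dg1 : has_derive g1 (delta h g) by exact: has_derive_steklov.
have dg2 : has_derive g2 (delta h g1) by exact: has_derive_steklov.
have dG : has_derive G (delta h g2) by exact: has_derive_steklov.
have dG1 := has_derive_delta h dg2.
have dG2 := has_derive_delta h (has_derive_delta h dg1).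
have dG3 : continuous (delta h (delta h (delta h g))).
  have cd k : continuous k -> continuous (delta h k).
    move=> ck; have := @Ck_affine _ 0 1 h _ ck => /= ck'.
    have e : (fun x => k (1 * x + h)) = (fun x => k (x + h)).
      by apply/funext => x; rewrite mul1r.
    by rewrite e in ck'; exact: (@continuous_funZ _ _ _ (continuous_funB ck' ck)).
  exact: (cd _ (cd _ (cd _ cg))).
have GE : G = iter m.+3 (steklov h) W by [].
pose f x := G (s * x + h).
pose f1 x := s * delta h g2 (s * x + h).
pose f2 x := s * (s * delta h (delta h g1) (s * x + h)).
pose f3 x := s * (s * (s * delta h (delta h (delta h g)) (s * x + h))).
have df : has_derive f f1 by exact: has_derive_comp_affine.
have df1 : has_derive f1 f2.
  by apply: has_deriveZ; exact: (has_derive_comp_affine s h dG1).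
have df2 : has_derive f2 f3.
  by do 2! apply: has_deriveZ; exact: (has_derive_comp_affine s h dG2).
have cf3 : continuous f3.
  by do 3! apply: continuous_funZ; exact: (@Ck_affine _ 0 s h _ dG3).
have cf1 := is_derive_continuous df1; have cf := is_derive_continuous df.
exists f, f1, f2, f3, ((-1 - (n + 1) * h) / s), (- h / s).
have s0 : 0 < s by lra.
(* For x in [-1,0], the point s x + h and the n steps of length h after it stay within (n + 1) h of
   x. One window thus controls all values of [W] that enter f at x. *)
pose r := (n + 1) * h.
have r0 : 0 < r by rewrite /r mulr_gt0//; lra.
pose B x := Num.sqrt (2 * r * (Vc (x + r) - Vc (x - r))).
have B0 x : 0 <= B x := sqrtr_ge0 _.
have rng (x : R) : -1 <= x <= 0 -> x - r <= s * x + h /\ s * x + h + n * h <= x + r.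
  move=> /andP[x1 x0]; rewrite /s /r.
  have : - ((n + 2) * h) <= (n + 2) * h * x by rewrite -[leLHS]mulrN1 ler_wpM2l// mulr_ge0//; lra.
  have : (n + 2) * h * x <= 0 by rewrite mulr_ge0_le0// mulr_ge0//; lra.
  by move=> *; split; lra.
have osc (k : nat) (x y z : R) : (k <= m.+3)%N -> -1 <= x <= 0 ->
  s * x + h <= y <= s * x + h + (n - k%:R) * h -> s * x + h <= z <= s * x + h + (n - k%:R) * h ->
  `|iter k (steklov h) W y - iter k (steklov h) W z| <= B x.
  move=> km x01; have [l1 l2] := rng x x01.
  apply: iter_steklov_osc => // y' z'.
  rewrite -addrA -mulrDl subrK => /andP[y1 y2] /andP[z1 z2].
  by apply: W_incr; apply/andP; split; lra.
split.
- split.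
  + by apply: Ck_affine; exact: Ck_iter_steklov.
  + by rewrite ltr_pdivlMr// mulN1r /s; lra.
  + by rewrite mulNr oppr_lt0 divr_gt0.
  + move=> x; rewrite in_itv/= ler_pdivrMr// ler_pdivlMr// => xcd.
    rewrite /f GE; apply: (@iter_steklov_supp _ m.+3 h W (-1) 0) => //.
    rewrite in_itv/= -/n; move: xcd; rewrite !negb_and -!ltNge => /orP[|] xx; apply/orP; [left|right]; lra.
- by split.
- apply: (@le_trans _ _ (1 * (2 * r) * n1)); last first.
    rewrite ler_wpM2r// /C /r mul1r -/S -/N1 N1E mulrA ler_wpM2r ?(ltW h0)//.
    rewrite ler_peMr ?mulr_ge0//; [lra|].
    have S0 : 0 <= S by lra.
    have : 0 <= a * S by rewrite mulr_ge0.
    have : 0 <= S ^+ 3 by rewrite exprn_ge0.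
    lra.
  apply: L2norm_osc => //; first by continuity.
  move=> x x01; rewrite mul1r /f GE.
  have -> : u x = W x by rewrite /W clampE.
  have [l1 l2] := rng x x01.
  apply: iter_steklov_near => // y /andP[y1 y2]; apply: W_incr; apply/andP; split => //; lra.
(* Each derivative of f costs s / h, and S = m + 6 bounds s because h <= 1. The weaker 1/h of the
   first-order term is absorbed in h^(-3). *)
- pose K := (4 * S ^+ 3 + a * S) * h^-1 ^+ 3.
  have S0 : 0 <= S by lra.
  have aS : 0 <= a * S by rewrite mulr_ge0.
  have S3 : 0 <= S ^+ 3 by rewrite exprn_ge0.
  apply: (@le_trans _ _ (K * (2 * r) * n1)); last first.
    rewrite ler_wpM2r// /C /r /K -/S -/N1 N1E.
    have -> : (4 * S ^+ 3 + a * S) * h^-1 ^+ 3 * (2 * ((n + 1) * h)) =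
       (h * h^-1) * (2 * (n + 1) * (4 * S ^+ 3 + a * S) * h^-1 ^+ 2) by ring.
    rewrite hh mul1r ler_wpM2r ?exprn_ge0 ?(ltW hV0)// ler_wpM2l//; lra.
  apply: L2norm_osc => //.
  + by rewrite /kdv_fun; continuity.
  + by rewrite /K mulr_ge0 ?addr_ge0 ?mulr_ge0 ?exprn_ge0 ?(ltW hV0).
  move=> x x01; rewrite -/(B x).
  have hn : 3 * h <= n * h by rewrite ler_wpM2r// ltW.
  set y := s * x + h.
  have E1 : `|delta h g2 y| <= h^-1 * B x.
    rewrite /delta normrM (gtr0_norm hV0) ler_wpM2l ?(ltW hV0)//.
    apply: (osc m.+2) => //; rewrite -/y; have -> : n - m.+2%:R = 1 by rewrite /n -natr1 addrC addKr.
      lra.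
    lra.
  have E3 : `|delta h (delta h (delta h g)) y| <= h^-1 ^+ 3 * (4 * B x).
    (* The third difference combines three first differences with weights 1, -2, 1; each is at most
       [B x], which explains the 4. *)
    have -> : delta h (delta h (delta h g)) y = h^-1 ^+ 3 *
      ((g (y + h + h + h) - g (y + h + h)) - 2 * (g (y + h + h) - g (y + h)) + (g (y + h) - g y)).
      by rewrite /delta; ring.
    rewrite normrM ger0_norm ?exprn_ge0 ?(ltW hV0)// ler_wpM2l ?exprn_ge0 ?(ltW hV0)//.
    have n3 : (n - m%:R) * h = 3 * h by rewrite /n -addn3 natrD addrC addKr.
    have o (y1 y2 : R) : y <= y1 <= y + 3 * h -> y <= y2 <= y + 3 * h -> `|g y1 - g y2| <= B x.
      have mm : (m <= m.+3)%N by rewrite -addn3 leq_addr.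
      by move=> i1 i2; apply: (osc m _ _ _ mm x01); rewrite -/y n3.
    have o1 : `|g (y + h + h + h) - g (y + h + h)| <= B x by apply: o; lra.
    have o2 : `|g (y + h + h) - g (y + h)| <= B x by apply: o; lra.
    have o3 : `|g (y + h) - g y| <= B x by apply: o; lra.
    move: o1 o2 o3; rewrite !ler_norml => *; lra.
  rewrite /kdv_fun /f1 /f3 -/y.
  apply: le_trans (ler_normD _ _) _.
  have nrm (t : R) : `|s * t| = s * `|t| by rewrite normrM gtr0_norm.
  rewrite mulN1r normrN (nrm _) (nrm _) (nrm _) mulNr normrN (normrM a) (ger0_norm a0) (nrm _).
  have e3 : s * (s * (s * `|delta h (delta h (delta h g)) y|)) <= S ^+ 3 * (h^-1 ^+ 3 * (4 * B x)).
    have -> t : s * (s * (s * t)) = s ^+ 3 * t by ring.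
    apply: ler_pM E3; rewrite ?normr_ge0 ?exprn_ge0 ?(ltW s0)//.
    by rewrite lerXn2r// nnegrE ltW.
  have hV1 : 1 <= h^-1 by rewrite invf_ge1.
  have e1 : a * (s * `|delta h g2 y|) <= a * (S * (h^-1 ^+ 3 * B x)).
    have hV3 : h^-1 <= h^-1 ^+ 3 by rewrite -[leLHS]expr1; exact: ler_weXn2l.
    rewrite ler_wpM2l//; apply: ler_pM => //; first exact: ltW.
    by apply: le_trans E1 _; rewrite ler_wpM2r.
  apply: le_trans (lerD e3 e1) _.
  by rewrite le_eqVlt; apply/orP; left; apply/eqP; rewrite /K; ring.
Qed.

End Approx.
End Approximation.

Section Seminorm.
Variable R : realType.
Implicit Types (u v w f g x y : L2 R).

Lemma L2norm_eqv u v : L2norm (u - v) = 0 -> L2norm u = L2norm v.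
Proof. by move=> /ae_L2norm /L2norm_ae_eq. Qed.

Lemma L2norm_eqv_le u v : L2norm (u - v) = 0 -> L2norm u <= L2norm v.
Proof. by move=> /L2norm_eqv ->. Qed.

Lemma L2norm_eq0_le u : L2norm u <= 0 -> L2norm u = 0.
Proof. by move=> h; apply/eqP; rewrite eq_le h L2norm_ge0. Qed.

Lemma L2norm_subrr u : L2norm (u - u) = 0.
Proof. by rewrite subrr L2norm0. Qed.

End Seminorm.

(** * Contraction semigroups and their generators *)

Section Semigroup.
Variable R : realType.
Variables (S : R -> L2 R -> L2 R) (hS : contraction_semigroup S).
Implicit Types (f g x y z : L2 R) (s t h : R).
Notation N := (@L2norm R).

Lemma S_lin t (k : R) f g : 0 <= t -> N (S t (k *: f + g) - (k *: S t f + S t g)) = 0.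
Proof. by move=> t0; apply: L2norm_ae; exact: semigroup_linear. Qed.

Lemma S_contr t f : 0 <= t -> N (S t f) <= N f.
Proof. exact: semigroup_contraction. Qed.

Lemma S_0 f : N (S 0 f - f) = 0.
Proof. by apply: L2norm_ae; exact: semigroup0. Qed.

Lemma S_D s t f : 0 <= s -> 0 <= t -> N (S (s + t) f - S s (S t f)) = 0.
Proof. by move=> s0 t0; apply: L2norm_ae; exact: semigroupD. Qed.

(** Linearity of [S t] holds only almost everywhere. Its instances are gathered here into terms of
    norm zero, so that later proofs use linearity and contraction in one inequality. *)
Lemma S_comb t (k : R) x y g : 0 <= t ->
  N (k *: (S t x - S t y) - S t g) <= N (k *: (x - y) - g).
Proof.
move=> t0; have e1 := S_lin (-1) y x t0; have e2 := S_lin k (-1 *: y + x) (-1 *: g) t0.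
have e3 := S_lin (-1) g 0 t0; have e4 := S_lin (-1) (0 : L2 R) 0 t0.
have z : N (S t 0) = 0.
  by apply: L2norm_eq0_le; rewrite -[leRHS](@L2norm0 R) S_contr.
apply: le_trans (S_contr _ t0); rewrite le_eqVlt; apply/orP; left; apply/eqP.
apply: L2norm_eqv; apply: L2norm_eq0_le.
have E1 : -1 *: y + x = x - y by rewrite scaleN1r addrC.
rewrite E1 in e1 e2; rewrite addr0 in e3.
have E2 : k *: (x - y) + -1 *: g = k *: (x - y) - g by rewrite scaleN1r.
rewrite E2 in e2.
have -> : k *: (S t x - S t y) - S t g - S t (k *: (x - y) - g) =
  - (S t (k *: (x - y) - g) - (k *: S t (x - y) + S t (-1 *: g)))
  - k *: (S t (x - y) - (-1 *: S t y + S t x))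
  - (S t (-1 *: g) - (-1 *: S t g + S t 0)) - S t 0.
  apply/LfuneqP => q; rewrite !(L2addE, L2oppE, L2scaleE); ring.
rewrite (le_trans (L2normB _ _))// z addr0 (le_trans (L2normB _ _))// e3 addr0.
by rewrite (le_trans (L2normB _ _))// L2normZ e1 mulr0 addr0 L2normN e2.
Qed.

Lemma S_sub t x y : 0 <= t -> N (S t x - S t y) <= N (x - y).
Proof.
move=> t0; have := S_comb 1 x y 0 t0; rewrite !scale1r subr0 => h.
have z : N (S t 0) = 0.
  by apply: L2norm_eq0_le; rewrite -[leRHS](@L2norm0 R) S_contr.
apply: le_trans h; have := L2normD (S t x - S t y - S t 0) (S t 0).
by rewrite subrK z addr0.
Qed.

Lemma S_eqv t x y : 0 <= t -> N (x - y) = 0 -> N (S t x - S t y) = 0.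
Proof. by move=> t0 xy; apply: L2norm_eq0_le; rewrite -xy S_sub. Qed.

Lemma S_continuous0 f (e : R) : 0 < e -> exists2 d, 0 < d &
  forall h, 0 <= h -> h < d -> N (S h f - f) <= e.
Proof.
move=> e0; have := semigroup_continuous hS f.
move=> /cvgrPdist_le /(_ e e0); rewrite near_withinE => -[d /= d0 hd].
exists d => // h; rewrite le_eqVlt => /predU1P[<- _|h0 hdl]; first by rewrite S_0 ltW.
have := hd h _ h0; rewrite sub0r normrN ger0_norm ?L2norm_ge0//; apply.
by rewrite /= sub0r normrN gtr0_norm.
Qed.

Lemma generatorP f g : generator S f g <-> forall e : R, 0 < e -> exists2 d : R, 0 < d &
  forall h, 0 < h -> h < d -> N (h^-1 *: (S h f - f) - g) <= e.
Proof.
split=> [H e e0|H].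
  move: H => /cvgrPdist_le /(_ e e0); rewrite near_withinE => -[d /= d0 hd].
  exists d => // h h0 hdl.
  have := hd h _ h0; rewrite sub0r normrN ger0_norm ?L2norm_ge0//; apply.
  by rewrite /= sub0r normrN gtr0_norm.
apply/cvgrPdist_le => e e0; rewrite near_withinE.
have [d d0 hd] := H e e0; exists d => //= h hdl h0.
rewrite sub0r normrN ger0_norm ?L2norm_ge0//; apply: hd => //.
by move: hdl; rewrite /ball_/= sub0r normrN gtr0_norm.
Qed.

Lemma generator_scaled h f g : 0 < h ->
  N (S h f - f - h *: g) = h * N (h^-1 *: (S h f - f) - g).
Proof.
move=> h0; have := L2normZ h (h^-1 *: (S h f - f) - g); rewrite gtr0_norm// => <-.
rewrite scalerBr scalerA divff ?scale1r//.
exact: lt0r_neq0.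
Qed.

(** The increment form has no h^-1 and can be summed over many small steps. *)
Lemma generator_incrP f g : generator S f g <-> forall e : R, 0 < e -> exists2 d : R, 0 < d &
  forall h, 0 < h -> h < d -> N (S h f - f - h *: g) <= h * e.
Proof.
rewrite generatorP; split => H e /H [d d0 hd]; exists d => // h h0 /(hd h h0);
  by rewrite generator_scaled// ler_pM2l.
Qed.

Lemma generator_eqv f g f' g' : N (f - f') = 0 -> N (g - g') = 0 ->
  generator S f g -> generator S f' g'.
Proof.
move=> ff' gg' /generator_incrP H; apply/generator_incrP => e /H[d d0 hd].
exists d => // h h0 /(hd h h0); apply: le_trans; apply: L2norm_eqv_le.
apply: L2norm_eq0_le.
have -> : S h f' - f' - h *: g' - (S h f - f - h *: g) =
   - (S h f - S h f') + (f - f') + h *: (g - g').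
  by apply/LfuneqP => q; rewrite !(L2addE, L2oppE, L2scaleE); ring.
rewrite (le_trans (L2normD _ _))// L2normZ gg' mulr0 addr0.
by rewrite (le_trans (L2normD _ _))// ff' addr0 L2normN S_eqv// ltW.
Qed.

Lemma generator_unique f g g' : generator S f g -> generator S f g' -> N (g - g') = 0.
Proof.
move=> /generatorP H /generatorP H'; apply: L2norm_eq0_le.
apply/ler_addgt0Pr => e e0; rewrite add0r.
have e2 : 0 < e / 2 by lra.
have [d d0 hd] := H _ e2; have [d' d'0 hd'] := H' _ e2.
pose h := Num.min d d' / 2.
have [h0 h1 h2] : [/\ 0 < h, h < d & h < d'].
  by rewrite /h /Num.min; case: ifP => *; split; lra.
have := hd h h0 h1; have := hd' h h0 h2.
have := L2norm_subl g (h^-1 *: (S h f - f)) g'; rewrite (L2norm_distC g (h^-1 *: (S h f - f))); lra.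
Qed.

Lemma generator_lin (k : R) f g f' g' : generator S f g -> generator S f' g' ->
  generator S (k *: f + f') (k *: g + g').
Proof.
move=> /generator_incrP H /generator_incrP H'; apply/generator_incrP => e e0.
pose m := 2 * (`|k| + 1); have m0 : 0 < m by have := normr_ge0 k; rewrite /m; lra.
have em : 0 < e / m by rewrite divr_gt0.
have e2 : 0 < e / 2 by lra.
have [d d0 hd] := H _ em; have [d' d'0 hd'] := H' _ e2.
exists (Num.min d d'); first by rewrite lt_min d0 d'0.
move=> h h0; rewrite lt_min => /andP[h1 h2].
have -> : S h (k *: f + f') - (k *: f + f') - h *: (k *: g + g') =
  (S h (k *: f + f') - (k *: S h f + S h f')) + k *: (S h f - f - h *: g) +
  (S h f' - f' - h *: g').
  by apply/LfuneqP => q; rewrite !(L2addE, L2oppE, L2scaleE); ring.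
have := L2normD ((S h (k *: f + f') - (k *: S h f + S h f')) + k *: (S h f - f - h *: g))
  (S h f' - f' - h *: g').
have := L2normD (S h (k *: f + f') - (k *: S h f + S h f')) (k *: (S h f - f - h *: g)).
have e1 := S_lin k f f' (ltW h0); have e2' := L2normZ k (S h f - f - h *: g) => n1 n2.
have n3 := hd' h h0 h2; have n4 := hd h h0 h1.
have n5 : `|k| * N (S h f - f - h *: g) <= `|k| * (h * (e / m)) by rewrite ler_wpM2l.
have n6 : `|k| * (h * (e / m)) <= h * (e / 2).
  have -> : `|k| * (h * (e / m)) = h * (e / m * `|k|) by ring.
  rewrite ler_wpM2l ?ltW// mulrAC ltr_pdivrMr//.
  rewrite /m; have := normr_ge0 k; nra.
lra.
Qed.

Lemma generatorB f g f' g' : generator S f g -> generator S f' g' ->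
  generator S (f - f') (g - g').
Proof.
move=> H H'; have := generator_lin (-1) H' H.
by rewrite !scaleN1r ![- _ + _]addrC.
Qed.

Lemma S_comm s t f : 0 <= s -> 0 <= t -> N (S s (S t f) - S t (S s f)) = 0.
Proof.
move=> s0 t0; apply: L2norm_eq0_le.
have := L2norm_subl (S s (S t f)) (S (s + t) f) (S t (S s f)).
have e1 := S_D f s0 t0; have e2 := S_D f t0 s0; rewrite (addrC t s) in e2.
by rewrite (L2norm_distC (S s (S t f)) (S (s + t) f)) e1 e2 addr0.
Qed.

Lemma generator_S t f g : 0 <= t -> generator S f g -> generator S (S t f) (S t g).
Proof.
move=> t0 /generatorP H; apply/generatorP => e /H[d d0 hd]; exists d => // h h0 /(hd h h0).
apply: le_trans; apply: le_trans (S_comb h^-1 (S h f) f g t0).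
apply: L2norm_eqv_le; apply: L2norm_eq0_le.
have -> : h^-1 *: (S h (S t f) - S t f) - S t g - (h^-1 *: (S t (S h f) - S t f) - S t g) =
  h^-1 *: (S h (S t f) - S t (S h f)).
  by apply/LfuneqP => q; rewrite !(L2addE, L2oppE, L2scaleE); ring.
by rewrite L2normZ (S_comm f (ltW h0) t0) mulr0.
Qed.

(** Telescoping: the j-th step contributes S (j tau) applied to the remainder over one step,
    contracted, plus tau (S (j tau) g - g). *)
Lemma S_steps (n : nat) (tau : R) f g (M : R) : 0 <= tau ->
  (forall s, 0 <= s -> s <= n%:R * tau -> N (S s g - g) <= M) ->
  N (S (n%:R * tau) f - f - (n%:R * tau) *: g) <=
    n%:R * (N (S tau f - f - tau *: g) + tau * M).
Proof.
move=> t0; elim: n => [|n ih] HM.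
  rewrite !mul0r scale0r subr0 S_0//.
have nt0 : 0 <= n%:R * tau by rewrite mulr_ge0.
have nS : n.+1%:R * tau = n%:R * tau + tau by rewrite -natr1 mulrDl mul1r.
have HM' : forall s, 0 <= s -> s <= n%:R * tau -> N (S s g - g) <= M.
  by move=> s s0 sn; apply: HM; [exact: s0|rewrite nS (le_trans sn)// lerDl].
have {}ih := ih HM'; have hn := HM' _ nt0 (lexx _).
have nS' (X : R) : n.+1%:R * X = n%:R * X + X by rewrite -natr1 mulrDl mul1r.
rewrite nS (nS' (_ + _)).
set T := n%:R * tau in nt0 nS hn ih *.
have -> : S (T + tau) f - f - (T + tau) *: g =
  (S (T + tau) f - S T (S tau f)) + (1 *: (S T (S tau f) - S T f) - S T (tau *: g + 0))
  + ((S T (tau *: g + 0) - (tau *: S T g + S T 0)) + S T 0 + tau *: (S T g - g)) + (S T f - f - T *: g).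
  by apply/LfuneqP => q; rewrite !(L2addE, L2oppE, L2scaleE); ring.
have z : N (S T 0) = 0.
  by apply: L2norm_eq0_le; rewrite -[leRHS](@L2norm0 R) S_contr.
apply: le_trans (L2normD _ _) _; rewrite addrC lerD//.
apply: le_trans (L2normD _ _) _; apply: lerD.
  apply: le_trans (L2normD _ _) _; rewrite S_D// add0r.
  by apply: le_trans (S_comb _ _ _ _ nt0) _; rewrite scale1r addr0.
apply: le_trans (L2normD _ _) _; rewrite L2normZ ger0_norm// -[leRHS]add0r lerD//.
  by apply: le_trans (L2normD _ _) _; rewrite S_lin// z addr0.
by rewrite ler_wpM2l.
Qed.

(** Plays the part of S h f - f = integral of S s g over [0,h], without vector-valued integration:
    over steps of length h / n the remainders are o(h / n) and add up to an arbitrarily small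
    error. *)
Lemma generator_taylor h f g (M : R) : generator S f g -> 0 <= h ->
  (forall s, 0 <= s -> s <= h -> N (S s g - g) <= M) ->
  N (S h f - f - h *: g) <= h * M.
Proof.
move=> /generator_incrP H; rewrite le_eqVlt => /predU1P[<- _|h0 HM].
  by rewrite scale0r subr0 S_0 mul0r.
apply/ler_addgt0Pr => e e0.
have eh : 0 < e / h by rewrite divr_gt0.
have [d d0 hd] := H _ eh.
have [n hn] : exists n : nat, h / d < n%:R.
  by exists (Num.truncn (h / d)).+1; rewrite truncnS_gt.
have n0 : 0 < n%:R :> R by apply: lt_trans hn; rewrite divr_gt0.
pose tau := h / n%:R.
have ntau : n%:R * tau = h by rewrite /tau mulrC divfK// gt_eqF.
have tau0 : 0 < tau by rewrite divr_gt0.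
have taud : tau < d by rewrite /tau ltr_pdivrMr// mulrC -ltr_pdivrMr.
have := @S_steps n tau f g M (ltW tau0); rewrite ntau => /(_ HM) h1.
apply: le_trans h1 _; rewrite mulrDr mulrA ntau addrC lerD2l.
have := hd tau tau0 taud => h2.
apply: (@le_trans _ _ (n%:R * (tau * (e / h)))); first by rewrite ler_wpM2l// ltW.
by rewrite mulrA ntau mulrC divfK// gt_eqF.
Qed.

Lemma generator_lip h f g : generator S f g -> 0 <= h -> N (S h f - f) <= h * N g.
Proof.
move=> H h0; pose g0 : L2 R := 0.
(* [generator_taylor] bounds the remainder with respect to any [g]; the crude
   bound N (S s g - g) <= 2 N g would lose a factor, so steps are used again. *)
apply/ler_addgt0Pr => e e0; move: h0; rewrite le_eqVlt => /predU1P[<-|h0].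
  by rewrite S_0 mul0r add0r ltW.
have /generator_incrP {}H := H.
have eh : 0 < e / h by rewrite divr_gt0.
have [d d0 hd] := H _ eh.
have [n hn] : exists n : nat, h / d < n%:R.
  by exists (Num.truncn (h / d)).+1; rewrite truncnS_gt.
have n0 : 0 < n%:R :> R by apply: lt_trans hn; rewrite divr_gt0.
pose tau := h / n%:R.
have ntau : n%:R * tau = h by rewrite /tau mulrC divfK// gt_eqF.
have tau0 : 0 < tau by rewrite divr_gt0.
have taud : tau < d by rewrite /tau ltr_pdivrMr// mulrC -ltr_pdivrMr.
have z s : 0 <= s -> s <= n%:R * tau -> N (S s g0 - g0) <= 0.
  move=> s0 _; rewrite subr0; apply: le_trans (S_contr _ s0) _; by rewrite L2norm0.
have := S_steps f (ltW tau0) z; rewrite ntau !scaler0 !subr0 mulr0 addr0 => h1.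
apply: le_trans h1 _.
have h2 : N (S tau f - f) <= tau * (e / h) + tau * N g.
  have := L2normD (S tau f - f - tau *: g) (tau *: g); rewrite subrK L2normZ gtr0_norm//.
  have := hd tau tau0 taud; lra.
apply: (@le_trans _ _ (n%:R * (tau * (e / h) + tau * N g))); first by rewrite ler_wpM2l// ltW.
have -> : n%:R * (tau * (e / h) + tau * N g) = n%:R * tau * (e / h) + n%:R * tau * N g by ring.
by rewrite ntau [h * (e / h)]mulrC divfK ?gt_eqF// addrC.
Qed.

(** In [generator_taylor] the length of time allowed depends only on how long S s g stays close to
    g, so the estimate survives the limit of the pairs (f', g'). *)
Lemma generator_closed f g :
  (forall e : R, 0 < e -> exists f' g', [/\ generator S f' g', N (f - f') <= e & N (g - g') <= e]) ->
  generator S f g.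
Proof.
move=> H; apply/generator_incrP => e e0; have [d d0 hd] := S_continuous0 g e0.
exists d => // h h0 hdl; apply/ler_addgt0Pr => e' e'0.
(* With approximation error e1, the remainder is at most h e + (2 + 3 h) e1. *)
pose m := 2 + 3 * h; have m0 : 0 < m by rewrite /m; lra.
have em : 0 < e' / m by rewrite divr_gt0.
have [f' [g' [H' ff gg]]] := H _ em.
set e1 := e' / m in em ff gg.
have e1E : e1 * m = e' by rewrite /e1 divfK// gt_eqF.
have b : forall s, 0 <= s -> s <= h -> N (S s g' - g') <= e + 2 * e1.
  move=> s s0 sh; have h1 := hd s s0 (le_lt_trans sh hdl).
  have h2 := S_sub g' g s0; rewrite (L2norm_distC g' g) in h2.
  have h3 := L2norm_subl (S s g') (S s g) g'; have h4 := L2norm_subl (S s g) g g'; lra.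
have h1 := generator_taylor H' (ltW h0) b.
have -> : S h f - f - h *: g = (S h f - S h f') + (S h f' - f' - h *: g') - (f - f') - h *: (g - g').
  by apply/LfuneqP => q; rewrite !(L2addE, L2oppE, L2scaleE); ring.
have h2 := S_sub f f' (ltW h0).
apply: le_trans (L2normB _ _) _; rewrite L2normZ gtr0_norm//.
have h3 : h * N (g - g') <= h * e1 by rewrite ler_wpM2l// ltW.
have h4 := L2normB ((S h f - S h f') + (S h f' - f' - h *: g')) (f - f').
have h5 := L2normD (S h f - S h f') (S h f' - f' - h *: g').
rewrite -e1E /m; lra.
Qed.

Lemma S_subr s t f : 0 <= s -> s <= t -> N (S t f - S (t - s) (S s f)) = 0.
Proof. by move=> s0 st; rewrite -{1}(subrK s t) S_D// subr_ge0. Qed.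

Lemma flow_lip s t f g : 0 <= s -> 0 <= t -> generator S f g ->
  N (S t f - S s f) <= `|t - s| * N g.
Proof.
move=> s0 t0 H; wlog st : s t s0 t0 / s <= t.
  move=> W; have [st|ts] := leP s t; first exact: W.
  by rewrite L2norm_distC distrC; apply: W => //; exact: ltW.
have ts0 : 0 <= t - s by rewrite subr_ge0.
rewrite ger0_norm//; have h1 := generator_lip (generator_S s0 H) ts0.
have h2 := L2norm_subl (S t f) (S (t - s) (S s f)) (S s f).
rewrite S_subr// add0r in h2; apply: le_trans h2 _; apply: le_trans h1 _.
by rewrite ler_wpM2l// S_contr.
Qed.

(** Going forward the constant would be 1. When t < s the expansion is made at t, and moving its
    linear term from t to s costs the same amount again. *)
Lemma flow_quad s t f g g2 : 0 <= s -> 0 <= t -> generator S f g -> generator S g g2 ->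
  N (S t f - S s f - (t - s) *: S s g) <= 2 * (t - s) ^+ 2 * N g2.
Proof.
move=> s0 t0 H H2.
have fwd p q : 0 <= p -> p <= q -> N (S q f - S p f - (q - p) *: S p g) <= (q - p) ^+ 2 * N g2.
  move=> p0 pq; have qp0 : 0 <= q - p by rewrite subr_ge0.
  have b r : 0 <= r -> r <= q - p -> N (S r (S p g) - S p g) <= (q - p) * N g2.
    move=> r0 rq; apply: le_trans (generator_lip (generator_S p0 H2) r0) _.
    by apply: ler_pM => //; [exact: L2norm_ge0|exact: S_contr].
  have h1 := generator_taylor (generator_S p0 H) qp0 b.
  have -> : S q f - S p f - (q - p) *: S p g =
    (S q f - S (q - p) (S p f)) + (S (q - p) (S p f) - S p f - (q - p) *: S p g).
    by apply/LfuneqP => x; rewrite !(L2addE, L2oppE, L2scaleE); ring.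
  by apply: le_trans (L2normD _ _) _; rewrite S_subr// add0r expr2 -mulrA.
have Ng := L2norm_ge0 g2; have sq := sqr_ge0 (t - s).
have sN : 0 <= (t - s) ^+ 2 * N g2 by rewrite mulr_ge0.
have [st|/ltW ts] := leP s t; first by apply: le_trans (fwd s t s0 st) _; lra.
have h1 := fwd t s t0 ts.
have -> : S t f - S s f - (t - s) *: S s g =
  - (S s f - S t f - (s - t) *: S t g) - (t - s) *: (S s g - S t g).
  by apply/LfuneqP => x; rewrite !(L2addE, L2oppE, L2scaleE); ring.
have h2 := flow_lip t0 s0 H2.
apply: le_trans (L2normB _ _) _; rewrite L2normN L2normZ.
have h3 : `|t - s| * N (S s g - S t g) <= `|t - s| * (`|t - s| * N g2).
  by rewrite ler_wpM2l// distrC -distrC; move: h2; rewrite distrC.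
rewrite mulrA -expr2 real_normK ?num_real// in h3.
have e : (s - t) ^+ 2 = (t - s) ^+ 2 by ring.
rewrite e in h1; lra.
Qed.

End Semigroup.

(** * Kato smoothing and the splitting of the flow *)

Section Smoothing.
Variable R : realType.

Lemma is_derive_quad (F : R -> R) (x L C d : R) : 0 < d ->
  (forall y, `|y - x| < d -> `|F y - F x - (y - x) * L| <= C * (y - x) ^+ 2) ->
  is_derive x 1 F L.
Proof.
move=> d0 FC.
have h : (fun h : R => h^-1 *: (F (h *: 1 + x) - F x)) @ 0^' --> L.
  apply/cvgrPdist_le => e e0; rewrite near_withinE.
  exists (Num.min d (e / (`|C| + 1))) => /=.
    by rewrite lt_min d0/= divr_gt0// ltr_wpDl.
  move=> h; rewrite /ball_/= sub0r normrN lt_min => /andP[hd he] h0.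
  have := FC (h + x); rewrite addrK => /(_ hd) H.
  rewrite /GRing.scale/= mulr1 distrC.
  have -> : h^-1 * (F (h + x) - F x) - L = h^-1 * (F (h + x) - F x - h * L).
    by rewrite [RHS]mulrBr mulKf.
  rewrite normrM normfV ler_pdivrMl ?normr_gt0//; apply: le_trans H _.
  have h0' : 0 < `|h| by rewrite normr_gt0.
  rewrite -[h ^+ 2]real_normK ?num_real// expr2 mulrCA ler_wpM2l ?(ltW h0')//.
  move: he; rewrite ltr_pdivlMr ?ltr_wpDl// => he.
  apply: le_trans (ltW he); rewrite mulrC ler_wpM2l ?(ltW h0')//.
  by apply: le_trans (ler_norm C) _; rewrite lerDl.
by apply: DeriveDef; [apply/cvg_ex; exists L|apply: cvg_lim].
Qed.

Variables (a : R) (a0 : 0 <= a) (S : R -> L2 R -> L2 R) (hS : kdv_semigroup a S).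
Implicit Types (f g x y z : L2 R) (s t h : R).
Notation N := (@L2norm R).
Let hC : contraction_semigroup S := hS.1.

Lemma generator_classical f g g2 : generator S f g -> generator S g g2 ->
  exists u u1 u2 u3, classical_kdv a f g u u1 u2 u3.
Proof. by move=> /hS.2 H /hS.2 H2; exact: kdv_regular H H2. Qed.

Lemma energy_is_derive f g g2 s : generator S f g -> generator S g g2 -> 0 < s ->
  is_derive s 1 (fun t => ip (wtm (S t f)) (S t f)) (2 * ip (S s g) (wtm (S s f))).
Proof.
move=> H H2 s0; set y := S s f.
apply: (@is_derive_quad _ _ _ (4 * (N y * N g2) + N g ^+ 2) s s0) => t ts.
have t0 : 0 <= t by move: ts; rewrite ltr_norml; lra.
set d := S t f - y.
have q := flow_quad hC (ltW s0) t0 H H2.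
have l := flow_lip hC (ltW s0) t0 H.
rewrite -/y -/d in q l.
have -> : S t f = y + d by rewrite /d subrKC.
have wD : wtm (y + d) = wtm y + wtm d.
  by rewrite -[d]opprK wtmB; congr (_ + _); rewrite -[X in wtm X]sub0r wtmB (_ : wtm 0 = 0) ?sub0r ?opprK//; apply/LfuneqP => x; rewrite wtmE mulr0.
rewrite -/y wD (ipDl (wtm y) (wtm d)) !(ipDr y d).
have -> : ip (wtm y) y + ip (wtm y) d + (ip (wtm d) y + ip (wtm d) d) - ip (wtm y) y
   - (t - s) * (2 * ip (S s g) (wtm y)) =
   2 * ip (wtm y) (d - (t - s) *: S s g) + ip (wtm d) d.
  rewrite ipBr ipZr (ip_wtm d y) (ipC d) (ipC (S s g)); ring.
apply: le_trans (ler_normD _ _) _; rewrite [leRHS]mulrDl; apply: lerD.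
  rewrite normrM ger0_norm//; have := ip_le (wtm y) (d - (t - s) *: S s g).
  have : N (wtm y) * N (d - (t - s) *: S s g) <= N y * (2 * (t - s) ^+ 2 * N g2).
    by apply: ler_pM => //; [exact: L2norm_ge0|exact: L2norm_ge0|exact: L2norm_wtm].
  have -> : 4 * (N y * N g2) * (t - s) ^+ 2 = 2 * (N y * (2 * (t - s) ^+ 2 * N g2)) by ring.
  by move=> *; lra.
apply: le_trans (ip_le _ _) _.
have -> : N g ^+ 2 * (t - s) ^+ 2 = (`|t - s| * N g) * (`|t - s| * N g).
  by rewrite -expr2 exprMn real_normK ?num_real// mulrC.
apply: ler_pM; rewrite ?L2norm_ge0//.
by apply: le_trans (L2norm_wtm _) _.
Qed.

(** The mean value theorem for the weighted energy on [t/2, t] selects a single time s, in place of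
    an average over time; starting at t/2 stays away from time 0, where no two-sided derivative
    exists. *)
Lemma kato_smoothing f g g2 t : generator S f g -> generator S g g2 -> 0 < t ->
  exists s u u1 u2 u3, [/\ 0 < s, s < t, classical_kdv a (S s f) (S s g) u u1 u2 u3 &
    3 * t * L2norm (toL2 u1) ^+ 2 <= (2 + a * t) * N f ^+ 2].
Proof.
move=> H H2 t0; pose E t := ip (wtm (S t f)) (S t f).
have t2 : t / 2 < t by lra.
have dE s : t / 2 <= s -> is_derive s 1 E (2 * ip (S s g) (wtm (S s f))).
  by move=> s2; apply: energy_is_derive H H2 _; lra.
have [s||s] := @MVT _ E (fun s => 2 * ip (S s g) (wtm (S s f))) _ _ t2.
- by rewrite in_itv/= => /andP[s2 _]; apply: dE; exact: ltW.
- apply: derivable_within_continuous => s; rewrite in_itv/= => /andP[s2 _].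
  have dd : is_derive s 1 E (2 * ip (S s g) (wtm (S s f))) := dE s s2.
  exact: ex_derive.
rewrite in_itv/= => /andP[s2 st] Es.
have s0 : 0 < s by lra.
have [u [u1 [u2 [u3 hu]]]] := generator_classical (generator_S hC (ltW s0) H) (generator_S hC (ltW s0) H2).
exists s, u, u1, u2, u3; split => //.
rewrite (kdv_energy hu) in Es.
have E0 : 0 <= E t by exact: ip_wtm_ge0.
have Et : E (t / 2) <= N f ^+ 2.
  apply: le_trans (ler_norm _) _; apply: le_trans (ip_le _ _) _; rewrite expr2.
  have c : N (S (t / 2) f) <= N f by apply: (S_contr hC); lra.
  apply: ler_pM; rewrite ?L2norm_ge0//; exact: le_trans (L2norm_wtm _) c.
have c : a * N (S s f) ^+ 2 <= a * N f ^+ 2.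
  by rewrite ler_wpM2l// lerXn2r ?nnegrE ?L2norm_ge0// (S_contr hC)// ltW.
have c' : (a * N (S s f) ^+ 2) * (t - t / 2) <= (a * N f ^+ 2) * (t - t / 2) by rewrite ler_wpM2r//; lra.
move: Es c'; rewrite mulrBl; set n1 := L2norm (toL2 u1) ^+ 2; set nf := N f ^+ 2.
rewrite -/nf in Et; move=> Es c'; lra.
Qed.

(* The time is [tau ^+ 2], which makes t^(-3/2) the integer power
   [tau^-1 ^+ 3]. *)
Lemma flow_split (T : R) : 0 < T -> exists2 C : R, 0 < C &
  forall (tau d : R) f g g2, generator S f g -> generator S g g2 -> 0 < tau -> tau ^+ 2 <= T ->
    0 < d -> d * (1 + T) <= 1 ->
    exists z z1 z2, [/\ generator S z z1, generator S z1 z2,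
      N (S (tau ^+ 2) f - z) <= C * d * N f &
      N z1 <= C * d^-1 ^+ 2 * tau^-1 ^+ 3 * N f].
Proof.
move=> T0.
pose C1 : R := 2 * 7%:R * (4 * 9%:R ^+ 3 + a * 9%:R + 1); pose C2 : R := 2 + a * T.
have aT : 0 <= a * T by rewrite mulr_ge0// ltW.
have C10 : 0 < C1.
  by rewrite /C1 mulr_gt0// ltr_wpDl// addr_ge0 ?mulr_ge0.
have C20 : 0 < C2 by rewrite /C2; lra.
exists (C1 * C2); first exact: mulr_gt0.
move=> tau d f g g2 H H2 tau0 tauT d0 dT.
have t0 : 0 < tau ^+ 2 by rewrite exprn_gt0.
have [s [u [u1 [u2 [u3 [s0 st hu hn]]]]]] := kato_smoothing H H2 t0.
have [[du du1 du2 cu3] [um uz u10 uw _]] := hu.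
have cu1 := is_derive_continuous du1; have cu := is_derive_continuous du.
set n1 := L2norm (toL2 u1) in hn.
have n10 : 0 <= n1 := L2norm_ge0 _.
have Nf0 : 0 <= N f := L2norm_ge0 f.
have n1le : n1 * tau <= C2 * N f.
  rewrite -ler_sqr ?nnegrE ?mulr_ge0 ?(ltW tau0) ?(ltW C20)//.
  rewrite !exprMn mulrC.
  have h1 : (2 + a * tau ^+ 2) * N f ^+ 2 <= C2 * N f ^+ 2.
    by rewrite ler_wpM2r ?sqr_ge0// /C2 lerD2l ler_wpM2l.
  have h2 : C2 * N f ^+ 2 <= C2 ^+ 2 * N f ^+ 2.
    by rewrite ler_wpM2r ?sqr_ge0// expr2 ler_peMl ?ltW// /C2; lra.
  have h3 : 0 <= tau ^+ 2 * n1 ^+ 2 by rewrite mulr_ge0 ?sqr_ge0.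
  lra.
have tauT1 : tau <= 1 + T.
  have := sqr_ge0 (tau - 1); rewrite (_ : (tau - 1) ^+ 2 = tau ^+ 2 - 2 * tau + 1); [lra|ring].
(* The mollification scale d t^(1/2); tau <= 1 + T and d (1 + T) <= 1 give the h <= 1 required by
   [kdv_approx]. *)
pose h := d * tau.
have h0 : 0 < h <= 1.
  by rewrite mulr_gt0//=; apply: le_trans dT; rewrite ler_wpM2l// ltW.
have [f0 [f1 [f2 [f3 [c [e [[kf c1 e0 sf] [df df1 df2 cf3] n2 n3]]]]]]] :=
  kdv_approx du cu1 um uz 3 a0 h0.
rewrite -/n1 -/C1 in n2 n3; clearbody C1.
have [g0 [K0 kg sg _]] := Ck_kdv a c1 e0 sf kf.
have K1 := smooth_kdv a df df1 df2 cf3 c1 e0 sf.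
have [g1 [K2 _ _ _]] := Ck_kdv a c1 e0 sg kg.
have /hS.2 G0 := K0; have /hS.2 G1 := K1; have /hS.2 G2 := K2.
have G2' : generator S (toL2 (kdv_fun a f1 f3)) (toL2 g1).
  apply: (generator_eqv hC _ (L2norm_subrr _) G2).
  exact: generator_unique G0 G1.
have ts0 : 0 <= tau ^+ 2 - s by rewrite subr_ge0 ltW.
(* The splitting is made at the good time s and carried to time tau^2 by the flow, which contracts
   both errors. *)
exists (S (tau ^+ 2 - s) (toL2 f0)), (S (tau ^+ 2 - s) (toL2 (kdv_fun a f1 f3))),
  (S (tau ^+ 2 - s) (toL2 g1)).
have cf := is_derive_continuous df.
split; [exact: generator_S|exact: generator_S| |].
- have e1 := S_subr hC f (ltW s0) (ltW st).
  have e2 := L2norm_subl (S (tau ^+ 2) f) (S (tau ^+ 2 - s) (S s f)) (S (tau ^+ 2 - s) (toL2 f0)).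
  rewrite e1 add0r in e2; apply: le_trans e2 _.
  apply: le_trans (S_sub hC _ _ ts0) _.
  rewrite (L2norm_sub_toL2 uw cu cf); apply: le_trans n2 _.
  have -> : C1 * h * n1 = C1 * d * (n1 * tau) by rewrite /h; ring.
  have -> : C1 * C2 * d * N f = C1 * d * (C2 * N f) by ring.
  by rewrite ler_wpM2l// mulr_ge0// ltW.
- apply: le_trans (S_contr hC _ ts0) _; apply: le_trans n3 _.
  have -> : C1 * h^-1 ^+ 2 * n1 = C1 * d^-1 ^+ 2 * tau^-1 ^+ 3 * (n1 * tau).
    by rewrite /h; field; rewrite !gt_eqF.
  have -> : C1 * C2 * d^-1 ^+ 2 * tau^-1 ^+ 3 * N f = C1 * d^-1 ^+ 2 * tau^-1 ^+ 3 * (C2 * N f) by ring.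
  apply: ler_wpM2l n1le; rewrite !mulr_ge0 ?exprn_ge0 ?invr_ge0 ?(ltW C10) ?(ltW d0) ?(ltW tau0)//.
Qed.

End Smoothing.

(** * Absorption argument for data in the domain of A^2 *)

Section Bootstrap.
Variable R : realType.
Variables (a : R) (a0 : 0 <= a) (S : R -> L2 R -> L2 R) (hS : kdv_semigroup a S).
Implicit Types (f g x y z : L2 R) (s t h : R).
Notation N := (@L2norm R).
Let hC : contraction_semigroup S := hS.1.

Definition diffq h x : L2 R := h^-1 *: (S h x - x).

Lemma diffq_le h x : 0 < h -> N (diffq h x) <= 2 * h^-1 * N x.
Proof.
move=> h0; have hV : 0 < h^-1 by rewrite invr_gt0.
have -> : 2 * h^-1 * N x = h^-1 * (2 * N x) by ring.
rewrite /diffq L2normZ gtr0_norm// ler_pM2l//.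
have := L2normB (S h x) x; have := S_contr hC x (ltW h0); lra.
Qed.

Lemma diffq_eqv h x y : 0 < h -> N (x - y) = 0 -> N (diffq h x) = N (diffq h y).
Proof.
move=> h0 xy; apply: L2norm_eqv; apply: L2norm_eq0_le.
have -> : diffq h x - diffq h y = h^-1 *: ((S h x - S h y) - (x - y)).
  by apply/LfuneqP => q; rewrite !(L2addE, L2oppE, L2scaleE); ring.
rewrite L2normZ; have := L2normB (S h x - S h y) (x - y).
rewrite xy (S_eqv hC (ltW h0) xy) addr0 => h1.
by rewrite (L2norm_eq0_le h1) mulr0.
Qed.

Lemma diffq_sub h x y : 0 < h -> N (diffq h x) <= N (diffq h y) + N (diffq h (x - y)).
Proof.
move=> h0; have hV : 0 < h^-1 by rewrite invr_gt0.
have e := S_comb hC 1 x y (x - y) (ltW h0).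
rewrite !scale1r subrr L2norm0 in e.
have -> : diffq h x = diffq h y + diffq h (x - y) + h^-1 *: (S h x - S h y - S h (x - y)).
  by apply/LfuneqP => q; rewrite !(L2addE, L2oppE, L2scaleE); ring.
apply: le_trans (L2normD _ _) _; rewrite L2normZ (L2norm_eq0_le e) mulr0 addr0.
exact: L2normD.
Qed.

Lemma diffq_S h t x : 0 < h -> 0 <= t -> N (diffq h (S t x)) <= N (diffq h x).
Proof.
move=> h0 t0; have e := S_comb hC h^-1 (S h x) x 0 t0.
have z : N (S t 0) = 0.
  by apply: L2norm_eq0_le; rewrite -[leRHS](@L2norm0 R) (S_contr hC).
rewrite subr0 in e; apply: le_trans e.
have -> : diffq h (S t x) = h^-1 *: (S t (S h x) - S t x) - S t 0 + S t 0 +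
  h^-1 *: (S h (S t x) - S t (S h x)).
  by apply/LfuneqP => q; rewrite !(L2addE, L2oppE, L2scaleE); ring.
apply: le_trans (L2normD _ _) _; rewrite L2normZ (S_comm hC x (ltW h0) t0) mulr0 addr0.
by apply: le_trans (L2normD _ _) _; rewrite z addr0.
Qed.

Lemma diffq_generator h x y : 0 < h -> generator S x y -> N (diffq h x) <= N y.
Proof.
move=> h0 H; have hV : 0 < h^-1 by rewrite invr_gt0.
by rewrite /diffq L2normZ gtr0_norm// mulrC ler_pdivrMr// mulrC (generator_lip hC)// ltW.
Qed.

(* With [d] small, [flow_split] at half of the time turns a bound [B] for the
   difference quotient of step [h] into [B / 2 + C1], where [C1] does not depend
   on [h]; the crude bound [2 / h] starts the iteration. *)
Lemma smoothing_on_domain (T : R) : 0 < T -> exists2 C : R, 0 < C &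
  forall tau f g g2, generator S f g -> generator S g g2 -> 0 < tau -> tau ^+ 2 <= T ->
    N (S (tau ^+ 2) g) <= C * tau^-1 ^+ 3 * N f.
Proof.
move=> T0; have [C0 C00 split] := flow_split a0 hS T0.
(* Halving the time multiplies tau^-3 by 2 sqrt 2 <= 3, so the mollification error returns with
   factor 3 C0 d; the choice of d makes it at most 1/2. *)
pose d := (1 + T + 6 * C0)^-1.
have D0 : 0 < 1 + T + 6 * C0 by lra.
have d0 : 0 < d by rewrite invr_gt0.
have dD : d * (1 + T + 6 * C0) = 1 by rewrite mulVf// gt_eqF.
have dC : 0 < d * C0 by rewrite mulr_gt0.
have dT' : 0 < d * (1 + T) by rewrite mulr_gt0//; lra.
have dT : d * (1 + T) <= 1 by lra.
clearbody d; pose C1 := 3 * C0 * d^-1 ^+ 2.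
have C10 : 0 < C1 by rewrite !mulr_gt0 ?exprn_gt0 ?invr_gt0.
exists (2 * C1 + 1); first lra.
move=> tau0 f0 g0 g20 H0 H20 tau00 tauT0.
pose P h (B : R) := forall tau f g g2, generator S f g -> generator S g g2 -> 0 < tau -> tau ^+ 2 <= T ->
    N (diffq h (S (tau ^+ 2) f)) <= B * tau^-1 ^+ 3 * N f.
have step (h B : R) : 0 < h -> 0 <= B -> P h B -> P h (B / 2 + C1).
  move=> h0 B0 PB tau f g g2 H H2 tau_0 tauT.
  pose q : R := Num.sqrt 2; have q2 : q ^+ 2 = 2 by rewrite sqr_sqrtr.
  have q0 : 0 < q by rewrite sqrtr_gt0.
  have q32 : q <= 3 / 2.
    by rewrite -ler_sqr ?nnegrE ?(ltW q0)// q2 expr2; lra.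
  pose sg := tau / q; have sg0 : 0 < sg by rewrite divr_gt0.
  have sg2 : sg ^+ 2 + sg ^+ 2 = tau ^+ 2.
    by rewrite /sg exprMn exprVn q2 -mulr2n -[_ *+ 2]mulr_natr divfK.
  have sgT : sg ^+ 2 <= T by have := sqr_ge0 sg; lra.
  have sg3 : sg^-1 ^+ 3 <= 3 * tau^-1 ^+ 3.
    have -> : sg^-1 ^+ 3 = q ^+ 2 * q * tau^-1 ^+ 3.
      by rewrite /sg invf_div; ring.
    by rewrite q2 ler_wpM2r ?exprn_ge0 ?invr_ge0 ?(ltW tau_0)//; lra.
  have [z [z1 [z2 [G1 G2 n1 n2]]]] := split sg d f g g2 H H2 sg0 sgT d0 dT.
  have s0 : 0 <= sg ^+ 2 := sqr_ge0 sg.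
  have e1 := S_D hC f s0 s0; rewrite sg2 in e1.
  rewrite (diffq_eqv h0 e1).
  have e2 := diffq_sub (S (sg ^+ 2) (S (sg ^+ 2) f)) (S (sg ^+ 2) z) h0.
  apply: le_trans e2 _.
  have e3 : N (S (sg ^+ 2) (S (sg ^+ 2) f) - S (sg ^+ 2) z - S (sg ^+ 2) (S (sg ^+ 2) f - z)) = 0.
    apply: L2norm_eq0_le; have := S_comb hC 1 (S (sg ^+ 2) f) z (S (sg ^+ 2) f - z) s0.
    by rewrite !scale1r subrr L2norm0.
  rewrite (diffq_eqv h0 e3).
  have G := generatorB hC (generator_S hC s0 H) G1.
  have G' := generatorB hC (generator_S hC s0 H2) G2.
  have n3 := PB _ _ _ _ G G' sg0 sgT.
  have n4 := le_trans (diffq_S z h0 s0) (diffq_generator h0 G1).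
  have Nf := L2norm_ge0 f; have sg3' : 0 <= sg^-1 ^+ 3 by rewrite exprn_ge0// invr_ge0 ltW.
  have n5 : B * sg^-1 ^+ 3 * N (S (sg ^+ 2) f - z) <= B * sg^-1 ^+ 3 * (C0 * d * N f).
    by apply: ler_wpM2l n1; rewrite mulr_ge0.
  have n6 : sg^-1 ^+ 3 * ((B * (C0 * d) + C0 * d^-1 ^+ 2) * N f) <=
      3 * tau^-1 ^+ 3 * ((B * (C0 * d) + C0 * d^-1 ^+ 2) * N f).
    apply: ler_wpM2r sg3; rewrite mulr_ge0// addr_ge0// !mulr_ge0 ?exprn_ge0 ?invr_ge0 ?(ltW C00) ?(ltW d0)//.
  have n7 : B * (6 * (C0 * d)) <= B * 1 by apply: ler_wpM2l => //; lra.
  have n8 : tau^-1 ^+ 3 * N f * (B * (6 * (C0 * d))) <= tau^-1 ^+ 3 * N f * (B * 1).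
    by apply: ler_wpM2l n7; rewrite mulr_ge0// exprn_ge0// invr_ge0 ltW.
  rewrite /C1; lra.
have PC (h : R) : 0 < h -> P h (2 * C1 + 1).
  move=> h0; have hV : 0 < h^-1 by rewrite invr_gt0.
  pose B0 := 2 * h^-1 * (1 + T) ^+ 3.
  have B00 : 0 <= B0 by rewrite !mulr_ge0 ?exprn_ge0 ?(ltW hV)//; lra.
  have base : P h B0.
    move=> tau f g g2 H H2 tau_0 tauT.
    have tauT1 : tau <= 1 + T.
      have := sqr_ge0 (tau - 1); rewrite (_ : (tau - 1) ^+ 2 = tau ^+ 2 - 2 * tau + 1); [lra|ring].
    apply: le_trans (diffq_le _ h0) _.
    have t2 : 0 <= tau ^+ 2 := sqr_ge0 tau.
    have n1 := S_contr hC f t2.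
    have tt : 1 <= (1 + T) ^+ 3 * tau^-1 ^+ 3.
      by rewrite -exprMn exprn_ege1// ler_pdivlMr// mul1r.
    have -> : B0 * tau^-1 ^+ 3 * N f = 2 * h^-1 * (((1 + T) ^+ 3 * tau^-1 ^+ 3) * N f) by rewrite /B0; ring.
    apply: ler_wpM2l; first by rewrite mulr_ge0 ?(ltW hV).
    by apply: le_trans n1 _; rewrite ler_peMl ?L2norm_ge0.
  (* 2 C1 is the fixed point of B -> B / 2 + C1. Finitely many iterations, their number depending on
     h, bring the bound below 2 C1 + 1. *)
  have it n : P h (B0 / 2 ^+ n + 2 * C1).
    elim: n => [|n ih].
      rewrite expr0 divr1 => tau f g g2 H H2 tau_0 tauT.
      apply: le_trans (base _ _ _ _ H H2 tau_0 tauT) _.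
      by rewrite ler_wpM2r ?L2norm_ge0// ler_wpM2r ?exprn_ge0 ?invr_ge0 ?(ltW tau_0)//; lra.
    have := step h _ h0 _ ih; have -> : (B0 / 2 ^+ n + 2 * C1) / 2 + C1 = B0 / 2 ^+ n.+1 + 2 * C1.
      by rewrite exprS; field; rewrite expf_neq0.
    by apply; rewrite addr_ge0 ?divr_ge0 ?exprn_ge0//; lra.
  have [n hn] : exists n : nat, B0 <= 2 ^+ n.
    exists (Num.truncn B0).+1; apply: (@le_trans _ _ (Num.truncn B0).+1%:R).
      exact/ltW/truncnS_gt.
    by rewrite -natrX ler_nat; exact/ltnW/ltn_expl.
  move=> tau f g g2 H H2 tau_0 tauT.
  apply: le_trans (it n _ _ _ _ H H2 tau_0 tauT) _.
  rewrite ler_wpM2r ?L2norm_ge0// ler_wpM2r ?exprn_ge0 ?invr_ge0 ?(ltW tau_0)//.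
  by rewrite addrC lerD2l ler_pdivrMr ?exprn_gt0// mul1r.
(* The bound is now uniform in the step, so it passes to the limit of the difference quotients. *)
apply/ler_addgt0Pr => e e0.
have t2 : 0 <= tau0 ^+ 2 := sqr_ge0 tau0.
have [d1 d10 hd] := (generatorP S _ _).1 (generator_S hC t2 H0) e e0.
have h0 : 0 < d1 / 2 by lra.
have h1 : d1 / 2 < d1 by lra.
have n1 := hd _ h0 h1; have n2 := PC _ h0 _ _ _ _ H0 H20 tau00 tauT0.
rewrite /diffq in n2.
set w := (d1 / 2)^-1 *: (S (d1 / 2) (S (tau0 ^+ 2) f0) - S (tau0 ^+ 2) f0) in n1 n2.
have n3 := L2norm_subl (S (tau0 ^+ 2) g0) w 0; rewrite !subr0 (L2norm_distC _ w) in n3.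
lra.
Qed.

End Bootstrap.

(** * Density of smooth compactly supported functions in L^2(-1,0) *)

Section Density.
Variable R : realType.
Implicit Types (f g F : R -> R) (u v w b : L2 R).
Notation mu := (@lebesgue_measure R).
Notation N := (@L2norm R).

Lemma L2_dominated_convergence (F : nat -> L2 R) u b (e : R) : 0 < e ->
  (forall x, -1 < x < 0 -> F ^~ x @ \oo --> u x) ->
  (forall n x, -1 < x < 0 -> `|F n x - u x| <= b x) ->
  exists n0, forall n, (n0 <= n)%N -> N (F n - u) <= e.
Proof.
move=> e0 Fu Fb.
pose f_ n x := (((F n - u) x) * ((F n - u) x))%:E.
have [|||||_ _] := @dominated_convergence _ _ _ (lebI R) setT measurableT f_ (cst 0%:E) (EFin \o (fun x => b x * b x)).
- by move=> n; have /integrableP[] := L2_integrableM (F n - u) (F n - u).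
- exact: measurable_cst.
- apply: (@lebI_ae R (fun x => setT x -> f_ ^~ x @ \oo --> 0%:E)) => x x01 _.
  apply: cvg_EFin; first by near=> n.
  have h : (F n x - u x) @[n --> \oo] --> (0 : R).
    by rewrite -(subrr (u x)); apply: cvgB; [exact: Fu|exact: cvg_cst].
  by rewrite -[X in _ --> X](mulr0 (0 : R)); exact: (cvgM h h).
- exact: L2_integrableM.
- have key x : -1 < x < 0 -> forall n, (`|f_ n x| <= (b x * b x)%:E)%E.
    move=> x01 n; rewrite /f_ /= lee_fin normrM; have h := Fb n x x01.
    by apply: ler_pM.
  by apply: lebI_aeS (lebI_ae key) => x h n _; exact: h.
rewrite integral0 => /fine_cvgP[_] /cvgrPdist_le /(_ (e ^+ 2)).
rewrite exprn_gt0// => /(_ isT)[n0 _ H]; exists n0 => n /H /=.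
rewrite sub0r normrN => h; apply: L2norm_le_sqr; first exact: ltW.
rewrite L2norm_sqr; apply: le_trans (ler_norm _) _; exact: h.
Unshelve. all: by end_near. Qed.

Lemma bounded_Lfun2 f (M : R) : measurable_fun setT f -> (forall x, `|f x| <= M) ->
  f \in Lfun (lebI R) 2%:E.
Proof.
move=> mf fM; apply: Lfun2P => //.
have c : continuous (fun _ : R => M ^+ 2) by continuity.
apply: (le_integrable _ _ _ (continuous_lebI_integrable c)) => //.
  by apply/measurable_EFinP; exact: measurable_funX.
move=> x _; rewrite lee_fin/= !normrX lerXn2r ?nnegrE//.
by apply: le_trans (fM x) (ler_norm _).
Qed.

Definition trunc (M x : R) : R := Num.max (- M) (Num.min M x).

Lemma trunc_le (M x : R) : 0 <= M -> `|trunc M x| <= M.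
Proof.
move=> M0; rewrite ler_norml /trunc le_max lexx/= ge_max ge_min lexx/= andbT; lra.
Qed.

Lemma trunc_id (M x : R) : `|x| <= M -> trunc M x = x.
Proof. by rewrite ler_norml => /andP[h1 h2]; rewrite /trunc min_r// max_r. Qed.

Lemma trunc_sub (M x y : R) : 0 <= M -> `|y| <= M -> `|y - trunc M x| <= `|y - x|.
Proof.
rewrite ler_norml /trunc => M0 /andP[h1 h2].
have [h3|h3] := leP M x.
  rewrite max_r; last lra.
  by rewrite !ler0_norm; lra.
have [h4|h4] := leP (- M) x; first by [].
by rewrite !ger0_norm; lra.
Qed.

Lemma trunc_sub_id (M x : R) : 0 <= M -> `|x - trunc M x| <= `|x|.
Proof.
rewrite /trunc => M0; have [h3|h3] := leP M x.
  rewrite max_r; last lra.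
  by rewrite !ger0_norm; lra.
have [h4|h4] := leP (- M) x; first by rewrite subrr normr0.
by rewrite !ler0_norm; lra.
Qed.

Lemma continuous_trunc (M : R) f : continuous f -> continuous (fun x => trunc M (f x)).
Proof.
move=> cf; suff h : continuous (cst (- M) \max (cst M \min f)) by exact: h.
move=> x; apply: continuous_max; first exact: cst_continuous.
by apply: continuous_min; [exact: cst_continuous|exact: cf].
Qed.

Lemma trunc_approx u (e : R) : 0 < e -> exists f (M : R),
  [/\ 0 < M, measurable_fun setT f, forall x, `|f x| <= M & N (toL2 f - u) <= e].
Proof.
move=> e0.
pose T n x := trunc n%:R (u x).
have mT n : measurable_fun setT (T n).
  apply: (@measurableT_comp _ _ _ _ _ _ (trunc n%:R)); last exact: L2_measurable.
  apply: continuous_measurable_funT; apply: continuous_trunc; exact: continuous_idfun.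
have Tb n x : `|T n x| <= n%:R by exact: trunc_le.
have TL n : toL2 (T n) = T n :> (R -> R).
  by rewrite toL2E//; exact: bounded_Lfun2 (mT n) (Tb n).
pose b := toL2 (fun x => `|u x|).
have bE : b = (fun x => `|u x|) :> (R -> R).
  rewrite toL2E//; apply: Lfun2P; first by apply: measurableT_comp => //; exact: L2_measurable.
  have := L2_integrableM u u; congr integrable; apply/funext => x /=.
  by rewrite real_normK ?num_real// expr2.
have [x x01|n x x01|n0 H] := @L2_dominated_convergence (fun n => toL2 (T n)) u b e e0.
- have [m hm] : exists m : nat, `|u x| < m%:R.
    by exists (Num.truncn `|u x|).+1; rewrite truncnS_gt.
  apply: cvg_near_cst; exists m => // n /= mn; rewrite TL /T trunc_id//.
  by apply: le_trans (ltW hm) _; rewrite ler_nat.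
- by rewrite TL bE /T distrC; exact: trunc_sub_id.
exists (T n0.+1), n0.+1%:R; split; [by []|exact: mT|exact: Tb|exact: (H n0.+1 (leqnSn n0))].
Qed.

(** Approximation in L^1 becomes approximation in L^2 after truncation at M, because |f - g|^2 <= 2
    M |f - g|; hence the tolerance e^2 / (2 M). *)
Lemma continuous_bounded_approx f (M e : R) : 0 < e -> 0 < M ->
  measurable_fun setT f -> (forall x, `|f x| <= M) ->
  exists g, [/\ continuous g, forall x, `|g x| <= M & N (toL2 g - toL2 f) <= e].
Proof.
move=> e0 M0 mf fM.
have fL := bounded_Lfun2 mf fM.
have mI := @measurable_IT R.
have finI : (mu `](-1)%R, 0%R[%classic < +oo)%E.
  by rewrite lebesgue_measure_itv/= lte_fin ltrN10 ltry.
have intf : mu.-integrable `](-1)%R, 0%R[ (EFin \o f).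
  apply: measurable_bounded_integrable => //; first exact: measurable_funTS.
  by exists M; split; rewrite ?num_real// => x Mx y _; exact: le_trans (fM y) (ltW Mx).
have [g_ [cg ig gf]] := approximation_continuous_integrable mI finI intf.
have e2 : (0 < (e ^+ 2 / (2 * M))%:E)%E by rewrite lte_fin divr_gt0 ?exprn_gt0 ?mulr_gt0.
have /fine_cvgP[[n1 _ fin1] /cvgrPdist_le/(_ (e ^+ 2 / (2 * M)))] := gf.
rewrite divr_gt0 ?exprn_gt0 ?mulr_gt0// => /(_ isT)[n2 _ H].
pose n := maxn n1 n2; pose h := g_ n.
have ch : continuous h by exact: cg.
have cth := @continuous_trunc M _ ch.
have M0' := ltW M0.
exists (fun x => trunc M (h x)); split => //.
  by move=> x; exact: trunc_le.
apply: L2norm_le_sqr; first exact: ltW.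
have := H n (leq_maxr _ _); rewrite /= sub0r normrN => Hn.
have fn := fin1 n (leq_maxl _ _); rewrite /= in fn.
rewrite L2norm_sqr /ip.
have mfh : measurable_fun setT (fun x => 2 * M * `|f x - h x|).
  apply: measurable_funM => //; apply: measurableT_comp => //.
  by apply: measurable_funB => //; exact: continuous_measurable_funT.
rewrite -lee_fin /Rintegral fineK; last first.
  by apply: integrable_fin_num => //; exact: L2_integrableM.
apply: (@le_trans _ _ (\int[lebI R]_x (2 * M * `|f x - h x|)%:E)%E).
  apply: ge0_le_integral => //.
  - by move=> x _; rewrite lee_fin -expr2 sqr_ge0.
  - by have /integrableP[] := L2_integrableM (toL2 (fun x => trunc M (h x)) - toL2 f) (toL2 (fun x => trunc M (h x)) - toL2 f).
  - exact/measurable_EFinP.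
  move=> x _; rewrite lee_fin L2subE toL2_continuous// toL2E// -expr2.
  rewrite -real_normK ?num_real// expr2; apply: ler_pM => //.
    apply: le_trans (ler_normB _ _) _; have := trunc_le (h x) M0'; have := fM x; lra.
  by rewrite distrC; exact: trunc_sub.
rewrite ge0_lebI_integral//; last by move=> x; rewrite !mulr_ge0.
under eq_integral do rewrite EFinM.
rewrite ge0_integralZl//; last 2 first.
- apply/measurable_EFinP; apply: measurable_funTS; apply: measurableT_comp => //.
  by apply: measurable_funB => //; exact: continuous_measurable_funT.
- by rewrite lee_fin mulr_ge0.
rewrite -(fineK fn) -EFinM lee_fin.
have := le_trans (ler_norm _) Hn; rewrite ler_pdivlMr ?mulr_gt0// mulrC.
by [].
Qed.

End Density.

Section Density.
Variable R : realType.
Implicit Types (f g F : R -> R) (u v w b : L2 R).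
Notation N := (@L2norm R).

Lemma exists_nat_gt (x : R) : exists n : nat, x < n%:R.
Proof. by exists (Num.truncn x).+1; rewrite truncnS_gt. Qed.

(** (1 + x)(-x) is positive exactly on ]-1,0[. Subtracting 2 makes the support compact, and the
    value 1 is reached as soon as n (1 + x)(-x) >= 3. *)
Definition cutoff (n : nat) (x : R) : R :=
  Num.min 1 (Num.max 0 (n%:R * ((1 + x) * - x) - 2)).

Lemma continuous_cutoff n : continuous (cutoff n).
Proof.
have c : continuous (fun x : R => n%:R * ((1 + x) * - x) - 2) by continuity.
suff h : continuous (cst 1 \min (cst 0 \max (fun x : R => n%:R * ((1 + x) * - x) - 2))) by exact: h.
move=> x; apply: continuous_min; first exact: cst_continuous.
by apply: continuous_max; [exact: cst_continuous|exact: c].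
Qed.

Lemma cutoff_itv n x : 0 <= cutoff n x <= 1.
Proof. by rewrite /cutoff ge_min lexx le_min ler01 le_max lexx. Qed.

Lemma cutoff_supp n : supp_in (cutoff n.+1) (-1 + 2 / n.+1%:R) (- 2 / n.+1%:R).
Proof.
move=> x; rewrite in_itv/= negb_and -!ltNge => H.
suff h : n.+1%:R * ((1 + x) * - x) - 2 <= 0 by rewrite /cutoff max_l// min_r.
have m0 : 0 < n.+1%:R :> R by [].
move: (n.+1%:R : R) m0 H => m m0 H.
have [x0|x0] := leP 0 x.
  have h : (1 + x) * - x <= 0 by rewrite mulrN oppr_le0 mulr_ge0//; lra.
  by rewrite lerBlDr add0r (le_trans _ (ler0n R 2))// pmulr_rle0.
have [x1|x1] := leP x (-1).
  have h : (1 + x) * - x <= 0 by rewrite mulr_le0_ge0//; lra.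
  by rewrite lerBlDr add0r (le_trans _ (ler0n R 2))// pmulr_rle0.
have a1 : (1 + x) * - x <= 1 + x by nra.
have a2 : (1 + x) * - x <= - x by nra.
have h : (1 + x) * - x <= 2 / m by case/orP: H => H; [lra|move: H; rewrite mulNr; lra].
by rewrite subr_le0 mulrC -ler_pdivlMr.
Qed.

Lemma cutoff_eventually (x : R) : -1 < x < 0 ->
  exists n0, forall n, (n0 <= n)%N -> cutoff n x = 1.
Proof.
move=> /andP[x1 x0]; pose q := (1 + x) * - x.
have q0 : 0 < q by rewrite mulr_gt0//; lra.
have [n0 hn] := exists_nat_gt (3 / q); exists n0 => n n0n.
have h : 3 <= n%:R * q.
  rewrite -ler_pdivrMr//; apply: le_trans (ltW hn) _; by rewrite ler_nat.
rewrite /cutoff -/q max_r; last lra.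
by rewrite min_l//; lra.
Qed.

Lemma compact_support_approx g (M e : R) : 0 < e -> continuous g -> (forall x, `|g x| <= M) ->
  exists g2 (c d : R), [/\ continuous g2, forall x, `|g2 x| <= M,
    -1 < c /\ d < 0, supp_in g2 c d & N (toL2 g2 - toL2 g) <= e].
Proof.
move=> e0 cg gM.
pose p n x := cutoff n.+1 x * g x.
have cp n : continuous (p n) by apply: continuous_funM => //; exact: continuous_cutoff.
have cM : continuous (fun _ : R => M) by continuity.
have pM n x : `|p n x| <= `|g x|.
  have /andP[h1 h2] := cutoff_itv n.+1 x.
  by rewrite /p normrM ger0_norm// ler_piMl.
have [x x01|n x x01|n0 H] := @L2_dominated_convergence _ (fun n => toL2 (p n)) (toL2 g) (toL2 (fun=> M)) e e0.
- have [m hm] := cutoff_eventually x01.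
  apply: cvg_near_cst; exists m => // n /= mn.
  by rewrite !toL2_continuous// /p hm ?mul1r// (leq_trans mn).
- rewrite !toL2_continuous// /p -{2}[g x]mul1r -mulrBl normrM; apply: le_trans (gM x).
  have /andP[h1 h2] := cutoff_itv n.+1 x.
  by rewrite ler_piMl// distrC ger0_norm; lra.
exists (p n0), (-1 + 2 / n0.+1%:R), (- 2 / n0.+1%:R); split.
- exact: cp.
- by move=> x; exact: le_trans (pM n0 x) (gM x).
- by split; [rewrite ltrDl divr_gt0|rewrite mulNr oppr_lt0 divr_gt0].
- by move=> x xcd; rewrite /p cutoff_supp ?mul0r.
- exact: H.
Qed.

Lemma smooth_approx k g (c d M e : R) : 0 < e -> continuous g -> (forall x, `|g x| <= M) ->
  -1 < c -> d < 0 -> supp_in g c d ->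
  exists f (c' : R), [/\ Ck k f, -1 < c', supp_in f c' d & N (toL2 f - toL2 g) <= e].
Proof.
move=> e0 cg gM c1 d0 gcd.
pose h n : R := n.+1%:R^-1; pose p n := iter k (steklov (h n)) g.
have h0 n : 0 < h n by rewrite invr_gt0.
have cp n : continuous (p n) by exact: iter_steklov_continuous.
have c2M : continuous (fun _ : R => 2 * M) by continuity.
have small (r : R) : 0 < r -> exists n0, forall n, (n0 <= n)%N -> k%:R * h n < r.
  move=> r0; have [n0 hn] := exists_nat_gt (k%:R / r); exists n0 => n n0n.
  rewrite /h ltr_pdivrMr// mulrC -ltr_pdivrMr//; apply: lt_le_trans hn _.
  by rewrite ler_nat (leq_trans n0n).
have [x x01|n x x01|n0 H] := @L2_dominated_convergence _ (fun n => toL2 (p n)) (toL2 g) (toL2 (fun=> 2 * M)) e e0.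
- apply/cvgrPdist_le => r r0; have /cvgrPdist_le/(_ r r0) := cg x.
  rewrite near_nbhs => /nbhs_ballP[q /= q0 hq].
  have [m hm] := small q q0; exists m => // n /= /hm mn.
  rewrite !toL2_continuous//; apply: iter_steklov_near => // y /andP[y1 y2].
  by apply: hq; rewrite /ball/= ler0_norm; lra.
- rewrite !toL2_continuous// distrC; apply: iter_steklov_near => // y _.
  by apply: le_trans (ler_normB _ _) _; have := gM x; have := gM y; lra.
have [n1 hn1] := small (c + 1) ltac:(lra).
pose n := maxn n0 n1; exists (p n), (c - k%:R * h n); split.
- exact: Ck_iter_steklov.
- by have := hn1 n (leq_maxr _ _); lra.
- exact: iter_steklov_supp.
- by apply: H; exact: leq_maxl.
Qed.

Lemma Ck_dense k u (e : R) : 0 < e -> exists f (c d : R),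
  [/\ Ck k f, -1 < c, d < 0, supp_in f c d & N (u - toL2 f) <= e].
Proof.
move=> e0; have e4 : 0 < e / 4 by lra.
have [f [M [M0 mf fM n1]]] := trunc_approx u e4.
have [g [cg gM n2]] := continuous_bounded_approx e4 M0 mf fM.
have [g2 [c [d [cg2 g2M [c1 d0] s2 n3]]]] := compact_support_approx e4 cg gM.
have [p [c' [kp c'1 sp n4]]] := smooth_approx k e4 cg2 g2M c1 d0 s2.
exists p, c', d; split => //.
have t1 := L2norm_subl u (toL2 f) (toL2 p).
have t2 := L2norm_subl (toL2 f) (toL2 g) (toL2 p).
have t3 := L2norm_subl (toL2 g) (toL2 g2) (toL2 p).
rewrite (L2norm_distC u (toL2 f)) in t1; rewrite (L2norm_distC (toL2 f) (toL2 g)) in t2.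
rewrite (L2norm_distC (toL2 g) (toL2 g2)) (L2norm_distC (toL2 g2) (toL2 p)) in t3.
lra.
Qed.

End Density.

(** * Smoothing for arbitrary data in L^2 *)

Section Smoothing.
Variable R : realType.
Implicit Types (f g : R -> R) (w z : L2 R).
Notation N := (@L2norm R).

Lemma classical_kdv_lin (a k : R) w z u u1 u2 u3 w' z' v v1 v2 v3 :
  classical_kdv a w z u u1 u2 u3 -> classical_kdv a w' z' v v1 v2 v3 ->
  classical_kdv a (k *: w + w') (k *: z + z') (fun x => k * u x + v x)
    (fun x => k * u1 x + v1 x) (fun x => k * u2 x + v2 x) (fun x => k * u3 x + v3 x).
Proof.
move=> [[du du1 du2 c3] [um u0 u10 uw uz]] [[dv dv1 dv2 c3'] [vm v0 v10 vw vz]].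
split; split.
- exact: has_deriveD (has_deriveZ k du) dv.
- exact: has_deriveD (has_deriveZ k du1) dv1.
- exact: has_deriveD (has_deriveZ k du2) dv2.
- by continuity.
- by rewrite um vm mulr0 addr0.
- by rewrite u0 v0 mulr0 addr0.
- by rewrite u10 v10 mulr0 addr0.
- apply: lebI_aeS (lebI_aeI uw vw) => x [h1 h2] I'.
  by rewrite [RHS](_ : _ = k * w x + w' x)// h1// h2.
- apply: lebI_aeS (lebI_aeI uz vz) => x [h1 h2] I'.
  by rewrite [RHS](_ : _ = k * z x + z' x)// -h1// -h2//; ring.
Qed.

Lemma classical_kdv_sup (a : R) w z u u1 u2 u3 (x : R) : 0 <= a ->
  classical_kdv a w z u u1 u2 u3 -> -1 <= x <= 0 ->
  let M := (1 + a * (a + 1)) * (N w + N z) in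
  [/\ `|u x| <= M, `|u1 x| <= M & `|u2 x| <= M].
Proof.
move=> a0 H x01 M; have [h0 h1 h2] := kdv_sup H x01.
by have h := kdv_third_norm a0 H; split; exact: le_trans h.
Qed.

Lemma L2norm_sup f (M : R) : continuous f -> 0 <= M ->
  (forall x, -1 <= x <= 0 -> `|f x| <= M) -> N (toL2 f) <= M.
Proof.
move=> cf M0 fM; apply: L2norm_le_sqr => //; rewrite L2norm_toL2_sqr//.
have cM : continuous (fun _ : R => M ^+ 2) by continuity.
apply: (@le_trans _ _ (\int[lebI R]_x (M ^+ 2))).
  apply: le_lebI_integral => //; first by continuity.
  by move=> x /fM fx; rewrite -[_ ^+ 2]real_normK ?num_real// lerXn2r ?nnegrE.
have d : has_derive (fun x : R => M ^+ 2 * x) (fun=> M ^+ 2).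
  by move=> x; have := has_deriveZ (M ^+ 2) (@has_derive_id R) x; rewrite mulr1.
by rewrite (lebI_FTC d cM); lra.
Qed.

Lemma uniform_limit_toL2 (V : nat -> L2 R) (u : nat -> R -> R) (r : nat -> R) :
  (forall n, continuous (u n)) -> (forall n, u n = V n %[ae lebI R]) ->
  (forall e : R, 0 < e -> exists n, r n <= e) ->
  (forall n m x, -1 <= x <= 0 -> `|u n x - u m x| <= r n + r m) ->
  exists g : L2 R, forall n, N (V n - g) <= r n.
Proof.
move=> cu uV small ur.
have r0 n : 0 <= r n.
  have [i1 _] := itvN10 R; have := ur n n (-1) i1; rewrite subrr normr0; lra.
have cl (x : R) : -1 <= clamp x <= 0 by have := clamp_itv x; rewrite in_itv.
(* The limit is the supremum of the lower bounds u_n - r_n. *)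
pose E x : set R := [set y | exists n, y = u n (clamp x) - r n].
pose v x := sup (E x).
have uv n x : `|u n (clamp x) - v x| <= r n.
  have ub y : E x y -> y <= u n (clamp x) + r n.
    by move=> [m ->]; have := ur m n (clamp x) (cl x); rewrite ler_norml => /andP[_ h]; lra.
  have En : E x (u n (clamp x) - r n) by exists n.
  have v1 : v x <= u n (clamp x) + r n.
    by apply: ge_sup => //; exists (u n (clamp x) - r n).
  have v2 : u n (clamp x) - r n <= v x.
    by apply: ub_le_sup => //; exists (u n (clamp x) + r n).
  by rewrite ler_norml; lra.
have cv : continuous v.
  move=> x; apply/cvgrPdist_le => e e0; have e3 : 0 < e / 3 by lra.
  have [n hn] := small _ e3.
  have cun : continuous (fun y => u n (clamp y)).
    by apply: (@clamp_extension _ (u n)); exact: continuous_subspaceT.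
  have /cvgrPdist_le/(_ _ e3) := cun x.
  apply: filterS => y; have := uv n x; have := uv n y.
  by rewrite !ler_norml; lra.
exists (toL2 v) => n.
rewrite (L2norm_sub_toL2 (uV n) (cu n) cv); apply: L2norm_sup.
- by apply: continuous_funB.
- exact: r0.
- by move=> x x01; have := uv n x; rewrite clampE.
Qed.

Section KdV.
Variables (a : R) (a0 : 0 <= a) (S : R -> L2 R -> L2 R) (hS : kdv_semigroup a S).
Let hC : contraction_semigroup S := hS.1.

Lemma generator_chain_dense w (e : R) : 0 < e -> exists z z1 z2 z3,
  [/\ generator S z z1, generator S z1 z2, generator S z2 z3 & N (w - z) <= e].
Proof.
(* Three applications of A, at three derivatives each. *)
move=> e0; have [f [c [d [kf c1 d0 sf n1]]]] := Ck_dense 9 w e0.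
have [f1 [/hS.2 K1 k1 s1 _]] := Ck_kdv a c1 d0 sf kf.
have [f2 [/hS.2 K2 k2 s2 _]] := Ck_kdv a c1 d0 s1 k1.
have [f3 [/hS.2 K3 k3 s3 _]] := Ck_kdv a c1 d0 s2 k2.
by exists (toL2 f), (toL2 f1), (toL2 f2), (toL2 f3).
Qed.

(** Take z_n -> w in the domain of A^3. Both V_n = A e^(tA) z_n and W_n = A V_n are Cauchy, hence so
    are the representatives of V_n in sup norm, and their uniform limit is the required image. *)
Lemma smoothing (T : R) : 0 < T -> exists2 C : R, 0 < C &
  forall (tau : R) w, 0 < tau -> tau ^+ 2 <= T ->
    exists g : L2 R, generator S (S (tau ^+ 2) w) g /\ N g <= C * tau^-1 ^+ 3 * N w.
Proof.
move=> T0; have [C C0 core] := smoothing_on_domain a0 hS T0.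
exists C => // tau w tau0 tauT.
have t0 : 0 <= tau ^+ 2 := sqr_ge0 tau.
have tV : 0 < tau^-1 by rewrite invr_gt0.
(* A is applied twice to control W_n, each time using up time tau^2 / 4; the remaining half is spent
   by contraction. *)
pose sg := tau / 2; have sg0 : 0 < sg by rewrite divr_gt0.
have sgt : sg ^+ 2 <= tau ^+ 2 by rewrite lerXn2r ?nnegrE ?(ltW sg0) ?(ltW tau0)// /sg; lra.
have sgT : sg ^+ 2 <= T := le_trans sgt tauT.
have s0 : 0 <= sg ^+ 2 := sqr_ge0 sg.
have rest : 0 <= tau ^+ 2 - sg ^+ 2 by rewrite subr_ge0.
pose r n : R := n.+1%:R^-1.
have r0 n : 0 < r n by rewrite invr_gt0.
have small K e : 0 <= K -> 0 < e -> exists n, K * r n <= e.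
  move=> K0 e0; have [n hn] := exists_nat_gt (K / e); exists n.
  rewrite ler_pdivrMr// mulrC -ler_pdivrMr//; apply: le_trans (ltW hn) _.
  by rewrite ler_nat.
clearbody r.
have ex n := cid (generator_chain_dense w (r0 n)).
pose z n := projT1 (ex n).
have ex1 n := cid (projT2 (ex n)); pose z1 n := projT1 (ex1 n).
have ex2 n := cid (projT2 (ex1 n)); pose z2 n := projT1 (ex2 n).
have ex3 n := cid (projT2 (ex2 n)); pose z3 n := projT1 (ex3 n).
have H n : [/\ generator S (z n) (z1 n), generator S (z1 n) (z2 n),
   generator S (z2 n) (z3 n) & N (w - z n) <= r n] := projT2 (ex3 n).
clearbody z3 z2 z1 z.
pose V n := S (tau ^+ 2) (z1 n); pose W n := S (tau ^+ 2) (z2 n).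
have GV n : generator S (V n) (W n) by have [_ h _ _] := H n; exact: generator_S.
have GW n : generator S (W n) (S (tau ^+ 2) (z3 n)).
  by have [_ _ h _] := H n; exact: generator_S.
have zz n m : N (z n - z m) <= r n + r m.
  have := L2norm_subl (z n) w (z m); have [_ _ _ h1] := H n; have [_ _ _ h2] := H m.
  by rewrite (L2norm_distC (z n) w); lra.
have lin t x y : 0 <= t -> N (S t x - S t y) <= N (S t (x - y)).
  move=> t0'; have := S_comb hC 1 x y (x - y) t0'; rewrite !scale1r subrr L2norm0 => h.
  have := L2normD (S t x - S t y - S t (x - y)) (S t (x - y)); rewrite subrK; lra.
have VV n m : N (V n - V m) <= C * tau^-1 ^+ 3 * N (z n - z m).
  have [h1 h2 _ _] := H n; have [h1' h2' _ _] := H m.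
  apply: le_trans (lin _ _ _ t0) _.
  exact: core (generatorB hC h1 h1') (generatorB hC h2 h2') tau0 tauT.
pose C2 := C * sg^-1 ^+ 3 * (C * sg^-1 ^+ 3).
have sV : 0 <= C * sg^-1 ^+ 3.
  by rewrite mulr_ge0 ?exprn_ge0 ?invr_ge0 ?(ltW sg0) ?(ltW C0).
have WW n m : N (W n - W m) <= C2 * N (z n - z m).
  have [h1 h2 h3 _] := H n; have [h1' h2' h3' _] := H m.
  pose y n := S (tau ^+ 2 - sg ^+ 2) (z2 n).
  have Wy k : N (W k - S (sg ^+ 2) (y k)) = 0.
    by have := S_D hC (z2 k) s0 rest; rewrite subrKC.
  pose p := z n - z m; pose p1 := z1 n - z1 m; pose p2 := z2 n - z2 m; pose p3 := z3 n - z3 m.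
  have P1 : generator S p p1 by exact: generatorB.
  have P2 : generator S p1 p2 by exact: generatorB.
  have P3 : generator S p2 p3 by exact: generatorB.
  have b1 : N (S (sg ^+ 2) p1) <= C * sg^-1 ^+ 3 * N p by exact: core P1 P2 sg0 sgT.
  have Q1 := generator_S hC s0 P2; have Q2 := generator_S hC s0 P3.
  have b2 : N (S (sg ^+ 2) (S (sg ^+ 2) p2)) <= C * sg^-1 ^+ 3 * N (S (sg ^+ 2) p1).
    exact: core Q1 Q2 sg0 sgT.
  have ssT : sg ^+ 2 + sg ^+ 2 <= tau ^+ 2.
    have -> : sg ^+ 2 = tau ^+ 2 / 4 by rewrite /sg; field.
    by lra.
  have rest2 : 0 <= tau ^+ 2 - (sg ^+ 2 + sg ^+ 2) by rewrite subr_ge0.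
  have ss0 : 0 <= sg ^+ 2 + sg ^+ 2 by rewrite addr_ge0.
  apply: le_trans (lin _ _ _ t0) _.
  have e1 := S_D hC p2 rest2 ss0; rewrite subrK in e1.
  rewrite (L2norm_eqv e1); apply: le_trans (S_contr hC _ rest2) _.
  rewrite (L2norm_eqv (S_D hC p2 s0 s0)); apply: le_trans b2 _.
  by rewrite /C2 -[leRHS]mulrA ler_wpM2l.
pose K1 := C * tau^-1 ^+ 3 + C2.
have K10 : 0 <= K1.
  by apply: addr_ge0; [rewrite mulr_ge0 ?exprn_ge0 ?(ltW tV) ?(ltW C0)|exact: mulr_ge0].
have exu n := cid (generator_classical hS (GV n) (GW n)); pose u n := projT1 (exu n).
have exu1 n := cid (projT2 (exu n)); pose u1 n := projT1 (exu1 n).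
have exu2 n := cid (projT2 (exu1 n)); pose u2 n := projT1 (exu2 n).
have exu3 n := cid (projT2 (exu2 n)); pose u3 n := projT1 (exu3 n).
have Hu n : classical_kdv a (V n) (W n) (u n) (u1 n) (u2 n) (u3 n) := projT2 (exu3 n).
clearbody u3 u2 u1 u.
have KA0 : 0 <= 1 + a * (a + 1) by rewrite addr_ge0 ?mulr_ge0 ?addr_ge0.
pose K := (1 + a * (a + 1)) * K1.
have K0 : 0 <= K by rewrite mulr_ge0.
have [||||g gP] := @uniform_limit_toL2 V u (fun n => K * r n).
- by move=> n; have [[du _ _ _] _] := Hu n; exact: is_derive_continuous du.
- by move=> n; have [_ [_ _ _ h _]] := Hu n.
- by move=> e; exact: small.
- move=> n m x x01; have h := classical_kdv_lin (-1) (Hu m) (Hu n).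
  have [+ _ _] := classical_kdv_sup a0 h x01.
  rewrite !scaleN1r mulN1r [- u m x + _]addrC.
  rewrite ![(- _ + _ : L2 R)]addrC => hx.
  apply: le_trans hx _; rewrite -mulrDr /K -mulrA ler_wpM2l//.
  have h1 := VV n m; have h2 := WW n m.
  have h3 : K1 * N (z n - z m) <= K1 * (r n + r m) by apply: ler_wpM2l.
  apply: le_trans h3; rewrite /K1 mulrDl; exact: lerD.
exists g; split.
  apply: (generator_closed hC) => e e0.
  have [n hn] := small (K + 1) e (addr_ge0 K0 ler01) e0.
  have [h1 _ _ h2] := H n; have rn := ltW (r0 n).
  have Kr : 0 <= K * r n by rewrite mulr_ge0.
  rewrite mulrDl mul1r in hn.
  exists (S (tau ^+ 2) (z n)), (V n); split.
  - exact: generator_S.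
  - by apply: le_trans (S_sub hC _ _ t0) _; lra.
  - by rewrite L2norm_distC; apply: le_trans (gP n) _; lra.
apply/ler_addgt0Pr => e e0.
pose CT := C * tau^-1 ^+ 3.
have CT0 : 0 <= CT by rewrite mulr_ge0 ?exprn_ge0 ?(ltW tV) ?(ltW C0).
have [n hn] := small (K + CT) e (addr_ge0 K0 CT0) e0.
have [h1 h2 _ h3] := H n.
have h4 := core _ _ _ _ h1 h2 tau0 tauT.
have h5 : N (z n) <= N w + r n.
  by have := L2normD (z n - w) w; rewrite subrK (L2norm_distC (z n) w); lra.
have h6 : CT * N (z n) <= CT * (N w + r n) by apply: ler_wpM2l.
have h7 := L2normD (g - V n) (V n); rewrite subrK (L2norm_distC g (V n)) in h7.
have h8 := gP n; rewrite -/CT in h4 *; rewrite -/(V n) in h4.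
rewrite mulrDl in hn; lra.
Qed.

End KdV.
End Smoothing.

(** * Factorial inequalities *)

Section Factorials.
Local Open Scope nat_scope.

Lemma bin_le_exp2 n m : 'C(n, m) <= 2 ^ n.
Proof.
elim: n m => [|n ih] [|m] //; first by rewrite bin0 expn_gt0.
by rewrite binS expnS mul2n -addnn leq_add.
Qed.

Lemma fact_mul_le m n : m`! * n`! <= (m + n)`!.
Proof.
have := bin_fact (leq_addr n m); rewrite addKn => <-.
by rewrite leq_pmull// bin_gt0 leq_addr.
Qed.

Lemma fact_add_le m n : (m + n)`! <= 2 ^ (m + n) * (m`! * n`!).
Proof.
have := bin_fact (leq_addr n m); rewrite addKn => <-.
by rewrite leq_mul2r bin_le_exp2 orbT.
Qed.

Lemma expn_ffact_le n m : n ^ m <= (n + m) ^_ m.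
Proof.
elim: m => [|m ih]; first by rewrite ffactn0.
by rewrite addnS ffactSS expnS leq_mul// -addnS leq_addr.
Qed.

(** n^n is at most the falling factorial of 2n with n factors, that is 'C(2n, n) n!. *)
Lemma expnn_le_fact n : n ^ n <= 4 ^ n * n`!.
Proof.
apply: leq_trans (expn_ffact_le n n) _; rewrite -bin_ffact leq_mul2r.
by apply/orP; right; rewrite (_ : 4 = 2 ^ 2)// -expnM mul2n -addnn bin_le_exp2.
Qed.

Lemma fact_cube_le n : n`! ^ 3 <= (3 * n)`!.
Proof.
rewrite !mulSn mul0n addn0 !expnS expn0 muln1.
by apply: leq_trans (fact_mul_le _ _); rewrite leq_mul// fact_mul_le.
Qed.

Lemma fact3_le n : (3 * n)`! <= 27 ^ n * n`! ^ 3.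
Proof.
elim: n => // n ih; have -> : 3 * n.+1 = (3 * n).+3 by rewrite mulnS addnC !addnS addn0.
rewrite !factS !expnMn expnS.
have h1 : (3 * n).+3 <= 3 * n.+1 by rewrite mulnS addnC !addnS addn0.
have h2 : (3 * n).+2 <= 3 * n.+1 := leq_trans (leqnSn _) h1.
have h3 : (3 * n).+1 <= 3 * n.+1 := leq_trans (leqnSn _) h2.
have h := leq_mul h1 (leq_mul h2 (leq_mul h3 ih)).
apply: leq_trans h _; apply: eq_leq.
by rewrite !expnS !expn0; nia.
Qed.

(** Pays for the additional power of A in sup bounds: the polynomial loss (n + 1)^3 is at most
    8^n. *)
Lemma fact_steps_le n : (3 * n.+1)`! <= 27 * 8 ^ n * (3 * n)`!.
Proof.
have -> : 3 * n.+1 = (3 * n).+3 by rewrite mulnS addnC !addnS addn0.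
rewrite !factS.
have h1 : (3 * n).+3 <= 3 * n.+1 by rewrite mulnS addnC !addnS addn0.
have h2 : (3 * n).+2 <= 3 * n.+1 := leq_trans (leqnSn _) h1.
have h3 : (3 * n).+1 <= 3 * n.+1 := leq_trans (leqnSn _) h2.
have n2 : n.+1 <= 2 ^ n by exact: ltn_expl.
have e8 : 8 ^ n = 2 ^ n * (2 ^ n * 2 ^ n) by rewrite -!expnMn.
have k : n.+1 * (n.+1 * n.+1) <= 8 ^ n by rewrite e8 !leq_mul.
apply: leq_trans (leq_mul h1 (leq_mul h2 (leq_mul h3 (leqnn _)))) _.
rewrite !mulnA leq_mul2r; apply/orP; right.
by nia.
Qed.

End Factorials.

(** * Powers of the generator along orbits *)

Section Powers.
Variable R : realType.
Notation N := (@L2norm R).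
Variables (S : R -> L2 R -> L2 R) (hC : contraction_semigroup S).
Implicit Types (f g w z : L2 R).

(** The graph of A^n; its base case is equality in L^2 rather than of functions. *)
Fixpoint genpow n w z : Prop :=
  if n is n'.+1 then exists2 h, genpow n' w h & generator S h z else N (w - z) = 0.

Lemma eqv_trans w z g : N (w - z) = 0 -> N (z - g) = 0 -> N (w - g) = 0.
Proof.
move=> h1 h2; apply: L2norm_eq0_le.
by have := L2norm_subl w z g; rewrite h1 h2 addr0.
Qed.

Lemma eqv_sym w z : N (w - z) = 0 -> N (z - w) = 0.
Proof. by rewrite L2norm_distC. Qed.

Lemma genpow_eqvl n w w' z : N (w - w') = 0 -> genpow n w z -> genpow n w' z.
Proof.
move=> ww; elim: n z => [|n ih] z /=; first exact: eqv_trans (eqv_sym ww).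
by move=> [h /ih hn hz]; exists h.
Qed.

Lemma genpow_unique n w z z' : genpow n w z -> genpow n w z' -> N (z - z') = 0.
Proof.
elim: n z z' => [|n ih] z z' /=; first by move=> h1 h2; exact: eqv_trans (eqv_sym h1) h2.
move=> [h hn hz] [h' hn' hz']; apply: (generator_unique _ hz').
exact: (generator_eqv hC (ih _ _ hn hn') (L2norm_subrr _) hz).
Qed.

Lemma genpow_S n t w z : 0 <= t -> genpow n w z -> genpow n (S t w) (S t z).
Proof.
move=> t0; elim: n z => [|n ih] z /=; first exact: S_eqv.
by move=> [h /ih hn hz]; exists (S t h) => //; exact: generator_S.
Qed.

End Powers.

Section Orbit.
Variable R : realType.
Notation N := (@L2norm R).
Variables (a : R) (a0 : 0 <= a) (S : R -> L2 R -> L2 R) (hS : kdv_semigroup a S).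
Implicit Types (f g w z : L2 R).
Let hC : contraction_semigroup S := hS.1.

Lemma genpow_smoothing (T : R) : 0 < T -> exists2 C : R, 0 < C &
  forall n (tau : R) w, 0 < tau -> tau ^+ 2 <= T ->
    exists2 g, genpow S n (S (n%:R * tau ^+ 2) w) g & N g <= (C * tau^-1 ^+ 3) ^+ n * N w.
Proof.
move=> T0; have [C C0 sm] := smoothing a0 hS T0; exists C => // n tau w tau0 tauT.
have t2 : 0 <= tau ^+ 2 := sqr_ge0 tau.
elim: n => [|n [h hn hb]].
  exists w; first by rewrite /= mul0r S_0.
  by rewrite expr0 mul1r.
have [g [Hg gb]] := sm tau h tau0 tauT.
exists g.
  exists (S (tau ^+ 2) h) => //.
  have nt : 0 <= n%:R * tau ^+ 2 by rewrite mulr_ge0.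
  apply: genpow_eqvl (genpow_S hC t2 hn).
  have e : n.+1%:R * tau ^+ 2 = tau ^+ 2 + n%:R * tau ^+ 2 by rewrite -natr1; ring.
  rewrite e; exact: (eqv_sym (S_D hC w t2 nt)).
apply: le_trans gb _; rewrite (exprS (C * _)) -[leRHS]mulrA ler_wpM2l//.
by rewrite mulr_ge0 ?exprn_ge0 ?invr_ge0 ?(ltW tau0) ?(ltW C0).
Qed.

Lemma genpow_bound (T : R) : 0 < T -> exists2 L : R, 0 < L &
  forall n (t : R) w, 0 < t -> t <= T ->
    exists2 g, genpow S n (S t w) g &
      N g ^+ 2 <= L ^+ n * (3 * n)`!%:R * t^-1 ^+ (3 * n) * N w ^+ 2.
Proof.
move=> T0; have [C C0 sm] := genpow_smoothing T0.
(* Squaring makes n^(3n) an integer power. [C ^+ 2] comes from the squared smoothing estimate, and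
   4^3 from the cube of n^n <= 4^n n!, with (n!)^3 <= (3n)!. *)
exists (C ^+ 2 * 4 ^+ 3); first by rewrite mulr_gt0 ?exprn_gt0.
move=> [|n] t w t0 tT.
  exists (S t w); first by rewrite /= subrr L2norm0.
  by rewrite !expr0 !mul1r lerXn2r ?nnegrE ?L2norm_ge0// (S_contr hC)// ltW.
pose m : R := n.+1%:R; have m0 : 0 < m by rewrite /m.
pose tau : R := Num.sqrt (t / m); have tau0 : 0 < tau by rewrite sqrtr_gt0 divr_gt0.
have tau2 : tau ^+ 2 = t / m by rewrite sqr_sqrtr// divr_ge0 ?ltW.
have tauT : tau ^+ 2 <= T.
  rewrite tau2; apply: le_trans tT; rewrite ler_pdivrMr// ler_peMr ?(ltW t0)//.
  by rewrite /m ler1n.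
have [g gn gb] := sm n.+1 tau w tau0 tauT.
exists g; first by move: gn; rewrite tau2 -/m mulrC divfK// gt_eqF.
have gb2 : N g ^+ 2 <= ((C * tau^-1 ^+ 3) ^+ n.+1 * N w) ^+ 2.
  by rewrite lerXn2r ?nnegrE ?L2norm_ge0//; apply: le_trans gb; exact: L2norm_ge0.
apply: le_trans gb2 _; rewrite exprMn ler_wpM2r ?sqr_ge0//.
have -> : ((C * tau^-1 ^+ 3) ^+ n.+1) ^+ 2 = (C ^+ 2) ^+ n.+1 * (m ^+ n.+1) ^+ 3 * t^-1 ^+ (3 * n.+1).
  have e : (tau^-1 ^+ 3) ^+ 2 = m ^+ 3 * t^-1 ^+ 3.
    by rewrite exprAC exprVn tau2 invf_div exprMn.
  have sq (x y : R) k : ((x * y) ^+ k) ^+ 2 = (x ^+ 2) ^+ k * (y ^+ 2) ^+ k.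
    by rewrite -!exprM mulnC exprMn.
  by rewrite sq e (exprMn _ (m ^+ 3)) mulrA (exprAC m) -(exprM t^-1).
rewrite ler_wpM2r ?exprn_ge0 ?invr_ge0 ?(ltW t0)//.
rewrite (exprMn _ (C ^+ 2)) -[leRHS]mulrA ler_wpM2l ?exprn_ge0 ?(ltW C0)//.
have -> : (m ^+ n.+1) ^+ 3 = ((n.+1 ^ n.+1) ^ 3)%:R by rewrite /m !natrX.
have -> : (4 ^+ 3) ^+ n.+1 = ((4 ^ n.+1) ^ 3)%:R :> R by rewrite !natrX exprAC.
rewrite -natrM ler_nat.
apply: (@leq_trans ((4 ^ n.+1 * n.+1`!) ^ 3)).
  by rewrite leq_exp2r// expnn_le_fact.
by rewrite expnMn leq_mul2l fact_cube_le orbT.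
Qed.

Lemma orbit_powers w : exists F : nat -> R -> L2 R,
  [/\ forall t, 0 < t -> N (F 0%N t - S t w) = 0,
      forall n t, 0 < t -> generator S (F n t) (F n.+1 t),
      forall n s t, 0 < s -> s <= t -> N (F n t - S (t - s) (F n s)) = 0 &
      forall T : R, 0 < T -> exists2 L : R, 0 < L & forall n t, 0 < t -> t <= T ->
        N (F n t) ^+ 2 <= L ^+ n * (3 * n)`!%:R * t^-1 ^+ (3 * n) * N w ^+ 2].
Proof.
(* A value of A^n e^(tA) w is chosen separately for each n and t, so the relations between different
   times hold only up to norm zero. *)
pose F n t := xget (0 : L2 R) [set g | genpow S n (S t w) g].
have FP n t : 0 < t -> genpow S n (S t w) (F n t).
  move=> t0; have [L L0 H] := genpow_bound t0.
  by have [g gn _] := H n t w t0 (lexx t); rewrite /F; case: xgetP => // /(_ g).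
exists F; split.
- by move=> t t0; exact: eqv_sym (FP 0%N t t0).
- move=> n t t0; have [h hn hg] := FP n.+1 t t0.
  exact: (generator_eqv hC (genpow_unique hC hn (FP n t t0)) (L2norm_subrr _) hg).
- move=> n s t s0 st; have ts : 0 <= t - s by rewrite subr_ge0.
  have h := genpow_S hC ts (FP n s s0).
  apply: (genpow_unique hC (FP n t (lt_le_trans s0 st))).
  by apply: genpow_eqvl h; exact: eqv_sym (S_subr hC _ (ltW s0) st).
- move=> T T0; have [L L0 H] := genpow_bound T0; exists L => // n t t0 tT.
  have [g gn gb] := H n t w t0 tT; rewrite (L2norm_eqv (genpow_unique hC (FP n t t0) gn)).
  exact: gb.
Qed.

End Orbit.

(** * Partial derivatives of the solution *)

Section Partials.
Variable R : realType.
Notation N := (@L2norm R).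
Variables (a : R) (a0 : 0 <= a) (S : R -> L2 R -> L2 R) (hS : kdv_semigroup a S).
Implicit Types (w z : L2 R) (s t x : R).
Let hC : contraction_semigroup S := hS.1.

Variable F : nat -> R -> L2 R.
Hypothesis F_generator : forall n t, 0 < t -> generator S (F n t) (F n.+1 t).
Hypothesis F_flow : forall n s t, 0 < s -> s <= t -> N (F n t - S (t - s) (F n s)) = 0.

Lemma orbit_representatives : exists U U1 U2 U3 : nat -> R -> R -> R, forall n t, 0 < t ->
  classical_kdv a (F n t) (F n.+1 t) (U n t) (U1 n t) (U2 n t) (U3 n t).
Proof.
have H (p : nat * R) : exists q : (R -> R) * (R -> R) * (R -> R) * (R -> R), 0 < p.2 ->
    classical_kdv a (F p.1 p.2) (F p.1.+1 p.2) q.1.1.1 q.1.1.2 q.1.2 q.2.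
  have [t0|t0] := ltP 0 p.2; last by exists (id, id, id, id).
  have [u [u1 [u2 [u3 h]]]] := generator_classical hS (F_generator p.1 t0) (F_generator p.1.+1 t0).
  by exists (u, u1, u2, u3).
have [q qP] := choice H.
exists (fun n t => (q (n, t)).1.1.1), (fun n t => (q (n, t)).1.1.2),
  (fun n t => (q (n, t)).1.2), (fun n t => (q (n, t)).2) => n t t0.
exact: (qP (n, t) t0).
Qed.

(** Restarting the flow at tau gives a constant uniform over all later times. *)
Lemma orbit_quad n tau s t : 0 < tau -> tau <= s -> tau <= t ->
  N (F n t - F n s - (t - s) *: F n.+1 s) <= 2 * (t - s) ^+ 2 * N (F n.+2 tau).
Proof.
move=> tau0 ts tt; have s0 : 0 <= s - tau by rewrite subr_ge0.
have t0 : 0 <= t - tau by rewrite subr_ge0.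
have := flow_quad hC s0 t0 (F_generator n tau0) (F_generator n.+1 tau0).
have -> : t - tau - (s - tau) = t - s by ring.
apply: le_trans; apply: L2norm_eqv_le; apply: L2norm_eq0_le.
have e1 := F_flow n tau0 tt; have e2 := F_flow n tau0 ts; have e3 := F_flow n.+1 tau0 ts.
have -> : F n t - F n s - (t - s) *: F n.+1 s -
   (S (t - tau) (F n tau) - S (s - tau) (F n tau) - (t - s) *: S (s - tau) (F n.+1 tau)) =
   (F n t - S (t - tau) (F n tau)) - (F n s - S (s - tau) (F n tau))
   - (t - s) *: (F n.+1 s - S (s - tau) (F n.+1 tau)).
  by apply/LfuneqP => q; rewrite !(L2addE, L2oppE, L2scaleE); ring.
apply: le_trans (L2normB _ _) _; rewrite L2normZ e3 mulr0 addr0.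
by apply: le_trans (L2normB _ _) _; rewrite e1 e2 addr0.
Qed.

Section Family.
Variables U U1 U2 U3 : nat -> R -> R -> R.
Hypothesis HU : forall n t, 0 < t ->
  classical_kdv a (F n t) (F n.+1 t) (U n t) (U1 n t) (U2 n t) (U3 n t).

(* d_x^3 y = - d_t y - a d_x y trades three space derivatives for a time
   derivative. *)
Fixpoint kdv_partial (p : nat) (n : nat) (x t : R) : R :=
  match p with
  | 0 => U n t x
  | 1 => U1 n t x
  | 2 => U2 n t x
  | ((p'.+1 as q).+2) => - kdv_partial p' n.+1 x t - a * kdv_partial q n x t
  end.

Lemma third_derivativeE n t x : 0 < t -> -1 <= x <= 0 -> U3 n t x = - U n.+1 t x - a * U1 n t x.
Proof.
move=> t0 x01.
have [[_ du1 du2 c3] [_ _ _ _ h1]] := HU n t0.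
have [[du _ _ _] [_ _ _ h2 _]] := HU n.+1 t0.
have cu1 := is_derive_continuous du1; have cu := is_derive_continuous du.
have c : continuous (fun x => - U3 n t x - a * U1 n t x) by continuity.
have := continuous_ae_eq c cu (lebI_ae_trans h1 (lebI_ae_sym h2)) x01.
by move=> e; lra.
Qed.

Lemma kdv_partial_ind (P : nat -> Prop) : P 0%N -> P 1%N -> P 2%N ->
  (forall p, P p -> P p.+1 -> P p.+3) -> forall p, P p.
Proof.
move=> P0 P1 P2 PS p.
suff : [/\ P p, P p.+1 & P p.+2] by case.
by elim: p => // p [h0 h1 h2]; split => //; exact: PS.
Qed.

Lemma kdv_partial_x p n t : 0 < t -> exists g, [/\ has_derive (fun x => kdv_partial p n x t) g,
  continuous g & forall x, -1 <= x <= 0 -> g x = kdv_partial p.+1 n x t].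
Proof.
move=> t0; elim/kdv_partial_ind: p n => [n|n|n|p ih0 ih1 n] /=.
- have [[du du1 du2 c3] _] := HU n t0; exists (U1 n t); split => //.
  exact: is_derive_continuous du1.
- have [[du du1 du2 c3] _] := HU n t0; exists (U2 n t); split => //.
  exact: is_derive_continuous du2.
- have [[du du1 du2 c3] _] := HU n t0; exists (U3 n t); split => //.
  by move=> x x01; rewrite third_derivativeE.
have [g [dg cg gE]] := ih0 n.+1; have [h [dh ch hE]] := ih1 n.
exists (fun x => - g x - a * h x); split.
- exact: has_deriveB (has_deriveN dg) (has_deriveZ a dh).
- by continuity.
- by move=> x x01; rewrite gE// hE.
Qed.

(** For p <= 2, the Taylor remainder in time of [U n] is the classical representative of that of
    [F n], and A maps the latter to the remainder of [F n.+1]. Sup bounds by the graph norm thus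
    make the L^2 remainders uniform in x; larger p follow by the recursion. *)
Lemma kdv_partial_quad p n tau : 0 < tau -> exists2 M : R, 0 <= M &
  forall s t x, tau <= s -> tau <= t -> -1 <= x <= 0 ->
    `|kdv_partial p n x t - kdv_partial p n x s - (t - s) * kdv_partial p n.+1 x s| <=
      M * (t - s) ^+ 2.
Proof.
move=> tau0.
have KA0 : 0 <= 1 + a * (a + 1) by rewrite addr_ge0 ?mulr_ge0 ?addr_ge0.
have base n' : exists2 M : R, 0 <= M & forall s t x, tau <= s -> tau <= t -> -1 <= x <= 0 ->
   [/\ `|U n' t x - U n' s x - (t - s) * U n'.+1 s x| <= M * (t - s) ^+ 2,
       `|U1 n' t x - U1 n' s x - (t - s) * U1 n'.+1 s x| <= M * (t - s) ^+ 2 &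
       `|U2 n' t x - U2 n' s x - (t - s) * U2 n'.+1 s x| <= M * (t - s) ^+ 2].
  exists ((1 + a * (a + 1)) * (2 * (N (F n'.+2 tau) + N (F n'.+3 tau)))).
    by rewrite !mulr_ge0// addr_ge0// L2norm_ge0.
  move=> s t x ts tt x01.
  have s0 := lt_le_trans tau0 ts; have t0 := lt_le_trans tau0 tt.
  have H := classical_kdv_lin (- (t - s)) (HU n'.+1 s0) (classical_kdv_lin (-1) (HU n' s0) (HU n' t0)).
  have [h0 h1 h2] := classical_kdv_sup a0 H x01.
  have q0 := orbit_quad n' tau0 ts tt; have q1 := orbit_quad n'.+1 tau0 ts tt.
  have E0 k : - (t - s) *: F k.+1 s + (-1 *: F k s + F k t) = F k t - F k s - (t - s) *: F k.+1 s.
    by apply/LfuneqP => q; rewrite !(L2addE, L2oppE, L2scaleE); ring.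
  rewrite !E0 in h0 h1 h2.
  have b : (1 + a * (a + 1)) * (N (F n' t - F n' s - (t - s) *: F n'.+1 s) +
      N (F n'.+1 t - F n'.+1 s - (t - s) *: F n'.+2 s)) <=
     (1 + a * (a + 1)) * (2 * (N (F n'.+2 tau) + N (F n'.+3 tau))) * (t - s) ^+ 2.
    by rewrite -[leRHS]mulrA ler_wpM2l//; move: (lerD q0 q1) => h; apply: le_trans h _; lra.
  have r (A B C : R) : A - B - (t - s) * C = - (t - s) * C + (-1 * B + A) by ring.
  by split; rewrite r; apply: le_trans b.
elim/kdv_partial_ind: p n => [n|n|n|p ih0 ih1 n] /=.
- by have [M M0 H] := base n; exists M => // s t x h1 h2 h3; have [] := H s t x h1 h2 h3.
- by have [M M0 H] := base n; exists M => // s t x h1 h2 h3; have [] := H s t x h1 h2 h3.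
- by have [M M0 H] := base n; exists M => // s t x h1 h2 h3; have [] := H s t x h1 h2 h3.
have [M M0 H] := ih0 n.+1; have [M' M'0 H'] := ih1 n.
exists (M + a * M'); first by rewrite addr_ge0 ?mulr_ge0.
move=> s t x h1 h2 h3; have := H s t x h1 h2 h3; have := H' s t x h1 h2 h3.
set A := kdv_partial p n.+1 x t - _ - _; set B := kdv_partial p.+1 n x t - _ - _ => hB hA.
rewrite [X in `|X|](_ : _ = - A - a * B); last by rewrite /A /B /=; ring.
apply: le_trans (ler_normB _ _) _; rewrite normrN normrM (ger0_norm a0) mulrDl lerD//.
by rewrite -mulrA ler_wpM2l.
Qed.

End Family.
End Partials.

(** * Gevrey bounds *)

Section Bounds.
Variable R : realType.
Notation N := (@L2norm R).

Definition sqrt_fact (m : nat) : R := Num.sqrt m`!%:R.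

Lemma sqrt_fact_sqr m : sqrt_fact m ^+ 2 = m`!%:R.
Proof. by rewrite sqr_sqrtr. Qed.

Lemma sqrt_fact_gt0 m : 0 < sqrt_fact m.
Proof. by rewrite sqrtr_gt0 ltr0n fact_gt0. Qed.

Lemma sqrt_fact_le m n (c : nat) : (m`! <= c ^ 2 * n`!)%N -> sqrt_fact m <= c%:R * sqrt_fact n.
Proof.
move=> h; rewrite -ler_sqr ?nnegrE ?mulr_ge0 ?(ltW (sqrt_fact_gt0 _))//.
by rewrite exprMn !sqrt_fact_sqr -natrX -natrM ler_nat.
Qed.

Lemma sqrt_fact_homo m n : (m <= n)%N -> sqrt_fact m <= sqrt_fact n.
Proof. by move=> mn; rewrite -[leRHS]mul1r; apply: (@sqrt_fact_le _ _ 1); rewrite mul1n leq_fact. Qed.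

Lemma sqrt_fact_steps n : sqrt_fact (3 * n.+1) <= 27%:R * 2 ^+ (3 * n) * sqrt_fact (3 * n).
Proof.
have -> : 27%:R * 2 ^+ (3 * n) = (27 * 2 ^ (3 * n))%:R :> R by rewrite natrM natrX.
apply: sqrt_fact_le; apply: leq_trans (fact_steps_le n) _; rewrite leq_mul2r.
apply/orP; right; have -> : (2 ^ (3 * n) = 8 ^ n)%N by rewrite expnM.
by rewrite -[leqRHS]mulnn leq_pmulr// muln_gt0 expn_gt0.
Qed.

(** The square of the left side is (3n + p)! <= 2^(3n+p) 27^n (n!)^3 p!. The constants 216 = 8 * 27
    and 2 are kept without their square roots, which only enlarges the bound. *)
Lemma sqrt_fact_split n p :
  sqrt_fact (3 * n + p) <= 216%:R ^+ n * 2 ^+ p * (sqrt_fact n ^+ 3 * sqrt_fact p).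
Proof.
have s0 m := ltW (sqrt_fact_gt0 m).
rewrite -ler_sqr ?nnegrE; last 2 first.
- exact: s0.
- by apply: mulr_ge0; apply: mulr_ge0; rewrite ?exprn_ge0 ?ler0n.
rewrite !exprMn exprAC !sqrt_fact_sqr -!natrX -!natrM ler_nat.
apply: leq_trans (fact_add_le _ _) _.
apply: (@leq_trans (2 ^ (3 * n + p) * (27 ^ n * n`! ^ 3 * p`!))%N).
  by rewrite leq_mul2l leq_mul2r fact3_le !orbT.
have -> : (2 ^ (3 * n + p) * (27 ^ n * n`! ^ 3 * p`!) = 216 ^ n * 2 ^ p * (n`! ^ 3 * p`!))%N.
  have -> : (216 ^ n = 2 ^ (3 * n) * 27 ^ n)%N by rewrite expnM -expnMn.
  by rewrite expnD; ring.
rewrite leq_mul2r; apply/orP; right.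
have sq m : (0 < m)%N -> (m <= m ^ 2)%N by move=> m0; rewrite -mulnn leq_pmulr.
by apply: leq_mul; rewrite ?[((216 ^ 2) ^ n)%N]expnAC; apply: sq; rewrite expn_gt0.
Qed.

Variables (a : R) (a0 : 0 <= a) (S : R -> L2 R -> L2 R) (hS : kdv_semigroup a S).
Variables (F : nat -> R -> L2 R) (U U1 U2 U3 : nat -> R -> R -> R).
Hypothesis HU : forall n t, 0 < t ->
  classical_kdv a (F n t) (F n.+1 t) (U n t) (U1 n t) (U2 n t) (U3 n t).
Variables (T L0 Y : R).
Hypotheses (T0 : 0 < T) (L00 : 0 < L0) (Y0 : 0 <= Y).
Hypothesis HF : forall n t, 0 < t -> t <= T ->
  N (F n t) ^+ 2 <= L0 ^+ n * (3 * n)`!%:R * t^-1 ^+ (3 * n) * Y ^+ 2.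

Let D := kdv_partial a U U1 U2.
Let iq (t : R) := (Num.sqrt t)^-1.

Let iq_gt0 t : 0 < t -> 0 < iq t.
Proof. by move=> t0; rewrite invr_gt0 sqrtr_gt0. Qed.

Let sqrt_iq t : 0 < t -> Num.sqrt t * iq t = 1.
Proof. by move=> t0; rewrite divff// gt_eqF// sqrtr_gt0. Qed.

Let sqrt_le t : 0 < t -> t <= T -> Num.sqrt t <= 1 + T.
Proof.
move=> t0 tT; have := sqr_ge0 (Num.sqrt t - 1).
rewrite (_ : (Num.sqrt t - 1) ^+ 2 = Num.sqrt t ^+ 2 - 2 * Num.sqrt t + 1); last ring.
rewrite sqr_sqrtr ?(ltW t0)// => h1; lra.
Qed.

(** On ]0,T] the power of t^(-1/2) may be raised at the price of powers of 1 + T, so that terms of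
    different orders share one exponent. *)
Let iq_shift t k m : 0 < t -> t <= T -> iq t ^+ k <= (1 + T) ^+ m * iq t ^+ (k + m).
Proof.
move=> t0 tT; have i0 := ltW (iq_gt0 t0).
rewrite exprD mulrCA -exprMn ler_peMr ?exprn_ge0//.
rewrite exprn_ege1//; apply: le_trans (_ : Num.sqrt t * iq t <= _); first by rewrite sqrt_iq.
by apply: ler_wpM2r (sqrt_le t0 tT).
Qed.

(** The sup bound involves [F n.+1], whose size t^(-3(n+1)/2) accounts for the exponent 3n + 3; the
    factor 2 in the base [2 * La] absorbs the loss of [sqrt_fact_steps]. *)
Lemma kdv_partial_base_bound : exists K L : R, [/\ 0 < K, 1 <= L &
  forall p n t x, (p <= 2)%N -> 0 < t -> t <= T -> -1 <= x <= 0 ->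
    `|D p n x t| <= K * L ^+ (3 * n) * sqrt_fact (3 * n) * iq t ^+ (3 * n + 3)].
Proof.
pose La := 1 + L0; have La1 : 1 <= La by rewrite /La lerDl ltW.
have La0 : 0 <= La by lra.
have NF n t : 0 < t -> t <= T ->
    N (F n t) <= Y * La ^+ (3 * n) * sqrt_fact (3 * n) * iq t ^+ (3 * n).
  move=> t0 tT; have i0 := ltW (iq_gt0 t0); have s0 := ltW (sqrt_fact_gt0 (3 * n)).
  apply: L2norm_le_sqr; first by rewrite !mulr_ge0 ?exprn_ge0.
  apply: le_trans (HF n t0 tT) _; rewrite !exprMn sqrt_fact_sqr.
  have -> : iq t ^+ (3 * n) ^+ 2 = t^-1 ^+ (3 * n).
    by rewrite exprAC /iq exprVn sqr_sqrtr// ltW.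
  have h : L0 ^+ n <= La ^+ (3 * n) ^+ 2.
    rewrite -exprM; apply: (@le_trans _ _ (La ^+ n)).
      by rewrite lerXn2r ?nnegrE ?(ltW L00)// /La lerDr.
    by apply: ler_weXn2l => //; rewrite -mulnA mulnC -mulnA leq_pmulr.
  have -> : Y ^+ 2 * La ^+ (3 * n) ^+ 2 * (3 * n)`!%:R * t^-1 ^+ (3 * n) =
     La ^+ (3 * n) ^+ 2 * ((3 * n)`!%:R * t^-1 ^+ (3 * n) * Y ^+ 2) by ring.
  rewrite -[leLHS]mulrA -[leLHS]mulrA [_ * (t^-1 ^+ _ * _)]mulrA; apply: ler_wpM2r h.
  by rewrite !mulr_ge0 ?sqr_ge0 ?exprn_ge0 ?invr_ge0 ?(ltW t0).
pose KA := 1 + a * (a + 1); have KA0 : 0 <= KA by rewrite addr_ge0 ?mulr_ge0 ?addr_ge0.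
pose K := KA * (Y * ((1 + T) ^+ 3 + 27%:R * La ^+ 3)) + 1.
have T1 : 0 <= (1 + T) ^+ 3 by rewrite exprn_ge0 ?addr_ge0 ?(ltW T0).
have La3 : 0 <= 27%:R * La ^+ 3 by rewrite mulr_ge0 ?exprn_ge0.
have Kp : 0 <= KA * (Y * ((1 + T) ^+ 3 + 27%:R * La ^+ 3)).
  by rewrite mulr_ge0// mulr_ge0// addr_ge0.
exists K, (2 * La); split; [by rewrite /K; lra|by lra|].
move=> p n t x p2 t0 tT x01.
have i0 := ltW (iq_gt0 t0); have s0 := ltW (sqrt_fact_gt0 (3 * n)).
have h : `|D p n x t| <= KA * (N (F n t) + N (F n.+1 t)).
  have [h0 h1 h2] := classical_kdv_sup a0 (HU n t0) x01.
  by case: p p2 => [|[|[|//]]] _ /=.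
apply: le_trans h _.
set W := (2 * La) ^+ (3 * n) * sqrt_fact (3 * n) * iq t ^+ (3 * n + 3).
have W0 : 0 <= W by rewrite !mulr_ge0 ?exprn_ge0 ?mulr_ge0.
have LaW : La ^+ (3 * n) <= (2 * La) ^+ (3 * n) by rewrite lerXn2r ?nnegrE ?mulr_ge0//; lra.
have n1 : N (F n t) <= Y * (1 + T) ^+ 3 * W.
  apply: le_trans (NF n t t0 tT) _.
  have -> : Y * (1 + T) ^+ 3 * W = Y * (2 * La) ^+ (3 * n) * sqrt_fact (3 * n) *
    ((1 + T) ^+ 3 * iq t ^+ (3 * n + 3)) by rewrite /W; ring.
  apply: ler_pM; rewrite ?mulr_ge0 ?exprn_ge0//; last exact: iq_shift.
  by rewrite ler_wpM2r// ler_wpM2l.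
have n2 : N (F n.+1 t) <= Y * (27%:R * La ^+ 3) * W.
  apply: le_trans (NF n.+1 t t0 tT) _.
  have h3 := sqrt_fact_steps n.
  have -> : iq t ^+ (3 * n.+1) = iq t ^+ (3 * n + 3) by rewrite mulnS addnC.
  have -> : Y * La ^+ (3 * n.+1) * sqrt_fact (3 * n.+1) * iq t ^+ (3 * n + 3) =
     Y * La ^+ 3 * La ^+ (3 * n) * iq t ^+ (3 * n + 3) * sqrt_fact (3 * n.+1).
    by rewrite mulnS exprD; ring.
  apply: (@le_trans _ _ (Y * La ^+ 3 * La ^+ (3 * n) * iq t ^+ (3 * n + 3) *
     (27%:R * 2 ^+ (3 * n) * sqrt_fact (3 * n)))).
    by rewrite ler_wpM2l// !mulr_ge0 ?exprn_ge0.
  by rewrite le_eqVlt; apply/orP; left; apply/eqP; rewrite /W exprMn; ring.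
have -> : K * (2 * La) ^+ (3 * n) * sqrt_fact (3 * n) * iq t ^+ (3 * n + 3) = K * W.
  by rewrite /W; ring.
have h4 : KA * (N (F n t) + N (F n.+1 t)) <= KA * (Y * (1 + T) ^+ 3 * W + Y * (27%:R * La ^+ 3) * W).
  by rewrite ler_wpM2l// lerD.
apply: le_trans h4 _; rewrite /K.
have -> : KA * (Y * (1 + T) ^+ 3 * W + Y * (27%:R * La ^+ 3) * W) =
   KA * (Y * ((1 + T) ^+ 3 + 27%:R * La ^+ 3)) * W by ring.
by rewrite ler_wpM2r// lerDl.
Qed.

(** The factorial and the power of t in [b] depend on 3n + p alone, which is unchanged when three
    space derivatives become one time derivative. Only the geometric factors have to be compared in
    the induction. *)
Lemma kdv_partial_bound : exists K A B : R, [/\ 0 < K, 0 < A, 0 < B &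
  forall p n t x, 0 < t -> t <= T -> -1 <= x <= 0 ->
    `|D p n x t| <= K * A ^+ n * B ^+ p * (sqrt_fact n ^+ 3 * sqrt_fact p) * iq t ^+ (3 * n + p + 3)].
Proof.
have [K [L [K0 L1 base]]] := kdv_partial_base_bound.
have L0' : 0 <= L by lra.
have K0' := ltW K0.
pose Th := (1 + T) ^+ 2; have Th0 : 0 <= Th by rewrite sqr_ge0.
have T1 : 1 <= 1 + T by rewrite lerDl ltW.
have Th1 : 1 <= Th by rewrite /Th exprn_ege1.
(* Chosen for L^3 + a Th M <= M^3, the condition under which the recursion reproduces [b]: L^3
   stands for the new time derivative and a Th M for the lower-order term, whose two missing powers
   of t^(-1/2) cost Th. *)
pose M := L + 1 + a * Th.
have aTh : 0 <= a * Th by rewrite mulr_ge0.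
have M1 : 1 <= M by rewrite /M; lra.
have M0 : 0 <= M by lra.
have M3 : L ^+ 3 + a * Th * M <= M ^+ 3.
  have LM : L <= M by rewrite /M; lra.
  have h1 : L ^+ 3 <= L ^+ 2 * M by rewrite exprSr ler_wpM2l ?sqr_ge0.
  have h2 : (L ^+ 2 + a * Th) * M <= M ^+ 2 * M.
    rewrite ler_wpM2r//.
    have -> : M ^+ 2 = L ^+ 2 + 2 * L * (1 + a * Th) + (1 + a * Th) ^+ 2 by rewrite /M; ring.
    have : 0 <= 2 * L * (1 + a * Th) by rewrite !mulr_ge0//; lra.
    have : a * Th <= (1 + a * Th) ^+ 2 by rewrite expr2; nra.
    by lra.
  by rewrite (exprSr M); lra.
pose k := K * Th.
have k0 : 0 <= k by apply: mulr_ge0 Th0; exact: ltW.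
pose b p n t := k * L ^+ (3 * n) * M ^+ p * sqrt_fact (3 * n + p) * iq t ^+ (3 * n + p + 3).
have main p n t x : 0 < t -> t <= T -> -1 <= x <= 0 -> `|D p n x t| <= b p n t.
  move=> t0 tT x01; have i0 := ltW (iq_gt0 t0).
  have small q n' : (q <= 2)%N -> `|D q n' x t| <= b q n' t.
    move=> q2; apply: le_trans (base q n' t x q2 t0 tT x01) _.
    have s0 := ltW (sqrt_fact_gt0 (3 * n')).
    have h1 := sqrt_fact_homo (leq_addr q (3 * n')).
    have h2 := iq_shift (3 * n' + 3) q t0 tT.
    have h3 : (1 + T) ^+ q <= Th by rewrite /Th ler_weXn2l.
    have h4 : 1 <= M ^+ q by rewrite exprn_ege1.
    have e : (3 * n' + 3 + q = 3 * n' + q + 3)%N by rewrite addnAC.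
    rewrite e in h2.
    have h5 : iq t ^+ (3 * n' + 3) <= Th * iq t ^+ (3 * n' + q + 3).
      by apply: le_trans h2 _; rewrite ler_wpM2r ?exprn_ge0.
    have -> : b q n' t = (K * L ^+ (3 * n')) * ((M ^+ q * sqrt_fact (3 * n' + q)) * (Th * iq t ^+ (3 * n' + q + 3))).
      by rewrite /b /k; ring.
    rewrite -[leLHS]mulrA ler_wpM2l//; first by rewrite mulr_ge0 ?exprn_ge0 ?(ltW K0).
    apply: ler_pM h5 => //; first by rewrite exprn_ge0.
    by apply: le_trans h1 _; rewrite ler_peMl// ltW// sqrt_fact_gt0.
  elim/kdv_partial_ind: p n => [n|n|n|p ih0 ih1 n]; [exact: small|exact: small|exact: small|].
  rewrite /D /=; apply: le_trans (ler_normB _ _) _; rewrite normrN normrM (ger0_norm a0).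
  have {}ih0 := ih0 n.+1; have {}ih1 := ih1 n.
  have e1 : (3 * n.+1 + p = 3 * n + p.+3)%N by ring.
  set W := k * L ^+ (3 * n) * M ^+ p * sqrt_fact (3 * n + p.+3) * iq t ^+ (3 * n + p.+3 + 3).
  have s0 m : 0 <= sqrt_fact m := ltW (sqrt_fact_gt0 m).
  have W0 : 0 <= W.
    by apply: mulr_ge0; [apply: mulr_ge0 => //; apply: mulr_ge0; [apply: mulr_ge0 => //|]|]; apply: exprn_ge0.
  have b0 : b p n.+1 t = L ^+ 3 * W.
    by rewrite /b /W e1 mulnS exprD; ring.
  have b1 : b p.+1 n t <= M * Th * W.
    have h1 : sqrt_fact (3 * n + p.+1) <= sqrt_fact (3 * n + p.+3).
      by apply: sqrt_fact_homo; apply: leq_add => //; apply: leqW; apply: leqW.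
    have h2 := iq_shift (3 * n + p.+1 + 3) 2 t0 tT.
    have e2 : (3 * n + p.+1 + 3 + 2 = 3 * n + p.+3 + 3)%N by ring.
    rewrite e2 -/Th in h2.
    have -> : M * Th * W = (k * L ^+ (3 * n) * M ^+ p.+1) * (sqrt_fact (3 * n + p.+3) * (Th * iq t ^+ (3 * n + p.+3 + 3))).
      by rewrite /W exprS; ring.
    have -> : b p.+1 n t = (k * L ^+ (3 * n) * M ^+ p.+1) * (sqrt_fact (3 * n + p.+1) * iq t ^+ (3 * n + p.+1 + 3)).
      by rewrite /b; ring.
    apply: ler_wpM2l.
      by apply: mulr_ge0; [apply: mulr_ge0 => //|]; apply: exprn_ge0.
    by apply: ler_pM h1 h2 => //; apply: exprn_ge0.
  have -> : b p.+3 n t = M ^+ 3 * W by rewrite /b /W !exprS; ring.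
  rewrite b0 in ih0.
  have h3 : a * `|D p.+1 n x t| <= a * (M * Th * W) by rewrite ler_wpM2l// (le_trans ih1).
  apply: le_trans (lerD ih0 h3) _.
  have -> : L ^+ 3 * W + a * (M * Th * W) = (L ^+ 3 + a * Th * M) * W by ring.
  by rewrite ler_wpM2r.
exists k, (L ^+ 3 * 216%:R), (M * 2); split.
- by rewrite /k mulr_gt0//; lra.
- by apply: mulr_gt0; [apply: exprn_gt0; lra|rewrite ltr0n].
- by rewrite mulr_gt0//; lra.
move=> p n t x t0 tT x01; apply: le_trans (main p n t x t0 tT x01) _.
have i0 := ltW (iq_gt0 t0).
have h := sqrt_fact_split n p.
rewrite /b ler_wpM2r ?exprn_ge0//.
apply: (@le_trans _ _ (k * L ^+ (3 * n) * M ^+ p * (216%:R ^+ n * 2 ^+ p * (sqrt_fact n ^+ 3 * sqrt_fact p)))).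
  by apply: ler_wpM2l h; apply: mulr_ge0; [apply: mulr_ge0 => //|]; apply: exprn_ge0.
have -> : (L ^+ 3 * 216%:R) ^+ n = L ^+ (3 * n) * 216%:R ^+ n :> R.
  by rewrite exprM; exact: exprMn.
have -> : (M * 2) ^+ p = M ^+ p * 2 ^+ p by exact: exprMn.
move: (L ^+ (3 * n)) (216%:R ^+ n) => l c.
by rewrite le_eqVlt; apply/orP; left; apply/eqP; ring.
Qed.

End Bounds.

(** * Smoothness on rectangles from one-variable information *)

Section Smooth.
Variable R : realType.
Implicit Types (x t : R) (D : nat -> nat -> R -> R -> R).

Lemma is_derive_is_derive_within (I : set R) (f : R -> R) x (l : R) :
  is_derive x 1 f l -> is_derive_within I f x l.
Proof.
move=> fl; have h : h^-1 *: (f (h *: 1 + x) - f x) @[h --> 0^'] --> l.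
  by rewrite -(@derive_val _ _ _ _ _ _ _ fl); exact: (@ex_derive _ _ _ _ _ _ _ fl).
apply/cvgrPdist_lt => e e0; have /cvgrPdist_lt/(_ e e0) := h.
rewrite near_withinE => -[d /= d0 hd]; apply/nbhs_ballP; exists d => //= z xz zx _.
have := hd (z - x); rewrite /ball_/= sub0r normrN distrC subr_eq0 => /(_ xz zx).
by rewrite /GRing.scale/= mulr1 subrK mulrC.
Qed.

Lemma continuous_itv_bounded (f : R -> R) : continuous f ->
  exists2 B : R, 0 <= B & forall x, -1 <= x <= 0 -> `|f x| <= B.
Proof.
move=> cf; have cn : continuous (fun x => `|f x|).
  by move=> x; apply: continuous_comp; [exact: cf|exact: norm_continuous].
have le10 : (-1 : R) <= 0 by rewrite oppr_le0.
have [c _ hc] := EVT_max le10 (continuous_subspaceT cn).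
by exists `|f c| => // x x01; apply: hc; rewrite in_itv.
Qed.

(** Joint continuity at (x0, t0) combines continuity in x at time t0 with a Lipschitz bound in t
    uniform in x. The latter follows from the quadratic remainder for times above t0 / 2 and from a
    bound of the time derivative at t0 on [-1,0]. *)
Lemma smooth_partials_quad D :
  (forall p n t, 0 < t -> exists g, [/\ has_derive (fun x => D p n x t) g,
     continuous g & forall x, -1 <= x <= 0 -> g x = D p.+1 n x t]) ->
  (forall p n tau, 0 < tau -> exists2 M : R, 0 <= M &
     forall s t x, tau <= s -> tau <= t -> -1 <= x <= 0 ->
     `|D p n x t - D p n x s - (t - s) * D p n.+1 x s| <= M * (t - s) ^+ 2) ->
  smooth_partials `[-1, 0] `]0, +oo[ (D 0%N 0%N) D.
Proof.
move=> Dx Dt; split => //.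
- move=> p n; apply/subspace_continuousP => -[x0 t0] [/= x01].
  rewrite in_itv/= andbT => t0p.
  have t2 : 0 < t0 / 2 by rewrite divr_gt0.
  have [M M0 HM] := Dt p n _ t2.
  have [g [dg _ _]] := Dx p n _ t0p; have cg := is_derive_continuous dg.
  have [g' [dg' _ _]] := Dx p n.+1 _ t0p.
  have [B B0 HB] := continuous_itv_bounded (is_derive_continuous dg').
  apply/cvgrPdist_lt => e e0; rewrite near_withinE.
  have c0 : 0 < M * (t0 / 2) + B + 1 by rewrite ltr_wpDl// addr_ge0// mulr_ge0// ltW.
  have d0 : 0 < Num.min (t0 / 2) (e / 2 / (M * (t0 / 2) + B + 1)).
    by rewrite lt_min t2/= !divr_gt0.
  have e2 : 0 < e / 2 by rewrite divr_gt0.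
  have n1 : \forall z \near (x0, t0), `|z.2 - t0| < Num.min (t0 / 2) (e / 2 / (M * (t0 / 2) + B + 1)).
    have h : (fun z : R * R => z.2) z @[z --> (x0, t0)] --> t0 by exact: cvg_snd.
    by move/cvgrPdistC_lt : h; exact.
  have n2 : \forall z \near (x0, t0), `|D p n x0 t0 - D p n z.1 t0| < e / 2.
    have h : (fun z : R * R => D p n z.1 t0) z @[z --> (x0, t0)] --> D p n x0 t0.
      apply: (@cvg_comp _ _ _ fst (fun x => D p n x t0) _ (nbhs x0)); first exact: cvg_fst.
      exact: cg.
    by have /cvgrPdist_lt/(_ _ e2) := h.
  near=> z => -[/= z1]; rewrite in_itv/= andbT => z20.
  have h1 : `|z.2 - t0| < Num.min (t0 / 2) (e / 2 / (M * (t0 / 2) + B + 1)) by near: z.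
  have h2 : `|D p n x0 t0 - D p n z.1 t0| < e / 2 by near: z.
  move: h1; rewrite lt_min => /andP[h1 h3].
  have z1' : -1 <= z.1 <= 0 by move: z1; rewrite in_itv.
  have h4 := HM t0 z.2 z.1.
  have h5 : `|D p n z.1 z.2 - D p n z.1 t0| <= `|z.2 - t0| * (M * (t0 / 2) + B + 1).
    have -> : D p n z.1 z.2 - D p n z.1 t0 = 
      (D p n z.1 z.2 - D p n z.1 t0 - (z.2 - t0) * D p n.+1 z.1 t0) + (z.2 - t0) * D p n.+1 z.1 t0 by ring.
    apply: le_trans (ler_normD _ _) _.
    have h6 : `|(z.2 - t0) * D p n.+1 z.1 t0| <= `|z.2 - t0| * B.
      by rewrite normrM ler_wpM2l// HB.
    have h7 : t0 / 2 <= t0 by rewrite ler_pdivrMr// ler_peMr ?(ltW t0p)// ler1n.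
    have h8 : t0 / 2 <= z.2 by move: h1; rewrite ltr_norml => /andP[]; lra.
    have h9 : M * (z.2 - t0) ^+ 2 <= `|z.2 - t0| * (M * (t0 / 2)).
      by rewrite -[(z.2 - t0) ^+ 2]real_normK ?num_real// expr2 mulrCA ler_wpM2l// ler_wpM2l// ltW.
    have := h4 h7 h8 z1'; have := normr_ge0 (z.2 - t0).
    rewrite [_ * (_ + B + 1)]mulrDr [_ * (_ + B)]mulrDr mulr1 => ? ?; lra.
  have h6 : `|z.2 - t0| * (M * (t0 / 2) + B + 1) < e / 2 by rewrite -ltr_pdivlMr.
  have -> : D p n x0 t0 - D p n z.1 z.2 =
    (D p n x0 t0 - D p n z.1 t0) - (D p n z.1 z.2 - D p n z.1 t0) by ring.
  apply: le_lt_trans (ler_normB _ _) _; lra.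
- move=> p n x t /=; rewrite !in_itv/= andbT => x01 t0.
  have [g [dg _ gE]] := Dx p n t t0; rewrite -gE//.
  exact: is_derive_is_derive_within.
- move=> p n x t /=; rewrite !in_itv/= andbT => x01 t0.
  have t2 : 0 < t / 2 by rewrite divr_gt0.
  have [M M0 HM] := Dt p n _ t2.
  apply: is_derive_is_derive_within; apply: (@is_derive_quad _ _ _ _ M (t / 2)) => // s.
  rewrite ltr_norml => /andP[s1 s2]; apply: HM => //; lra.
Unshelve. all: by end_near.
Qed.

Lemma smooth_partials_sub (I I' J J' : set R) y D : I `<=` I' -> J `<=` J' ->
  smooth_partials I' J' y D -> smooth_partials I J y D.
Proof.
move=> II JJ [h0 hc hx ht].
have sub (A B : set R) f x (l : R) : A `<=` B -> is_derive_within B f x l -> is_derive_within A f x l.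
  by move=> AB; apply: cvg_trans; apply: cvg_app; apply: within_subset.
split.
- by move=> x t /II Ix /JJ Jt; exact: h0.
- by move=> p n; apply: continuous_subspaceW (hc p n) => -[x t] [/= /II Ix /JJ Jt].
- by move=> p n x t Ix Jt; apply: (sub _ _ _ _ _ II); apply: hx; [exact: II|exact: JJ].
- by move=> p n x t Ix Jt; apply: (sub _ _ _ _ _ JJ); apply: ht; [exact: II|exact: JJ].
Qed.

Lemma sqrt_factE n : sqrt_fact R n = n`!%:R `^ (1 / 2).
Proof. by rewrite div1r powR12_sqrt. Qed.

Lemma sqrt_fact_powR3 n : sqrt_fact R n ^+ 3 = n`!%:R `^ (3 / 2).
Proof. by rewrite (mulrC 3) powRrM powR12_sqrt// powR_mulrn// sqrtr_ge0. Qed.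

Lemma invsqrt_powR t k : 0 <= t -> (Num.sqrt t)^-1 ^+ k = t `^ (- (k%:R / 2)).
Proof.
by move=> t0; rewrite powRN (mulrC k%:R) powRrM powR12_sqrt// powR_mulrn ?sqrtr_ge0// exprVn.
Qed.

End Smooth.

Theorem proposition2p2 (R : realType) (a : R) (ha : 0 <= a)
    (S : R -> L2 R -> L2 R) (hS : kdv_semigroup a S) (y0 : L2 R) :
  exists y : R -> R -> R,
    (forall t : R, 0 < t -> (fun x => y x t) = S t y0 %[ae lebI R]) /\
    (forall eps T : R, 0 < eps -> eps < T ->
       gevrey (1 / 2) (3 / 2) (-1) 0 eps T y) /\
    exists2 D : nat -> nat -> R -> R -> R,
      smooth_partials `[-1, 0] `]0, +oo[ y D &
      forall T : R, 0 < T ->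
        exists K R1 R2 : R, [/\ 0 < K, 0 < R1, 0 < R2 &
          forall (p n : nat) (t x : R), t \in `]0, T] -> x \in `[-1, 0] ->
            `|D p n x t| <=
              K * t `^ (- ((3 * n + p + 3)%:R / 2)) *
              (n`!%:R `^ (3 / 2) / R1 ^+ n) *
              (p`!%:R `^ (1 / 2) / R2 ^+ p)].
Proof.
have [F [F0 Fgen Fflow Fbound]] := orbit_powers ha hS y0.
have [U [U1 [U2 [U3 HU]]]] := orbit_representatives hS Fgen.
pose D := kdv_partial a U U1 U2.
have smoothD : smooth_partials `[-1, 0] `]0, +oo[ (D 0%N 0%N) D.
  apply: smooth_partials_quad => [p n t t0|p n tau tau0].
    exact (kdv_partial_x HU p n t0).
  exact (kdv_partial_quad ha hS Fgen Fflow HU p n tau0).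
have boundD T : 0 < T -> exists K A B : R, [/\ 0 < K, 0 < A, 0 < B &
    forall p n t x, 0 < t -> t <= T -> -1 <= x <= 0 ->
    `|D p n x t| <= K * A ^+ n * B ^+ p * (sqrt_fact R n ^+ 3 * sqrt_fact R p) *
      (Num.sqrt t)^-1 ^+ (3 * n + p + 3)].
  move=> T0; have [L L0 HL] := Fbound T T0.
  exact (kdv_partial_bound ha HU T0 L0 (L2norm_ge0 y0) HL).
exists (D 0%N 0%N); split; [|split].
- move=> t t0; have [_ [_ _ _ h _]] := HU 0%N t t0.
  exact: lebI_ae_trans h (ae_L2norm (F0 t t0)).
- move=> eps T e0 eT; exists D.
    apply: smooth_partials_sub smoothD => // t /=; rewrite !in_itv/= andbT => /andP[et _].
    exact: lt_le_trans et.
  have [K [A [B [K0 A0 B0 HB]]]] := boundD T (lt_trans e0 eT).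
  pose c := (Num.sqrt eps)^-1.
  have c0 : 0 < c by rewrite invr_gt0 sqrtr_gt0.
  (* For t >= eps, t^(-1/2) is at most c. The power 3n + p + 3 of c splits into c^3 for the
     constant, c for each space derivative and c^3 for each time derivative. *)
  exists (K * c ^+ 3), (B * c)^-1, (A * c ^+ 3)^-1; split.
  + by apply: mulr_gt0 => //; exact: exprn_gt0.
  + by rewrite invr_gt0; apply: mulr_gt0.
  + by rewrite invr_gt0; apply: mulr_gt0 => //; exact: exprn_gt0.
  move=> p n x t; rewrite !in_itv/= => x01 /andP[et tT].
  have t0 := lt_le_trans e0 et.
  apply: le_trans (HB p n t x t0 tT x01) _.
  have tc : (Num.sqrt t)^-1 <= c.
    by rewrite /c lef_pV2 ?posrE ?sqrtr_gt0// ler_wsqrtr.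
  clearbody c.
  have s0 m : 0 <= sqrt_fact R m := ltW (sqrt_fact_gt0 R m).
  rewrite -sqrt_factE -sqrt_fact_powR3.
  have -> : ((B * c)^-1 ^+ p * (A * c ^+ 3)^-1 ^+ n)^-1 = (B * c) ^+ p * (A * c ^+ 3) ^+ n.
    by rewrite !exprVn -invfM invrK.
  have -> : K * c ^+ 3 * (sqrt_fact R p * sqrt_fact R n ^+ 3) * ((B * c) ^+ p * (A * c ^+ 3) ^+ n) =
    K * A ^+ n * B ^+ p * (sqrt_fact R n ^+ 3 * sqrt_fact R p) * c ^+ (3 * n + p + 3).
    have -> : (B * c) ^+ p = B ^+ p * c ^+ p by exact: exprMn.
    have -> : (A * c ^+ 3) ^+ n = A ^+ n * c ^+ (3 * n) by rewrite exprM; exact: exprMn.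
    rewrite !exprD; move: (sqrt_fact R p) (sqrt_fact R n ^+ 3) (A ^+ n) (B ^+ p) (c ^+ p) (c ^+ (3 * n)) (c ^+ 3) => x1 x2 x3 x4 x5 x6 x7; ring.
  apply: ler_wpM2l.
    apply: mulr_ge0; last by apply: mulr_ge0 => //; exact: exprn_ge0.
    by apply: mulr_ge0; [apply: mulr_ge0; [exact: ltW|]|]; apply: exprn_ge0; exact: ltW.
  by apply: lerXn2r => //; rewrite nnegrE ?invr_ge0 ?sqrtr_ge0 ?(ltW c0).
- exists D => // T T0; have [K [A [B [K0 A0 B0 HB]]]] := boundD T T0.
  exists K, A^-1, B^-1; split; rewrite ?invr_gt0// => p n t x.
  rewrite !in_itv/= => /andP[t0 tT] x01.
  apply: le_trans (HB p n t x t0 tT x01) _.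
  rewrite -sqrt_factE -sqrt_fact_powR3 -invsqrt_powR ?(ltW t0)// !exprVn !invrK.
  by rewrite le_eqVlt; apply/orP; left; apply/eqP; ring.
Qed.
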